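(* Let $s>\frac72$ and $f\in C^{[s]+1}(\mathbb{R})$ with $f(0)=0$. Let $\beta\in W^{1,1}(\mathbb{R})$ and let $\beta''=\nu$ be a finite measure on $\mathbb{R}$. Let $u\in C^1([0,T],H^s(\mathbb{R}))$ be the solution of the initial-value problem $$u_t+(\beta\ast f(u))_x=0,\quad x\in\mathbb{R},\ t>0,\qquad u(x,0)=\varphi(x),\quad x\in\mathbb{R},$$ with $\varphi\in H^s(\mathbb{R})$. For $h>0$ and $x_i=ih$, $i\in\mathbb{Z}$, let $\mathbf{u}_h\in C^1([0,T_h),l^\infty)$ be the solution, with maximal existence time $T_h$, of $$\frac{d\mathbf{v}}{dt}=-D\big(\bm{\beta}_h\ast f(\mathbf{v})\big),\qquad \bm{\beta}_h=(\beta(x_i))_{i\in\mathbb{Z}},$$ with initial data $\bm{\varphi}_h=(\varphi(x_i))_{i\in\mathbb{Z}}$. Let $\mathbf{u}(t)=(u(x_i,t))_{i\in\mathbb{Z}}$. Then there is some $h_0>0$ so that for $h\le h_0$ the maximal existence time $T_h$ of $\mathbf{u}_h$ is at least $T$ and $$\|\mathbf{u}(t)-\mathbf{u}_h(t)\|_{l^\infty}=\mathcal{O}(h^2)$$ for all $t\in[0,T]$.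
   Context: All functions are real-valued. $(\beta\ast v)(x)=\int_{\mathbb{R}}\beta(x-y)v(y)\,dy$ for functions. $W^{1,1}(\mathbb{R})$ is the space of $L^1$ functions with distributional derivative in $L^1$; point values of $\beta$ are those of its continuous representative. $\nu$ is a finite signed Borel measure and $\beta''$ is the distributional second derivative. $H^s(\mathbb{R})$ is the usual $L^2$-based Sobolev space of index $s$ on $\mathbb{R}$ (elements are identified with their continuous representatives), and $[s]$ is the largest integer less than or equal to $s$. $l^\infty$ is the Banach space of bounded doubly infinite real sequences $\mathbf{w}=(w_i)_{i\in\mathbb{Z}}$ with the sup-norm. For sequences, $(\mathbf{w}\ast\mathbf{v})_i=\sum_{j\in\mathbb{Z}}h\,w_{i-j}v_j$, $(D\mathbf{w})_i=\frac{1}{2h}(w_{i+1}-w_{i-1})$, and $f(\mathbf{v})=(f(v_i))_{i\in\mathbb{Z}}$. The constant implied by $\mathcal{O}(h^2)$ is independent of $h\in(0,h_0]$ and of $t\in[0,T]$. *)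

(* Defs.v *)
From HB Require Import structures.
From mathcomp Require Import all_boot all_order all_algebra.
From mathcomp Require Import all_classical all_reals all_analysis.

Set Implicit Arguments.
Unset Strict Implicit.
Unset Printing Implicit Defensive.

Import Order.TTheory GRing.Theory Num.Theory.
Import numFieldNormedType.Exports.

Local Open Scope classical_set_scope.
Local Open Scope ring_scope.

Definition class_C (R : realType) (k : nat) (f : R -> R) : Prop :=
  (forall n x, (n < k)%N -> derivable (f^`(n))%classic x 1) /\
  continuous (f^`(k))%classic.

Definition smooth (R : realType) (f : R -> R) : Prop :=
  forall n x, derivable (f^`(n))%classic x 1.

Definition test_function (R : realType) (phi : R -> R) : Prop :=
  smooth phi /\ exists M : R, forall x, M < `|x| -> phi x = 0.

Definition schwartz (R : realType) (phi : R -> R) : Prop :=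
  smooth phi /\
  forall k n : nat, exists M : R, forall x, `|x ^+ k * (phi^`(n))%classic x| <= M.

Definition convolution (R : realType) (b v : R -> R) (x : R) : R :=
  (\int[lebesgue_measure]_y (b (x - y) * v y))%R.

Definition weak_derivative (R : realType) (b g : R -> R) : Prop :=
  forall phi : R -> R, test_function phi ->
    (\int[lebesgue_measure]_x (b x * (phi^`())%classic x) =
     - \int[lebesgue_measure]_x (g x * phi x))%R.

Definition W11 (R : realType) : set (R -> R) :=
  [set b | b \in Lfun lebesgue_measure 1%E /\
     exists2 g : R -> R, g \in Lfun lebesgue_measure 1%E & weak_derivative b g].

(* The Jordan decomposition does not depend on the choice of the Hahn
   decomposition. *)
Definition charge_integral (R : realType)
    (nu : {charge set (measurableTypeR R) -> \bar R}) (g : R -> R) : R :=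
  let: exist P exN := cid (Hahn_decomposition nu) in
  let: exist N nuPN := cid exN in
  ((\int[jordan_pos nuPN]_x g x) - (\int[jordan_neg nuPN]_x g x))%R.

Definition second_distributional_derivative (R : realType) (b : R -> R)
    (nu : {charge set (measurableTypeR R) -> \bar R}) : Prop :=
  forall phi : R -> R, test_function phi ->
    (\int[lebesgue_measure]_x (b x * (phi^`(2))%classic x))%R =
    charge_integral nu phi.

(* [a + 'i b] is the Fourier transform, with kernel [exp (- 'i x xi)], of [v]
   in the sense of tempered distributions; real-valued Schwartz functions
   suffice for testing, by linearity. *)
Definition is_fourier (R : realType) (v a b : R -> R) : Prop :=
  forall phi : R -> R, schwartz phi ->
    (\int[lebesgue_measure]_xi (a xi * phi xi) =
     \int[lebesgue_measure]_x
       (v x * \int[lebesgue_measure]_xi (cos (x * xi) * phi xi)))%R /\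
    (\int[lebesgue_measure]_xi (b xi * phi xi) =
     - \int[lebesgue_measure]_x
       (v x * \int[lebesgue_measure]_xi (sin (x * xi) * phi xi)))%R.

(* The norm [|| (1 + xi^2)^(s/2) (F v)(xi) ||_2]: the Fourier transform is
   unique up to null sets, so the infimum is over at most one finite value; it
   is [+oo] if there is none. *)
Definition sobolev_norm (R : realType) (s : R) (v : R -> R) : \bar R :=
  ereal_inf [set r | exists a b : R -> R,
    [/\ measurable_fun setT a, measurable_fun setT b, is_fourier v a b &
        r = Lnorm lebesgue_measure 2%:E (fun xi : measurableTypeR R =>
              ((1 + xi ^+ 2) `^ (s / 2) *
               Num.sqrt (a xi ^+ 2 + b xi ^+ 2))%:E)]].

(* [H^s(R)] for [s > 1/2], each class being represented by its continuous
   element. As [s >= 0], it is a subspace of [L^2]; [v \in L^2] makes the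
   integrals in [is_fourier] meaningful. *)
Definition sobolev (R : realType) (s : R) : set (R -> R) :=
  [set v | [/\ continuous v, v \in Lfun lebesgue_measure 2%:E &
               (sobolev_norm s v < +oo)%E]].

Definition linf_norm (R : realType) (w : int -> R) : \bar R :=
  ereal_sup (range (fun i => `|w i|%:E)).

Definition linf (R : realType) : set (int -> R) :=
  [set w | (linf_norm w < +oo)%E].

(* [u] is a [C^1] curve on [I], with derivative [u'], in the normed space [E]
   of real functions on [X] with norm [N]; derivatives are one-sided at the
   endpoints of [I]. *)
Definition C1_curve (R : realType) (X : Type) (E : set (X -> R))
    (N : (X -> R) -> \bar R) (I : set R) (u u' : R -> X -> R) : Prop :=
  [/\ forall t, I t -> E (u t) /\ E (u' t),
      forall t, I t ->
        N (fun x => (u tau x - u t x) / (tau - t) - u' t x)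
          @[tau --> within I t^'] --> 0%E &
      forall t, I t ->
        N (fun x => u' tau x - u' t x) @[tau --> within I (nbhs t)] --> 0%E].

(* The sum of an absolutely convergent family. *)
Definition zsum (R : realType) (F : int -> R) : R :=
  fine (\esum_(j in [set: int]) (EFin \o F)^\+ j)%E -
  fine (\esum_(j in [set: int]) (EFin \o F)^\- j)%E.

Definition grid (R : realType) (h : R) (g : R -> R) : int -> R :=
  fun i => g (i%:~R * h).

Definition discrete_convolution (R : realType) (h : R) (w v : int -> R) :
    int -> R :=
  fun i => zsum (fun j => h * w (i - j) * v j).

Definition central_difference (R : realType) (h : R) (w : int -> R) :
    int -> R :=
  fun i => (2 * h)^-1 * (w (i + 1) - w (i - 1)).

Definition semidiscrete_solution (R : realType) (beta f phi : R -> R) (h : R)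
    (Th : \bar R) (v : R -> int -> R) : Prop :=
  v 0 = grid h phi /\
  C1_curve (@linf R) (@linf_norm R) [set t | 0 <= t /\ (t%:E < Th)%E] v
    (fun t i => - central_difference h
       (discrete_convolution h (grid h beta) (fun j => f (v t j))) i).

Definition maximal_semidiscrete_solution (R : realType) (beta f phi : R -> R)
    (h : R) (Th : \bar R) (v : R -> int -> R) : Prop :=
  [/\ (0 < Th)%E, semidiscrete_solution beta f phi h Th v &
      forall (Th' : \bar R) (w : R -> int -> R),
        semidiscrete_solution beta f phi h Th' w -> (Th' <= Th)%E].

(* Main.v *)
Require Import Defs.
From HB Require Import structures.
From mathcomp Require Import all_boot all_order all_algebra.
From mathcomp Require Import all_classical all_reals all_analysis.
From mathcomp Require Import measurable_realfun ring lra zify.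
Set Implicit Arguments.
Unset Strict Implicit.
Unset Printing Implicit Defensive.
Import Order.TTheory GRing.Theory Num.Theory.
Import numFieldNormedType.Exports.
Local Open Scope classical_set_scope.
Local Open Scope ring_scope.

(** The scheme is compared with the solution by consistency and stability; the
    work lies in obtaining both from a kernel that is not smooth.

    Stability. The difference operator can be moved onto the kernel, and the
    sums of [|beta (x + h) - beta x|] over a grid of mesh [h] are bounded
    independently of [h], because [beta] has an integrable derivative
    ([first_difference_variation], [discrete_operator_le]). So the right-hand
    side of the scheme is Lipschitz in the sup norm, with a constant independent
    of [h], as long as the values stay in a bounded set, and the error obeys a
    Gronwall inequality ([sup_norm_gronwall]).

    Consistency. For [g = f \o u t], the right-hand side of the scheme at the
    values of [g] is a Riemann sum for the convolution of [beta] with the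
    central difference quotient of [g]. The midpoint rule is of second order for
    it because the sums of second differences of [beta] with step [t] are of
    order [t]; this expresses that the second derivative of [beta] is a finite
    measure ([second_difference_variation], [midpoint_convolution]). The
    difference quotient itself costs another [h ^ 2], since [g] has three
    bounded derivatives ([discrete_convolution_consistency]).

    Regularity. Functions of Sobolev index above [7 / 2] have three bounded
    derivatives, by inversion of the Fourier transform ([fourier_inversion],
    [sobolev_embedding]). A curve that is differentiable in the Sobolev norm is
    locally Lipschitz for the bounds so obtained, and these are therefore
    uniform on the compact time interval ([sobolev_curve_bounded]).

    Existence. Replace [f] by [f \o clamp K], where [K] exceeds the supremum of
    [|u|] by [1]. The truncated system has a global solution [w]
    ([picard_lindelof]), and consistency and stability give
    [|u - w| <= C * h ^ 2] on [0, T] without any assumption on the size of [w]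
    ([truncated_scheme_error]). For small [h] this keeps [w] within [1 / 2] of
    [u] up to time [T], hence in [-K, K] slightly beyond [T], where it solves
    the original system ([truncated_semidiscrete_solution]). By maximality the
    solution of the scheme lives beyond [T], and by uniqueness it coincides
    there with [w] ([scheme_uniqueness]). *)

(** * Mean value inequalities *)

Lemma eq_ler (R : realType) (x y : R) : x = y -> x <= y.
Proof. by move->. Qed.

Lemma derive_le_increment (R : realType) (f g f' g' : R -> R) (a b : R) :
  a <= b ->
  (forall x : R, x \in `]a, b[ -> is_derive x 1 f (f' x)) ->
  (forall x : R, x \in `]a, b[ -> is_derive x 1 g (g' x)) ->
  {within `[a, b], continuous f} -> {within `[a, b], continuous g} ->
  (forall x : R, x \in `]a, b[ -> f' x <= g' x) ->
  f b - f a <= g b - g a.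
Proof.
rewrite le_eqVlt => /predU1P[->|ab] df dg cf cg fg; first by rewrite !subrr.
have dgf x : x \in `]a, b[ -> is_derive x 1 (g - f) (g' x - f' x).
  by move=> xab; have := df _ xab; have := dg _ xab => ? ?; exact: is_deriveB.
have cgf : {within `[a, b], continuous (g - f)}.
  by move=> x; apply: cvgB; [exact: cg|exact: cf].
have [c cab e] := MVT ab dgf cgf.
have : 0 <= (g - f) b - (g - f) a.
  rewrite e mulr_ge0 ?subr_ge0 ?fg//; exact: ltW.
by rewrite !fctE; lra.
Qed.

Lemma is_derive_continuous_at (R : realType) (f : R -> R) (x v : R) :
  is_derive x 1 f v -> {for x, continuous f}.
Proof.
by move=> ?; apply: differentiable_continuous; apply/derivable1_diffP; exact: ex_derive.
Qed.

Lemma is_derive_continuous (R : realType) (f f' : R -> R) :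
  (forall x : R, is_derive x 1 f (f' x)) -> continuous f.
Proof. by move=> df x; exact: is_derive_continuous_at (df x). Qed.

Lemma derive_bounded_increment (R : realType) (f f' g g' : R -> R) (a b : R) :
  a <= b ->
  (forall x : R, x \in `]a, b[ -> is_derive x 1 f (f' x)) ->
  (forall x : R, x \in `]a, b[ -> is_derive x 1 g (g' x)) ->
  {within `[a, b], continuous f} -> {within `[a, b], continuous g} ->
  (forall x : R, x \in `]a, b[ -> `|f' x| <= g' x) ->
  `|f b - f a| <= g b - g a.
Proof.
move=> ab df dg cf cg fg; rewrite ler_norml; apply/andP; split; last first.
  apply: (derive_le_increment ab df dg cf cg) => x /fg; exact: le_trans (ler_norm _).
have dNf x : x \in `]a, b[ -> is_derive x 1 (- f) (- f' x).
  by move=> /df ?; exact: is_deriveN.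
have cNf : {within `[a, b], continuous (- f)}.
  by move=> x; apply: cvgN; exact: cf.
have := derive_le_increment ab dNf dg cNf cg _.
rewrite !fctE lerNl => H.
rewrite [leLHS](_ : _ = (- f b - - f a)); first by apply: H => x /fg; apply: le_trans; rewrite -normrN ler_norm.
by lra.
Qed.

Lemma derive_lipschitz_on (R : realType) (f f' : R -> R) (a b M : R) :
  (forall x : R, a <= x <= b -> is_derive x 1 f (f' x)) ->
  (forall x : R, a <= x <= b -> `|f' x| <= M) ->
  forall x y : R, a <= x <= b -> a <= y <= b -> `|f x - f y| <= M * `|x - y|.
Proof.
move=> df Mf x y; wlog yx : x y / y <= x.
  move=> H xab yab; case/orP: (le_total y x) => yx; first exact: H.
  by rewrite distrC (distrC x); exact: H.
move=> /andP[_ xb] /andP[ay _].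
rewrite (ger0_norm (_ : 0 <= x - y)) ?subr_ge0// mulrBr.
have yxab (z : R) : y <= z <= x -> a <= z <= b.
  by move=> /andP[yz zx]; rewrite (le_trans ay yz) (le_trans zx xb).
have oo (z : R) : z \in `]y, x[ -> a <= z <= b.
  by rewrite in_itv/= => /andP[/ltW yz /ltW zx]; apply: yxab; rewrite yz.
apply: (@derive_bounded_increment _ f f' (fun x => M * x) (fun=> M)) => //.
- by move=> z /oo; exact: df.
- by move=> z _; apply: is_derive_eq; rewrite /GRing.scale/=; ring.
- apply: continuous_in_subspaceT => z; rewrite inE/= in_itv/= => /yxab/df.
  exact: is_derive_continuous_at.
- by apply: continuous_subspaceT => z; apply: cvgM; [exact: cvg_cst|exact: cvg_id].
- by move=> z /oo; exact: Mf.
Qed.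

Lemma derive_lipschitz (R : realType) (f f' : R -> R) (M : R) :
  (forall x : R, is_derive x 1 f (f' x)) -> (forall x, `|f' x| <= M) ->
  forall x y : R, `|f x - f y| <= M * `|x - y|.
Proof.
move=> df Mf x y.
have xm (z : R) : z <= Num.max `|x| `|y| -> - z <= Num.max `|x| `|y| ->
    - Num.max `|x| `|y| <= z <= Num.max `|x| `|y| by move=> z1 z2; rewrite lerNl z2.
apply: (@derive_lipschitz_on R f f' (- Num.max `|x| `|y|) (Num.max `|x| `|y|)) => //; apply: xm.
- by rewrite le_max ler_norm.
- by rewrite le_max -normrN ler_norm.
- by rewrite le_max ler_norm orbT.
- by rewrite le_max -(normrN y) ler_norm orbT.
Qed.

Lemma is_derive_add_arg (R : realType) (f : R -> R) (c x v : R) :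
  is_derive (c + x) 1 f v -> is_derive x 1 (fun t => f (c + t)) v.
Proof.
move=> df; have dl : is_derive x 1 (fun t : R => c + t) (0 + 1) by apply: is_deriveD.
have := @is_derive1_comp _ f (fun t => c + t) x _ _ df dl.
by rewrite add0r mulr1.
Qed.

Lemma is_derive_sub_arg (R : realType) (f : R -> R) (c x v : R) :
  is_derive (c - x) 1 f v -> is_derive x 1 (fun t => f (c - t)) (- v).
Proof.
move=> df; have dl : is_derive x 1 (fun t : R => c - t) (0 - 1) by apply: is_deriveB.
have := @is_derive1_comp _ f (fun t => c - t) x _ _ df dl.
by rewrite sub0r mulrN1.
Qed.

Lemma is_derive_scale_arg (R : realType) (f : R -> R) (c x v : R) :
  is_derive (c * x) 1 f v -> is_derive x 1 (fun t => f (c * t)) (c * v).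
Proof.
move=> df; have dl : is_derive x 1 (fun t : R => c * t) c.
  by apply: is_derive_eq; rewrite /GRing.scale/=; ring.
by have := @is_derive1_comp _ f (fun t => c * t) x _ _ df dl; rewrite mulrC.
Qed.

Lemma is_derive_translate (R : realType) (f f' : R -> R) (c : R) :
  (forall x : R, is_derive x 1 f (f' x)) ->
  forall x : R, is_derive x 1 (fun t => f (c + t)) (f' (c + x)).
Proof. by move=> df x; exact: is_derive_add_arg. Qed.

Lemma is_derive_reflect (R : realType) (f f' : R -> R) (c : R) :
  (forall x : R, is_derive x 1 f (f' x)) ->
  forall x : R, is_derive x 1 (fun t => f (c - t)) (- f' (c - x)).
Proof. by move=> df x; exact: is_derive_sub_arg. Qed.

(** The mean value inequality applied to [t |-> f (c + t) + f (c - t)], whose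
    derivative is a first difference of [f1]. *)
Lemma second_difference_le (R : realType) (f f1 f2 : R -> R) (M : R) :
  (forall x : R, is_derive x 1 f (f1 x)) -> (forall x : R, is_derive x 1 f1 (f2 x)) ->
  (forall x, `|f2 x| <= M) ->
  forall c t : R, 0 <= t -> `|f (c + t) + f (c - t) - 2 * f c| <= M * t ^+ 2.
Proof.
move=> d1 d2 Mf c t t0.
pose F s := f (c + s) + f (c - s).
have dF (x : R) : is_derive x 1 F (f1 (c + x) - f1 (c - x)).
  have := is_derive_translate c d1 x; have := is_derive_reflect c d1 x => ? ?.
  exact: is_deriveD.
have dG (x : R) : is_derive x 1 (fun x => M * x ^+ 2) (M * (2 * x)).
  by apply: is_derive_eq; rewrite /GRing.scale/=; ring.
have /= := @derive_bounded_increment _ F _ (fun x => M * x ^+ 2) _ 0 t t0 (fun x _ => dF x) (fun x _ => dG x) _ _ _.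
rewrite /F addr0 subr0 expr0n/= mulr0 subr0.
rewrite [f c + f c](_ : _ = 2 * f c); last by ring.
apply.
- by apply: continuous_subspaceT; exact: is_derive_continuous dF.
- by apply: continuous_subspaceT; exact: is_derive_continuous dG.
- move=> x; rewrite in_itv/= => /andP[x0 _].
  apply: le_trans (derive_lipschitz d2 Mf _ _) _.
  by rewrite (_ : c + x - (c - x) = 2 * x) ?ger0_norm; lra.
Qed.

Lemma central_difference_error (R : realType) (f f1 f2 f3 : R -> R) (M : R) :
  (forall x : R, is_derive x 1 f (f1 x)) -> (forall x : R, is_derive x 1 f1 (f2 x)) ->
  (forall x : R, is_derive x 1 f2 (f3 x)) -> (forall x, `|f3 x| <= M) ->
  forall c t : R, 0 < t -> `|(2 * t)^-1 * (f (c + t) - f (c - t)) - f1 c| <= M * t ^+ 2.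
Proof.
move=> d1 d2 d3 Mf c t t0.
pose F s := f (c + s) - f (c - s) - 2 * f1 c * s.
have dF (x : R) : is_derive x 1 F (f1 (c + x) + f1 (c - x) - 2 * f1 c).
  have := is_derive_translate c d1 x; have := is_derive_reflect c d1 x => ? ?.
  by apply: is_derive_eq; rewrite /GRing.scale/=; ring.
have dG (x : R) : is_derive x 1 (fun x => M * x ^+ 3 / 3) (M * x ^+ 2).
  by apply: is_derive_eq; rewrite /GRing.scale/=; field.
have /= := @derive_bounded_increment _ F _ (fun x => M * x ^+ 3 / 3) _ 0 t (ltW t0) (fun x _ => dF x) (fun x _ => dG x) _ _ _.
rewrite /F addr0 subr0 expr0n/= !(mulr0, mul0r, subrr, subr0) => H.
have {}H : `|f (c + t) - f (c - t) - 2 * f1 c * t| <= M * t ^+ 3 / 3.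
  apply: H.
  - by apply: continuous_subspaceT; exact: is_derive_continuous dF.
  - by apply: continuous_subspaceT; exact: is_derive_continuous dG.
  - move=> x; rewrite in_itv/= => /andP[/ltW x0 _].
    exact: second_difference_le d2 d3 Mf _ _ x0.
have -> : (2 * t)^-1 * (f (c + t) - f (c - t)) - f1 c =
  (2 * t)^-1 * (f (c + t) - f (c - t) - 2 * f1 c * t) by field; lra.
have M0 : 0 <= M by apply: le_trans (normr_ge0 _) (Mf 0).
rewrite normrM ger0_norm ?invr_ge0; last by lra.
apply: (@le_trans _ _ ((2 * t)^-1 * (M * t ^+ 3 / 3))).
  by rewrite ler_wpM2l// invr_ge0; lra.
have -> : (2 * t)^-1 * (M * t ^+ 3 / 3) = M * t ^+ 2 / 6 by field; lra.
have : 0 <= M * t ^+ 2 by rewrite mulr_ge0// sqr_ge0.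
lra.
Qed.

(** * A Gronwall inequality in the sup norm *)

Lemma is_derive_scaled_exp (R : realType) (a k x : R) :
  is_derive x 1 (fun t => a * expR (k * t)) (a * k * expR (k * x)).
Proof.
have ? := is_derive_scale_arg (is_derive_expR (k * x)).
by apply: is_derive_eq; rewrite /GRing.scale/=; ring.
Qed.

(** The sup norm of infinitely many components need not be differentiable in
    time, so the estimate is made on a number instead: the supremum [S], over
    times and components, of [|e t i| * exp (- 2 L t)]. Integrating the
    hypothesis on [e'] against this weight gives [S <= S / 2 + eps * T]. The
    a priori bound [B] makes [S] finite, so that half of it can be absorbed. *)
Lemma sup_norm_gronwall (R : realType) (I : Type) (L eps T B : R)
    (e e' : R -> I -> R) :
  0 < L -> 0 <= eps -> 0 < T ->
  (forall i, e 0 i = 0) ->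
  (forall i, {within `[0, T], continuous (e^~ i)}) ->
  (forall i (t : R), t \in `]0, T[ -> is_derive t 1 (e^~ i) (e' t i)) ->
  (forall i (t : R), t \in `[0, T] -> `|e t i| <= B) ->
  (forall t m : R, t \in `]0, T[ -> (forall i, `|e t i| <= m) ->
    forall i, `|e' t i| <= L * m + eps) ->
  forall i (t : R), t \in `[0, T] -> `|e t i| <= 2 * eps * T * expR (2 * L * T).
Proof.
move=> L0 eps0 T0 e0 ce de eB He i0 t0 t0T.
pose A := [set z : R | exists (t : R) i, t \in `[0, T] /\ z = `|e t i| * expR (- (2 * L * t))].
have A0 : A !=set0 by exists (`|e t0 i0| * expR (- (2 * L * t0))), t0, i0.
have Aub : ubound A B.
  move=> _ [t [i [tT ->]]]; have B0 := le_trans (normr_ge0 _) (eB i _ tT).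
  apply: le_trans (eB i _ tT); rewrite ler_piMr// expRN invf_le1 ?expR_gt0//.
  by rewrite -expR0 ler_expR; move: tT; rewrite in_itv/= => /andP[t1 _]; rewrite !mulr_ge0// ltW.
have hsA : has_sup A by split=> //; exists B.
set S := sup A.
have eS i (t : R) : t \in `[0, T] -> `|e t i| <= S * expR (2 * L * t).
  move=> tT; rewrite -ler_pdivrMr ?expR_gt0// -expRN.
  by apply: (sup_upper_bound hsA); exists t, i.
have S0 : 0 <= S.
  have := eS i0 0; rewrite in_itv/= lexx ltW// e0 normr0 => /(_ isT).
  by rewrite mulr0 expR0 mulr1.
have key i (t : R) : t \in `[0, T] -> `|e t i| <= S / 2 * (expR (2 * L * t) - 1) + eps * t.
  rewrite in_itv/= => /andP[t1 tT].
  pose g (t : R) := S / 2 * expR (2 * L * t) + eps * t.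
  pose g' (t : R) := L * (S * expR (2 * L * t)) + eps.
  have dg (x : R) : is_derive x 1 g (g' x).
    have ? := is_derive_scaled_exp (S / 2) (2 * L) x.
    have ? : is_derive x 1 (fun t : R => eps * t) eps.
      by apply: is_derive_eq; rewrite /GRing.scale/=; ring.
    by apply: is_derive_eq; rewrite /g'; field.
  have sub : `[0, t] `<=` `[0, T].
    by move=> x /=; rewrite !in_itv/= => /andP[-> xt]; exact: le_trans xt tT.
  suff : `|e t i - e 0 i| <= g t - g 0.
    by rewrite e0 subr0 /g !mulr0 expR0 mulr1 addr0 => /le_trans; apply; lra.
  have de' (x : R) : x \in `]0, t[ -> is_derive x 1 (e^~ i) (e' x i).
    move=> xt; apply: de; move: xt; rewrite !in_itv/= => /andP[-> xt].
    exact: lt_le_trans xt tT.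
  refine (@derive_bounded_increment _ (e^~ i) (e'^~ i) g g' 0 t t1 de' (fun x _ => dg x) _ _ _).
  - exact: continuous_subspaceW sub (ce i).
  - by apply: continuous_subspaceT; exact: is_derive_continuous dg.
  - move=> x xt; apply: He.
      by move: xt; rewrite !in_itv/= => /andP[-> xt]; exact: lt_le_trans xt tT.
    move=> j; apply: eS; move: xt; rewrite !in_itv/= => /andP[/ltW-> xt].
    by rewrite (le_trans (ltW xt)).
have S2 : S <= S / 2 + eps * T.
  apply: ge_sup => // _ [t [i [tT ->]]].
  rewrite expRN ler_pdivrMr ?expR_gt0//; apply: le_trans (key i _ tT) _.
  move: tT; rewrite in_itv/= => /andP[t1 tT].
  have e1 : 1 <= expR (2 * L * t) by rewrite -expR0 ler_expR !mulr_ge0// ltW.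
  have : eps * t <= eps * T * expR (2 * L * t).
    rewrite -mulrA ler_wpM2l//; apply: le_trans tT _; rewrite ler_peMr//; exact: ltW.
  by lra.
have S3 : S <= 2 * eps * T by lra.
apply: (le_trans (eS i0 t0 t0T)); apply: ler_pM => //.
rewrite ler_expR ler_wpM2l//; first by rewrite mulr_ge0// ltW.
by move: t0T; rewrite in_itv/= => /andP[].
Qed.

(** * Smooth functions *)

(** An inductive form of [n]-fold differentiability: closure under algebraic
    operations follows by induction, without computing iterated derivatives. *)
Fixpoint ndiff (R : realType) (n : nat) (f : R -> R) : Prop :=
  if n is m.+1 then
    exists2 f' : R -> R, (forall x : R, is_derive x 1 f (f' x)) & ndiff m f'
  else True.

Lemma derive1_is_derive (R : realType) (f f' : R -> R) :
  (forall x : R, is_derive x 1 f (f' x)) -> (f^`())%classic = f'.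
Proof.
by move=> df; apply/funext => x; rewrite derive1E; have ? := df x; rewrite derive_val.
Qed.

Lemma ndiff_smooth (R : realType) (f : R -> R) : (forall n, ndiff n f) -> smooth f.
Proof.
move=> H n x; have := H n.+1; elim: n f {H} x => [|n IHn] f x [f' df nf'].
  by have ? := df x; exact: ex_derive.
by rewrite derive1Sn (derive1_is_derive df); exact: IHn nf'.
Qed.

Lemma ndiffW (R : realType) n (f : R -> R) : ndiff n.+1 f -> ndiff n f.
Proof.
elim: n f => [//|n IHn] f [f' df nf']; exists f' => //; exact: IHn.
Qed.

Lemma ndiff_cst (R : realType) n (c : R) : ndiff n (fun _ : R => c).
Proof.
by elim: n c => [//|n IHn] c; exists (fun=> 0) => // x; exact: is_derive_cst.
Qed.

Lemma ndiffD (R : realType) n (f g : R -> R) :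
  ndiff n f -> ndiff n g -> ndiff n (fun x => f x + g x).
Proof.
elim: n f g => [//|n IHn] f g [f' df nf'] [g' dg ng'].
exists (fun x => f' x + g' x); last exact: IHn.
by move=> x; have := df x; have := dg x => ? ?; exact: is_deriveD.
Qed.

Lemma ndiffM (R : realType) n (f g : R -> R) :
  ndiff n f -> ndiff n g -> ndiff n (fun x => f x * g x).
Proof.
elim: n f g => [//|n IHn] f g nf ng.
have [f' df nf'] := nf; have [g' dg ng'] := ng.
exists (fun x => f x * g' x + f' x * g x).
  move=> x; have := df x; have := dg x => ? ?.
  by apply: is_derive_eq; rewrite /GRing.scale/=; ring.
by apply: ndiffD; apply: IHn => //; exact: ndiffW.
Qed.

Lemma ndiff_id (R : realType) n : ndiff n (fun x : R => x).
Proof.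
case: n => [//|n]; exists (fun=> 1); first by move=> x; exact: is_derive_id.
exact: ndiff_cst.
Qed.

Lemma ndiff_affine (R : realType) n (a b : R) (f : R -> R) :
  ndiff n f -> ndiff n (fun x => f (a * x + b)).
Proof.
elim: n f => [//|n IHn] f [f' df nf'].
exists (fun x => a * f' (a * x + b)).
  move=> x; have dl : is_derive x 1 (fun t : R => a * t + b) a.
    by apply: is_derive_eq; rewrite /GRing.scale/=; ring.
  have := @is_derive1_comp _ f (fun t => a * t + b) x _ _ (df _) dl.
  by rewrite mulrC.
by apply: ndiffM; [exact: ndiff_cst|exact: IHn].
Qed.

Lemma ndiff_sum (R : realType) n (m : nat) (f : nat -> R -> R) :
  (forall i, ndiff n (f i)) -> ndiff n (fun x => \sum_(i < m) f i x).
Proof.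
move=> nf; elim: m => [|m IHm].
  rewrite (_ : (fun x => _) = fun=> 0); first exact: ndiff_cst.
  by apply/funext => x; rewrite big_ord0.
rewrite (_ : (fun x => _) = fun x => \sum_(i < m) f i x + f m x).
  exact: ndiffD.
by apply/funext => x; rewrite big_ord_recr.
Qed.

Lemma ndiffV (R : realType) n (f : R -> R) :
  (forall x, f x != 0) -> ndiff n f -> ndiff n (fun x => (f x)^-1).
Proof.
move=> f0; elim: n => [//|n IHn] nf; have [f' df nf'] := nf.
exists (fun x => (-1 * f' x) * ((f x)^-1 * (f x)^-1)).
  move=> x; have := is_deriveV (f0 x) (df x) => H.
  by apply: (is_derive_eq H); rewrite /GRing.scale/= expr2 invfM; ring.
have ? := IHn (ndiffW nf).
apply: ndiffM; apply: ndiffM => //; exact: ndiff_cst.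
Qed.

(** The functions [y^-k * exp (- 1 / y)], extended by [0]: a family closed
    under differentiation up to linear combinations. *)
Definition flat_exp (R : realType) (k : nat) (y : R) : R :=
  if 0 < y then y ^- k * expR (- y^-1) else 0.

(** [exp (1 / y)] dominates the term of order [k + 1] of its series. The linear
    bound is what gives [flat_exp] a derivative at [0]. *)
Lemma flat_exp_le (R : realType) k (y : R) : `|flat_exp k y| <= (k.+1)`!%:R * `|y|.
Proof.
rewrite /flat_exp; case: ifPn => [y0|_]; last by rewrite normr0 mulr_ge0.
rewrite !ger0_norm ?mulr_ge0 ?expR_ge0 ?invr_ge0 ?exprn_ge0 ?(ltW y0)//.
have yV : 0 <= y^-1 by rewrite invr_ge0 ltW.
have := @expR_ge1Dxn R y^-1 k yV.
move=> H.
have f0 : 0 < (k.+1)`!%:R :> R by rewrite ltr0n fact_gt0.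
rewrite expRN ler_pdivrMr ?expR_gt0// -ler_pdivrMl ?mulr_gt0//.
have H' := le_trans (ler_wpDl ler01 (lexx _)) H.
apply: le_trans H'.
by apply: eq_ler; rewrite exprVn exprS; field; rewrite !gt_eqF ?exprn_gt0.
Qed.

Lemma flat_exp_is_derive (R : realType) k (y : R) :
  is_derive y 1 (flat_exp k) (flat_exp k.+2 y - k%:R * flat_exp k.+1 y).
Proof.
have [y0|y0|->] := ltrgt0P y.
- have H : is_derive y 1 (fun y : R => y ^- k * expR (- y^-1))
      (flat_exp k.+2 y - k%:R * flat_exp k.+1 y).
    have yn : y != 0 by rewrite gt_eqF.
    have di : is_derive y 1 (fun y : R => y) 1 by exact: is_derive_id.
    have dx : is_derive y 1 (fun y : R => y ^+ k) (k%:R * y ^+ k.-1).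
      have := is_deriveX k di; rewrite /GRing.scale/= mulr1.
      have <- : ((fun y : R => y) ^+ k : R -> R) = (fun y : R => y ^+ k) by apply: funext => z; rewrite exprfctE.
      by [].
    have dxV := @is_deriveV R (fun y : R => y ^+ k) y _ _ (expf_neq0 k yn) dx.
    have dV := is_deriveN (is_deriveV yn di).
    have dE := @is_derive1_comp _ expR (fun t : R => - t^-1) y _ _ (is_derive_expR _) dV.
    have dM := is_deriveM dxV dE.
    apply: (is_derive_eq dM); rewrite /flat_exp y0 /GRing.scale/=.
    case: k {dx dxV dM} => [|k]; first by rewrite /= !expr0 !expr1; field.
    by rewrite /= !exprS; field; rewrite yn expf_neq0.
  apply: near_eq_is_derive H; near=> z.
  have z0 : 0 < z by near: z; exact: lt_nbhsr.
  by rewrite /flat_exp z0.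
- have -> : flat_exp k.+2 y - k%:R * flat_exp k.+1 y = 0.
    by rewrite /flat_exp ltNge (ltW y0)/= mulr0 subr0.
  apply: near_eq_is_derive (is_derive_cst 0 y 1); near=> z.
  have z0 : z < 0 by near: z; exact: lt_nbhsl.
  by rewrite /flat_exp ltNge (ltW z0).
- have -> : flat_exp k.+2 0 - k%:R * flat_exp k.+1 0 = 0 :> R.
    by rewrite /flat_exp ltxx mulr0 subr0.
  apply/is_derive1_caratheodory; exists (flat_exp k.+1); split.
  + move=> z; rewrite /flat_exp ltxx !subr0; case: ifPn => [z0|]; last by rewrite mul0r.
    rewrite exprS invfM (mulrC z^-1) -!mulrA; congr (_ * _).
    by rewrite mulrCA mulVf ?mulr1 ?gt_eqF.
  + rewrite /prop_for/continuous_at /flat_exp ltxx -/(flat_exp _ _).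
    apply/cvgr0Pnorm_le => e e0.
    near=> z; apply: le_trans (flat_exp_le _ _) _.
    rewrite -ler_pdivlMl ?ltr0n ?fact_gt0//.
    near: z; apply/nbhs_ballP; exists ((k.+2)`!%:R^-1 * e) => /=.
      by rewrite mulr_gt0// invr_gt0 ltr0n fact_gt0.
    by move=> z; rewrite /ball/= sub0r normrN => /ltW.
  + by rewrite /flat_exp ltxx.
Unshelve. all: by end_near. Qed.

Lemma ndiff_flat_exp (R : realType) n k : ndiff n (@flat_exp R k).
Proof.
elim: n k => [//|n IHn] k.
exists (fun y => flat_exp k.+2 y + (- k%:R) * flat_exp k.+1 y).
  by move=> y; rewrite mulNr; exact: flat_exp_is_derive.
by apply: ndiffD => //; apply: ndiffM => //; exact: ndiff_cst.
Qed.

Lemma ndiff_continuous (R : realType) n (f : R -> R) : ndiff n.+1 f -> continuous f.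
Proof. by move=> [f' df _]; exact: is_derive_continuous df. Qed.

Definition smooth_step (R : realType) (y : R) : R :=
  flat_exp 0 y * (flat_exp 0 y + flat_exp 0 (-1 * y + 1))^-1.

Lemma flat_exp_gt0 (R : realType) (y : R) : 0 < y -> 0 < flat_exp 0 y.
Proof. by move=> y0; rewrite /flat_exp y0 mulr_gt0 ?expR_gt0// invr_gt0 exprn_gt0. Qed.

Lemma flat_exp_ge0 (R : realType) (y : R) : 0 <= flat_exp 0 y.
Proof.
by case: (ltP 0 y) => [/flat_exp_gt0/ltW//|y0]; rewrite /flat_exp ltNge y0.
Qed.

Lemma ndiff_smooth_step (R : realType) n : ndiff n (@smooth_step R).
Proof.
apply: ndiffM; first exact: ndiff_flat_exp.
apply: ndiffV; last first.
  by apply: ndiffD; [|apply: ndiff_affine]; exact: ndiff_flat_exp.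
move=> y; rewrite gt_eqF//.
have := flat_exp_ge0 y; have := flat_exp_ge0 (-1 * y + 1).
case: (ltP 0 y) => [/flat_exp_gt0|y0]; first lra.
have : 0 < -1 * y + 1 by lra.
by move=> /flat_exp_gt0; lra.
Qed.

Lemma smooth_step0 (R : realType) (y : R) : y <= 0 -> smooth_step y = 0.
Proof. by move=> y0; rewrite /smooth_step {1}/flat_exp ltNge y0 mul0r. Qed.

Lemma smooth_step1 (R : realType) (y : R) : 1 <= y -> smooth_step y = 1.
Proof.
move=> y1; rewrite /smooth_step [X in _ + X](_ : _ = 0).
  by rewrite addr0 mulfV// gt_eqF// flat_exp_gt0//; lra.
by rewrite /flat_exp ifF//; apply/negbTE; rewrite -leNgt; lra.
Qed.

Lemma compact_support_bounded (R : realType) (f : R -> R) (a b : R) :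
  continuous f -> (forall x, x <= a -> f x = f a) -> (forall x, b <= x -> f x = f b) ->
  a <= b -> exists2 M, 0 < M & forall x, `|f x| <= M.
Proof.
move=> cf fa fb ab.
have cnf : {within `[a, b], continuous (fun x => `|f x|)}.
  by apply: continuous_subspaceT => x; apply: cvg_norm; exact: cf.
have [c _ Hc] := EVT_max ab cnf.
exists (`|f c| + 1); first by rewrite ltr_wpDl.
move=> x; apply: (@le_trans _ _ `|f c|); last by rewrite lerDl.
case: (leP x a) => [/fa->|/ltW ax]; first by apply: Hc; rewrite in_itv/= lexx.
case: (leP b x) => [/fb->|/ltW xb]; first by apply: Hc; rewrite in_itv/= lexx ab.
by apply: Hc; rewrite in_itv/= ax.
Qed.

Lemma is_derive_near_unique (R : realType) (f g : R -> R) (x a b : R) :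
  is_derive x 1 f a -> is_derive x 1 g b -> (\near x, f x = g x) -> a = b.
Proof.
move=> df dg fg; have dg' := near_eq_is_derive fg df.
by rewrite -(@derive_val _ _ _ _ _ _ _ dg) (@derive_val _ _ _ _ _ _ _ dg').
Qed.

(** A smooth function equal to [0] on the left of [0] and to the identity on
    the right of [1]; its second derivative is a (signed) mollifier. *)
Lemma smooth_ramp (R : realType) : exists (r r1 r2 : R -> R) (C : R),
  [/\ 0 < C,
      [/\ forall n, ndiff n r, forall n, ndiff n r1 & forall n, ndiff n r2],
      (forall x : R, is_derive x 1 r (r1 x)) /\ (forall x : R, is_derive x 1 r1 (r2 x)),
      (forall x, x <= 0 -> [/\ r x = 0, r1 x = 0 & r2 x = 0]) /\
      (forall x, 1 <= x -> [/\ r x = x, r1 x = 1 & r2 x = 0]) &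
      forall x, `|r1 x| <= C /\ `|r2 x| <= C].
Proof.
pose r (x : R) := x * smooth_step x.
have nr n : ndiff n r by apply: ndiffM; [exact: ndiff_id|exact: ndiff_smooth_step].
have [r1 d1 _] := nr 1%N.
have nr1 n : ndiff n r1.
  have [r1' d1' ] := nr n.+1; congr (ndiff n _).
  by rewrite -(derive1_is_derive d1) -(derive1_is_derive d1').
have [r2 d2 _] := nr1 1%N.
have nr2 n : ndiff n r2.
  have [r2' d2' ] := nr1 n.+1; congr (ndiff n _).
  by rewrite -(derive1_is_derive d2) -(derive1_is_derive d2').
have c1 := is_derive_continuous d2.
have c2 : continuous r2 by exact: ndiff_continuous (nr2 1%N).
have r0 x : x <= 0 -> r x = 0 by move=> x0; rewrite /r smooth_step0 ?mulr0.
have rx x : 1 <= x -> r x = x by move=> x1; rewrite /r smooth_step1 ?mulr1.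
have clos (f : R -> R) (a c : R) : continuous f -> (forall x, x < a -> f x = c) -> f a = c.
  move=> cf H; apply: (@cvg_unique _ (@Rhausdorff R) (f x @[x --> a^'-])).
    by apply: cvg_at_left_filter; exact: cf.
  apply: cvg_near_cst; near=> x; apply: H; near: x; exact: nbhs_left_lt.
have clos' (f : R -> R) (a c : R) : continuous f -> (forall x, a < x -> f x = c) -> f a = c.
  move=> cf H; apply: (@cvg_unique _ (@Rhausdorff R) (f x @[x --> a^'+])).
    by apply: cvg_at_right_filter; exact: cf.
  apply: cvg_near_cst; near=> x; apply: H; near: x; exact: nbhs_right_gt.
have r10 x : x <= 0 -> r1 x = 0.
  have H z : z < 0 -> r1 z = 0.
    move=> z0; apply: (is_derive_near_unique (d1 z) (is_derive_cst 0 z 1)).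
    by near=> y; apply: r0; apply: ltW; near: y; exact: lt_nbhsl.
  by rewrite le_eqVlt => /predU1P[->|/H//]; exact: (clos _ _ _ c1 H).
have r11 x : 1 <= x -> r1 x = 1.
  have H z : 1 < z -> r1 z = 1.
    move=> z0; apply: (is_derive_near_unique (d1 z) (is_derive_id z 1)).
    by near=> y; apply: rx; apply: ltW; near: y; exact: lt_nbhsr.
  by rewrite le_eqVlt => /predU1P[<-|/H//]; exact: (clos' _ _ _ c1 H).
have r20 x : x <= 0 -> r2 x = 0.
  have H z : z < 0 -> r2 z = 0.
    move=> z0; apply: (is_derive_near_unique (d2 z) (is_derive_cst 0 z 1)).
    by near=> y; apply: r10; apply: ltW; near: y; exact: lt_nbhsl.
  by rewrite le_eqVlt => /predU1P[->|/H//]; exact: (clos _ _ _ c2 H).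
have r21 x : 1 <= x -> r2 x = 0.
  have H z : 1 < z -> r2 z = 0.
    move=> z0; apply: (is_derive_near_unique (d2 z) (is_derive_cst (1 : R) z 1)).
    by near=> y; apply: r11; apply: ltW; near: y; exact: lt_nbhsr.
  by rewrite le_eqVlt => /predU1P[<-|/H//]; exact: (clos' _ _ _ c2 H).
have [C1 C10 HC1] : exists2 M, 0 < M & forall x, `|r1 x| <= M.
  apply: (@compact_support_bounded _ r1 0 1) => // x Hx.
  by rewrite !r10.
  by rewrite !r11.
have [C2 C20 HC2] : exists2 M, 0 < M & forall x, `|r2 x| <= M.
  apply: (@compact_support_bounded _ r2 0 1) => // x Hx.
  by rewrite !r20.
  by rewrite !r21.
exists r, r1, r2, (C1 + C2); split => //; first by lra.
- by split=> x Hx; split; auto.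
- by move=> x; move: (HC1 x) (HC2 x); lra.
Unshelve. all: by end_near. Qed.

(** * Real-valued integrals *)

Local Notation L1 mu f := (mu.-integrable setT (EFin \o f)).

Section integral_tools.
Context d (T : measurableType d) (R : realType) (mu : {measure set T -> \bar R}).
Implicit Types f g : T -> R.

Lemma integrable_dominated f g :
  measurable_fun setT f -> (forall x, `|f x| <= g x) ->
  L1 mu g -> L1 mu f.
Proof.
move=> mf fg; apply: le_integrable => //; first exact/measurable_EFinP.
by move=> x _ /=; rewrite lee_fin (le_trans (fg x))// ler_norm.
Qed.

Lemma integrable_measurable f : L1 mu f -> measurable_fun setT f.
Proof. by move=> /measurable_int/measurable_EFinP. Qed.

Lemma integrable_boundedM f g (M : R) :
  measurable_fun setT f -> (forall x, `|f x| <= M) ->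
  L1 mu g -> L1 mu (fun x => f x * g x).
Proof.
move=> mf fM ig; apply: (@integrable_dominated _ (fun x => M * `|g x|)).
- by apply: measurable_funM => //; exact: integrable_measurable.
- by move=> x; rewrite normrM ler_wpM2r.
- exact: (integrableZl measurableT M (integrable_norm ig)).
Qed.

Lemma integrableDR f g : L1 mu f -> L1 mu g -> L1 mu (fun x => f x + g x).
Proof. by move=> If Ig; exact: (integrableD measurableT If Ig). Qed.

Lemma integrableBR f g : L1 mu f -> L1 mu g -> L1 mu (fun x => f x - g x).
Proof. by move=> If Ig; exact: (integrableB measurableT If Ig). Qed.

Lemma integrableZR (k : R) f : L1 mu f -> L1 mu (fun x => k * f x).
Proof. by move=> If; exact: (integrableZl measurableT k If). Qed.

Lemma normr_Rintegral_le f g :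
  measurable_fun setT f -> (forall x, `|f x| <= g x) ->
  L1 mu g ->
  `|\int[mu]_x f x| <= \int[mu]_x g x.
Proof.
move=> mf fg ig; have If := integrable_dominated mf fg ig.
apply: (le_trans (le_normr_Rintegral _ If)) => //.
by apply: le_Rintegral => //; exact: integrable_norm.
Qed.

Lemma integrable_sumR (n : nat) (F : nat -> T -> R) :
  (forall i, L1 mu (F i)) -> L1 mu (fun x => \sum_(i < n) F i x).
Proof.
move=> IF; have := @integrable_sum _ _ _ mu setT measurableT _ (index_enum 'I_n) predT
  (fun i x => (F i x)%:E) (fun i _ => IF i).
by apply: eq_integrable => // x _ /=; rewrite sumEFin.
Qed.

Lemma Rintegral_sumR (n : nat) (F : nat -> T -> R) :
  (forall i, L1 mu (F i)) ->
  \int[mu]_x (\sum_(i < n) F i x) = \sum_(i < n) \int[mu]_x F i x.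
Proof.
move=> IF; elim: n => [|n IHn].
  rewrite big_ord0; under eq_Rintegral do rewrite big_ord0.
  by rewrite Rintegral_cst ?mul0r.
rewrite big_ord_recr/= -IHn -RintegralD//; last exact: integrable_sumR.
by apply: eq_Rintegral => x _; rewrite big_ord_recr.
Qed.

End integral_tools.

Section compact_support_integral.
Context (R : realType).
Let mu := @lebesgue_measure R.

Lemma continuous_measurableT (g : R -> R) :
  continuous g -> measurable_fun setT (g : measurableTypeR R -> R).
Proof. by move=> cg; exact: continuous_measurable_fun. Qed.

Lemma support_patch (g : R -> R) (a b : R) :
  (forall x, x < a -> g x = 0) -> (forall x, b < x -> g x = 0) -> g \_ `[a, b] = g.
Proof.
move=> ga gb; apply/funext => x; rewrite patchE; case: ifPn => //.
rewrite notin_setE/= in_itv/= => /negP; rewrite negb_and -!ltNge.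
by case/orP => [/ga|/gb].
Qed.

Lemma compact_support_integrable (g : R -> R) (a b : R) :
  continuous g -> (forall x, x < a -> g x = 0) -> (forall x, b < x -> g x = 0) ->
  L1 mu g.
Proof.
move=> cg ga gb; have : mu.-integrable `[a, b] (EFin \o g).
  apply: continuous_compact_integrable; first exact: segment_compact.
  exact: continuous_subspaceT.
have [+ _] := @integrable_mkcond _ _ R mu `[a, b] (EFin \o g) (measurable_itv _).
move=> /[apply].
by rewrite restrict_EFin (support_patch ga gb).
Qed.

Lemma compact_support_Rintegral (g : R -> R) (a b : R) :
  (forall x, x < a -> g x = 0) -> (forall x, b < x -> g x = 0) ->
  \int[mu]_x g x = \int[mu]_(x in `[a, b]) g x.
Proof. by move=> ga gb; rewrite [RHS]Rintegral_mkcond (support_patch ga gb). Qed.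

Lemma FTC2_continuous (f F : R -> R) (a b : R) : a <= b -> continuous f ->
  (forall x : R, a <= x <= b -> is_derive x 1 F (f x)) ->
  \int[mu]_(x in `[a, b]) f x = F b - F a.
Proof.
rewrite le_eqVlt => /predU1P[<- _ _|ab cf dF].
  by rewrite set_itv1 Rintegral_set1 subrr.
have cF (x : R) : a <= x <= b -> {for x, continuous F}.
  by move=> /dF; exact: is_derive_continuous_at.
have oo (x : R) : x \in `]a, b[ -> a <= x <= b.
  by rewrite in_itv/= => /andP[/ltW-> /ltW->].
rewrite /Rintegral (@continuous_FTC2 R f F a b)//.
- exact: continuous_subspaceT.
- split => [x /oo/dF ?||].
  + exact: ex_derive.
  + by apply: cvg_at_right_filter; apply: cF; rewrite lexx ltW.
  + by apply: cvg_at_left_filter; apply: cF; rewrite lexx ltW.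
- by move=> x /oo/dF ?; rewrite derive1E derive_val.
Qed.

Lemma Rintegral_le_cst (f : R -> R) (a b M : R) : a <= b -> continuous f ->
  (forall x, a <= x <= b -> `|f x| <= M) ->
  `|\int[mu]_(x in `[a, b]) f x| <= M * (b - a).
Proof.
move=> ab cf fM.
have If (g : R -> R) : continuous g -> mu.-integrable `[a, b] (EFin \o g).
  move=> cg; apply: continuous_compact_integrable; first exact: segment_compact.
  exact: continuous_subspaceT.
apply: (le_trans (le_normr_Rintegral _ (If _ cf))) => //.
have <- : \int[mu]_(x in `[a, b]) M = M * (b - a).
  by rewrite Rintegral_cst//= /mu lebesgue_measure_itv/= lte_fin; case: ltP => //= ba; rewrite (le_anti (_ : a <= b <= a)) ?ab ?ba// subrr.
apply: le_Rintegral => //.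
- by apply: integrable_norm; exact: If.
- by apply: (If (fun=> M)) => x; exact: cvg_cst.
Qed.

End compact_support_integral.

Lemma charge_integral_le (R : realType)
    (nu : {charge set (measurableTypeR R) -> \bar R}) :
  exists2 B : R, 0 <= B & forall (g : R -> R) (M : R), continuous g ->
    (forall x, `|g x| <= M) -> `|charge_integral nu g| <= B * M.
Proof.
rewrite /charge_integral; case: (cid _) => P exN; case: (cid exN) => N nuPN.
exists (fine (jordan_pos nuPN setT) + fine (jordan_neg nuPN setT)).
  by rewrite addr_ge0// fine_ge0.
move=> g M cg gM; rewrite mulrDl; apply: (le_trans (ler_normB _ _)).
have mg := continuous_measurableT cg.
by apply: lerD; (apply: (le_trans (normr_Rintegral_le mg gM _));
  [exact: finite_measure_integrable_cst|rewrite Rintegral_cst// mulrC]).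
Qed.

(** * Variation of the kernel *)

Lemma sum_indicator_le1 (R : realType) (n : nat) (P : pred nat) :
  (forall i j, P i -> P j -> i = j) -> \sum_(i < n) (P i)%:R <= 1 :> R.
Proof.
move=> Pinj; elim: n => [|n IHn]; first by rewrite big_ord0.
rewrite big_ord_recr/=; case: (boolP (P n)) => Pn; last by rewrite addr0.
rewrite big1 ?add0r// => i _; case: (boolP (P i)) => // Pi.
by have := Pinj _ _ Pi Pn => e; have := ltn_ord i; rewrite e ltnn.
Qed.

(** Bumps of width [2 h] spaced by [h] overlap at most thrice. *)
Lemma sum_overlap (R : realType) (n : nat) (F : nat -> R) (M h x y : R) : 0 < h ->
  (forall i, `|F i| <= M) -> (forall i, F i != 0 -> x + i%:R * h < y < x + i%:R * h + 2 * h) ->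
  `|\sum_(i < n) F i| <= 3 * M.
Proof.
move=> h0 FM FS; have M0 : 0 <= M by exact: le_trans (normr_ge0 _) (FM 0%N).
have [[i0 Fi0]|/forallNP H] := pselect (exists i, F i != 0); last first.
  rewrite big1 ?normr0 ?mulr_ge0// => i _.
  by apply/eqP; apply/negPn/negP; exact: H.
have close i : F i != 0 -> [|| i == i0, i.+1 == i0 | i == i0.+1].
  move=> /FS/andP[a1 a2]; have /andP[b1 b2] := FS _ Fi0.
  have c1 : (i < i0 + 2)%N.
    rewrite -(ltr_nat R) natrD -(ltr_pM2r h0); lra.
  have c2 : (i0 < i + 2)%N.
    rewrite -(ltr_nat R) natrD -(ltr_pM2r h0); lra.
  lia.
apply: (le_trans (ler_norm_sum _ _ _)).
apply: (@le_trans _ _ (\sum_(i < n) (M * ((i == i0 :> nat)%:R + (i.+1 == i0)%:R + (i == i0.+1 :> nat)%:R)))).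
  apply: ler_sum => i _; case: (eqVneq (F i) 0) => [->|/close].
    by rewrite normr0 mulr_ge0// !addr_ge0.
  move=> /or3P c; apply: (le_trans (FM i)); rewrite ler_peMr//.
  by case: c => ->; rewrite -!natrD ler1n; lia.
rewrite -mulr_sumr mulrC ler_wpM2r// !big_split/=.
have -> : 3 = 1 + 1 + 1 :> R by ring.
apply: lerD; first apply: lerD.
- by apply: (@sum_indicator_le1 R n (fun i => i == i0)) => i j /eqP-> /eqP->.
- by apply: (@sum_indicator_le1 R n (fun i => i.+1 == i0)) => i j /eqP<- /eqP[].
- by apply: (@sum_indicator_le1 R n (fun i => i == i0.+1)) => i j /eqP-> /eqP->.
Qed.

Lemma ndiff_rescale (R : realType) n (m a : R) (f : R -> R) :
  ndiff n f -> ndiff n (fun y => f (m * (y - a))).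
Proof.
move=> nf; rewrite (_ : (fun y => _) = fun y => f (m * y + - (m * a))).
  exact: ndiff_affine.
by apply/funext => y; rewrite mulrBr.
Qed.

Lemma is_derive_rescale (R : realType) (m a : R) (f f' : R -> R) :
  (forall x : R, is_derive x 1 f (f' x)) ->
  forall x : R, is_derive x 1 (fun y => f (m * (y - a))) (m * f' (m * (x - a))).
Proof.
move=> df x; have dl : is_derive x 1 (fun t : R => m * (t - a)) m.
  by apply: is_derive_eq; rewrite /GRing.scale/=; ring.
have := @is_derive1_comp _ f (fun t => m * (t - a)) x _ _ (df _) dl.
by rewrite mulrC.
Qed.

Lemma is_derive_sumR (R : realType) (N : nat) (F F' : nat -> R -> R) (x : R) :
  (forall i, is_derive x 1 (F i) (F' i x)) ->
  is_derive x 1 (fun y => \sum_(i < N) F i y) (\sum_(i < N) F' i x).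
Proof.
move=> dF; elim: N => [|N IHN].
  rewrite big_ord0 (_ : (fun y => _) = cst 0); first exact: is_derive_cst.
  by apply/funext => y; rewrite big_ord0.
rewrite big_ord_recr (_ : (fun y => _) = (fun y => \sum_(i < N) F i y) + F N).
  by have ? := dF N; exact: is_deriveD.
by apply/funext => y; rewrite big_ord_recr.
Qed.

Lemma is_derive_combination (R : realType) (N : nat) (a : nat -> R) (F F' : nat -> R -> R) (x : R) :
  (forall i, is_derive x 1 (F i) (F' i x)) ->
  is_derive x 1 (fun y => \sum_(i < N) a i * F i y) (\sum_(i < N) a i * F' i x).
Proof.
move=> dF; exact: (@is_derive_sumR R N (fun i y => a i * F i y) (fun i y => a i * F' i y)).
Qed.

Lemma cvg_sumR (R : realType) (N : nat) (F : nat -> nat -> R) (l : nat -> R) :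
  (forall i, F i @ \oo --> l i) ->
  (fun k => \sum_(i < N) F i k) @ \oo --> \sum_(i < N) l i.
Proof.
move=> Fl; elim: N => [|N IHN].
  rewrite big_ord0 (_ : (fun k => _) = cst 0); first exact: cvg_cst.
  by apply/funext => y; rewrite big_ord0.
rewrite big_ord_recr (_ : (fun k => _) = (fun k => \sum_(i < N) F i k) + F N).
  by apply: cvgD => //; exact: Fl.
by apply/funext => y; rewrite big_ord_recr.
Qed.

Lemma sum_bumps_test_function (R : realType) (N : nat) (h x a b : R) (F : nat -> R -> R) :
  0 < h -> 0 <= a -> 0 <= b -> (forall n i, ndiff n (F i)) ->
  (forall i y, F i y != 0 -> x + i%:R * h - a < y < x + i%:R * h + b) ->
  test_function (fun y => \sum_(i < N) F i y).
Proof.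
move=> h0 a0 b0 nF FS; split; first by apply: ndiff_smooth => n; exact: ndiff_sum.
exists (`|x| + N%:R * h + a + b) => y Hy; rewrite big1// => i _.
apply/eqP; apply: contraTT Hy => /FS/andP[y1 y2]; rewrite -leNgt ler_norml.
have iN : i%:R * h <= N%:R * h by rewrite ler_wpM2r ?(ltW h0)// ler_nat ltnW.
have i0 : 0 <= i%:R * h by rewrite mulr_ge0// ltW.
have := ler_norm x; have := ler_norm (- x); rewrite normrN => n1 n2.
by apply/andP; split; lra.
Qed.

Section kernel_variation.
Variables (R : realType) (beta : R -> R).
Hypothesis cbeta : continuous beta.
Let mu := @lebesgue_measure R.

Variables (r r1 r2 : R -> R) (C : R).
Hypothesis C0 : 0 < C.
Hypothesis nr : forall n, ndiff n r.
Hypothesis nr1 : forall n, ndiff n r1.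
Hypothesis nr2 : forall n, ndiff n r2.
Hypothesis dr : forall x : R, is_derive x 1 r (r1 x).
Hypothesis dr1 : forall x : R, is_derive x 1 r1 (r2 x).
Hypothesis r_left : forall x, x <= 0 -> [/\ r x = 0, r1 x = 0 & r2 x = 0].
Hypothesis r_right : forall x, 1 <= x -> [/\ r x = x, r1 x = 1 & r2 x = 0].
Hypothesis r_bound : forall x, `|r1 x| <= C /\ `|r2 x| <= C.

(** A Dirac sequence at [c] as [m] grows: its integral is [r1 1 - r1 0 = 1]. It
    may change sign, and converges because [r2] is bounded by [C]. *)
Let moll (m c y : R) := m * r2 (m * (y - c)).

Local Lemma continuous_moll (m c : R) : continuous (moll m c).
Proof.
by apply: (@ndiff_continuous _ 0); apply: ndiffM; [exact: ndiff_cst|exact: ndiff_rescale].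
Qed.

Local Lemma moll_support (m c : R) : 0 < m ->
  (forall y, y < c -> moll m c y = 0) /\ (forall y, c + m^-1 < y -> moll m c y = 0).
Proof.
move=> m0; split => y yc; rewrite /moll.
  have [|_ _ ->] := r_left (_ : m * (y - c) <= 0); last by rewrite mulr0.
  by rewrite pmulr_rle0// subr_le0 ltW.
have [|_ _ ->] := r_right (_ : 1 <= m * (y - c)); last by rewrite mulr0.
by rewrite -ler_pdivrMl// mulr1 lerBrDl ltW.
Qed.

Local Lemma integrable_moll (m c : R) : 0 < m ->
  L1 mu (fun y => beta y * moll m c y).
Proof.
move=> m0; have [ml mr] := moll_support c m0.
apply: (@compact_support_integrable _ _ c (c + m^-1)).
- by move=> y; apply: cvgM; [exact: cbeta|exact: continuous_moll].
- by move=> y /ml ->; rewrite mulr0.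
- by move=> y /mr ->; rewrite mulr0.
Qed.

Local Lemma moll_cvg (c : R) :
  (fun k => \int[mu]_y (beta y * moll k.+1%:R c y)) @ \oo --> beta c.
Proof.
apply/cvgrPdist_le => e e0.
have /cvgrPdist_le/(_ (e / C)) := @cbeta c; rewrite divr_gt0// => /(_ isT) [/= delta d0 Hd].
near=> k.
have md : k.+1%:R^-1 < delta by near: k; exact: near_infty_natSinv_lt (PosNum d0).
have [m [m0 {}md mE]] : exists m : R, [/\ 0 < m, m^-1 < delta & m = k.+1%:R] by exists k.+1%:R.
rewrite -mE.
have [ml mr] := moll_support c m0.
have cm1 : c < c + m^-1 by rewrite ltrDl invr_gt0.
rewrite (@compact_support_Rintegral _ _ c (c + m^-1)); last 2 first.
  by move=> y /ml ->; rewrite mulr0.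
  by move=> y /mr ->; rewrite mulr0.
have If (g : R -> R) : continuous g -> mu.-integrable `[c, c + m^-1] (EFin \o g).
  move=> cg; apply: continuous_compact_integrable; first exact: segment_compact.
  exact: continuous_subspaceT.
have int1 : \int[mu]_(y in `[c, c + m^-1]) moll m c y = 1.
  have d (x : R) : is_derive x 1 (fun y => r1 (m * (y - c))) (moll m c x).
    exact: is_derive_rescale.
  rewrite (FTC2_continuous (ltW cm1) (@continuous_moll m c) (fun x _ => d x)).
  rewrite subrr mulr0 addrAC subrr add0r mulfV ?gt_eqF//.
  by have [_ -> _] := r_left (lexx 0); have [_ -> _] := r_right (lexx 1); rewrite subr0.
have cbm : continuous (fun y => beta y * moll m c y).
  by move=> y; apply: cvgM; [exact: cbeta|exact: continuous_moll].
rewrite -[X in X - _]mulr1 -int1 -RintegralZl//; last exact/If/continuous_moll.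
rewrite -RintegralB//; [|apply: If|exact: If]; last first.
  by move=> y; apply: cvgM; [exact: cvg_cst|exact: continuous_moll].
apply: le_trans (Rintegral_le_cst (M := e / C * (m * C)) (ltW cm1) _ _) _.
- move=> y; apply: cvgB; last exact: cbm.
  by apply: cvgM; [exact: cvg_cst|exact: continuous_moll].
- move=> y /andP[cy yc]; rewrite -mulrBl normrM; apply: ler_pM => //.
    apply: Hd; rewrite /ball/= distrC ger0_norm ?subr_ge0//.
    by apply: le_lt_trans md; rewrite lerBlDl.
  by rewrite normrM (gtr0_norm m0) ler_wpM2l ?(ltW m0)//; have [] := r_bound (m * (y - c)).
by rewrite (_ : e / C * (m * C) * (c + m^-1 - c) = e)//; field; rewrite !gt_eqF.
Unshelve. all: by end_near. Qed.

(** The measure [nu] is tested against [phi], the sum over the nodes [c i] of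
    the second differences, with step [t], of the ramp [r (m y) / m], each with
    the sign of the second difference of [beta] at [c i]. The second derivative
    of [phi] is made of mollifiers, so that its integral against [beta] tends to
    the sum to be bounded. On the other hand [|phi| <= 6 C t], since ramps are
    [C]-Lipschitz and at most three of the summands overlap at a point. *)
Lemma second_difference_variation_aux (nu : {charge set (measurableTypeR R) -> \bar R}) :
  second_distributional_derivative beta nu ->
  exists2 B : R, 0 <= B & forall (h x t : R) (N : nat), 0 < h -> 0 <= t <= h / 2 ->
    \sum_(i < N) `|beta (x + i%:R * h + t) + beta (x + i%:R * h - t)
                   - 2 * beta (x + i%:R * h)| <= B * t.
Proof.
move=> hnu; have [B B0 HB] := charge_integral_le nu.
exists (B * (3 * (2 * C))); first by rewrite !mulr_ge0// ltW.
move=> h x t N h0 /andP[t0 th].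
pose c (i : nat) : R := x + i%:R * h.
pose d2 (i : nat) := beta (c i + t) + beta (c i - t) - 2 * beta (c i).
pose sg (i : nat) : R := Num.sg (d2 i).
rewrite (eq_bigr (fun i : 'I_N => sg i * d2 i)); last first.
  by move=> i _; rewrite -[LHS]/(`|d2 i|) normrEsg.
pose mm (k : nat) c := \int[mu]_y (beta y * moll k.+1%:R c y).
pose G k := \sum_(i < N) sg i * (mm k (c i + t) + mm k (c i - t) - 2 * mm k (c i)).
have cG : G @ \oo --> \sum_(i < N) sg i * d2 i.
  apply: (@cvg_sumR _ N (fun i k => sg i * (mm k (c i + t) + mm k (c i - t) - 2 * mm k (c i))) (fun i => sg i * d2 i)) => i; apply: cvgM; first exact: cvg_cst.
  apply: cvgB; first by apply: cvgD; exact: moll_cvg.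
  by apply: cvgM; [exact: cvg_cst|exact: moll_cvg].
suff GB : \forall k \near \oo, G k <= B * (3 * (2 * C)) * t.
  by rewrite -(cvg_lim (@Rhausdorff R) cG); apply: limr_le => //; apply: cvgP cG.
near=> k.
have mh : k.+1%:R^-1 < h by near: k; exact: near_infty_natSinv_lt (PosNum h0).
have [m [m0 {}mh mE]] : exists m : R, [/\ 0 < m, m^-1 < h & m = k.+1%:R] by exists k.+1%:R.
rewrite /G /mm -mE.
pose tau (c y : R) := m^-1 * (r (m * (y - (c + t))) + r (m * (y - (c - t))) - 2 * r (m * (y - c))).
pose tau1 (c y : R) := r1 (m * (y - (c + t))) + r1 (m * (y - (c - t))) - 2 * r1 (m * (y - c)).
pose tau2 (c y : R) := moll m (c + t) y + moll m (c - t) y - 2 * moll m c y.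
have dtau c0 (y : R) : is_derive y 1 (tau c0) (tau1 c0 y).
  have ? := is_derive_rescale m (c0 + t) dr y.
  have ? := is_derive_rescale m (c0 - t) dr y.
  have ? := is_derive_rescale m c0 dr y.
  apply: is_derive_eq; rewrite /GRing.scale/= /tau1.
  by field; rewrite gt_eqF.
have dtau1 c0 (y : R) : is_derive y 1 (tau1 c0) (tau2 c0 y).
  have ? := is_derive_rescale m (c0 + t) dr1 y.
  have ? := is_derive_rescale m (c0 - t) dr1 y.
  have ? := is_derive_rescale m c0 dr1 y.
  by apply: is_derive_eq; rewrite /GRing.scale/= /tau2 /moll; ring.
have ntau n c0 : ndiff n (tau c0).
  apply: ndiffM; first exact: ndiff_cst.
  apply: ndiffD; first by apply: ndiffD; exact: ndiff_rescale.
  rewrite (_ : (fun y => _) = fun y => (- 2) * r (m * (y - c0))).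
    by apply: ndiffM; [exact: ndiff_cst|exact: ndiff_rescale].
  by apply/funext => y; rewrite mulNr.
have tau_supp c0 y : tau c0 y != 0 -> c0 - t < y < c0 + t + m^-1.
  apply: contraR; rewrite negb_and -!leNgt => /orP[] Hy; rewrite /tau.
    have [|-> _ _] := r_left (_ : m * (y - (c0 + t)) <= 0); first by rewrite pmulr_rle0//; lra.
    have [|-> _ _] := r_left (_ : m * (y - (c0 - t)) <= 0); first by rewrite pmulr_rle0//; lra.
    have [|-> _ _] := r_left (_ : m * (y - c0) <= 0); first by rewrite pmulr_rle0//; lra.
    by rewrite mulr0 addr0 subrr mulr0.
  have mV : 0 < m^-1 by rewrite invr_gt0.
  have ge1 z : m^-1 <= z -> 1 <= m * z by move=> zm; rewrite -ler_pdivrMl// mulr1.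
  have [|-> _ _] := r_right (_ : 1 <= m * (y - (c0 + t))); first by apply: ge1; lra.
  have [|-> _ _] := r_right (_ : 1 <= m * (y - (c0 - t))); first by apply: ge1; lra.
  have [|-> _ _] := r_right (_ : 1 <= m * (y - c0)); first by apply: ge1; lra.
  by apply/eqP; ring.
have tau_bound c0 y : `|tau c0 y| <= 2 * C * t.
  have rl := derive_lipschitz dr (fun x => (r_bound x).1).
  rewrite /tau normrM gtr0_norm ?invr_gt0// ler_pdivrMl//.
  rewrite (_ : _ - _ = (r (m * (y - (c0 + t))) - r (m * (y - c0))) + (r (m * (y - (c0 - t))) - r (m * (y - c0)))); last by ring.
  apply: (le_trans (ler_normD _ _)).
  have := rl (m * (y - (c0 + t))) (m * (y - c0)).
  rewrite (_ : m * (y - (c0 + t)) - m * (y - c0) = - (m * t)); last by ring.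
  have := rl (m * (y - (c0 - t))) (m * (y - c0)).
  rewrite (_ : m * (y - (c0 - t)) - m * (y - c0) = m * t); last by ring.
  rewrite normrN (@ger0_norm _ (m * t)) ?mulr_ge0 ?(ltW m0)//.
  by lra.
pose phi y := \sum_(i < N) sg i * tau (c i) y.
pose phi1 y := \sum_(i < N) sg i * tau1 (c i) y.
pose phi2 y := \sum_(i < N) sg i * tau2 (c i) y.
have sg1 i : `|sg i| <= 1 by rewrite normr_sg lern1; case: (_ != _).
have dphi (y : R) : is_derive y 1 phi (phi1 y).
  exact: (@is_derive_combination R N sg (fun i => tau (c i)) (fun i => tau1 (c i))) (fun i => dtau (c i) y).
have dphi1 (y : R) : is_derive y 1 phi1 (phi2 y).
  exact: (@is_derive_combination R N sg (fun i => tau1 (c i)) (fun i => tau2 (c i))) (fun i => dtau1 (c i) y).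
have phi_bound y : `|phi y| <= 3 * (2 * C * t).
  apply: (@sum_overlap _ N (fun i => sg i * tau (c i) y) _ h (x - t) y h0).
    by move=> i; rewrite normrM -[leRHS]mul1r; exact: ler_pM.
  move=> i; rewrite mulf_eq0 negb_or => /andP[_ /tau_supp]; rewrite /c; lra.
have tphi : test_function phi.
  apply: (@sum_bumps_test_function _ N h x t (t + m^-1) (fun i y => sg i * tau (c i) y)) => //.
  - by rewrite addr_ge0// invr_ge0 ltW.
  - by move=> n i; apply: ndiffM => //; exact: ndiff_cst.
  - by move=> i y; rewrite mulf_eq0 negb_or addrA => /andP[_ /tau_supp].
have := hnu phi tphi; rewrite derive1Sn (derive1_is_derive dphi) derive1n1 (derive1_is_derive dphi1).
have -> : \int[mu]_x0 (beta x0 * phi2 x0) = \sum_(i < N) sg i * (\int[mu]_y (beta y * moll m (c i + t) y) + \int[mu]_y (beta y * moll m (c i - t) y) - 2 * \int[mu]_y (beta y * moll m (c i) y)).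
  pose v i y := beta y * moll m (c i + t) y + beta y * moll m (c i - t) y.
  pose w i y := v i y - 2 * (beta y * moll m (c i) y).
  have -> : (fun y => beta y * phi2 y) = (fun y => \sum_(i < N) sg i * w i y).
    by apply/funext => y; rewrite /phi2 mulr_sumr; apply: eq_bigr => i _; rewrite /tau2 /w /v; ring.
  have Iv i : L1 mu (v i) by apply: integrableDR; exact: integrable_moll.
  have I2 i : L1 mu (fun y => 2 * (beta y * moll m (c i) y)).
    by apply: integrableZR => //; exact: integrable_moll.
  have Iw i : L1 mu (w i) by exact: integrableBR.
  rewrite (@Rintegral_sumR _ _ _ mu N (fun i y => sg i * w i y)) => [|i]; last exact: integrableZR.
  apply: eq_bigr => i _; rewrite RintegralZl// RintegralB// RintegralD//; try exact: integrable_moll.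
  by rewrite RintegralZl//; exact: integrable_moll.
move=> ->; apply: (le_trans (ler_norm _)).
have := HB phi _ (is_derive_continuous dphi) phi_bound.
by rewrite -!mulrA.
Unshelve. all: by end_near. Qed.

(** The same with first differences of the steps [r1 (m y)] as test functions:
    these are bounded, and the weak derivative of [beta] is integrable. *)
Lemma first_difference_variation_aux (g : R -> R) :
  g \in Lfun mu 1%E -> weak_derivative beta g ->
  exists2 B : R, 0 <= B & forall (h x t : R) (N : nat), 0 < h -> 0 <= t <= h ->
    \sum_(i < N) `|beta (x + i%:R * h + t) - beta (x + i%:R * h)| <= B.
Proof.
move=> /Lfun1_integrable ig hg.
have ing := integrable_norm ig.
exists (3 * (2 * C) * \int[mu]_y `|g y|).
  by rewrite !mulr_ge0// ?(ltW C0)// Rintegral_ge0.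
move=> h x t N h0 /andP[t0 th].
pose c (i : nat) : R := x + i%:R * h.
pose d1 (i : nat) := beta (c i + t) - beta (c i).
pose sg (i : nat) : R := Num.sg (d1 i).
rewrite (eq_bigr (fun i : 'I_N => sg i * d1 i)); last first.
  by move=> i _; rewrite -[LHS]/(`|d1 i|) normrEsg.
pose mm (k : nat) c := \int[mu]_y (beta y * moll k.+1%:R c y).
pose G k := \sum_(i < N) sg i * (mm k (c i + t) - mm k (c i)).
have cG : G @ \oo --> \sum_(i < N) sg i * d1 i.
  apply: (@cvg_sumR _ N (fun i k => sg i * (mm k (c i + t) - mm k (c i))) (fun i => sg i * d1 i)) => i; apply: cvgM; first exact: cvg_cst.
  by apply: cvgB; exact: moll_cvg.
suff GB : \forall k \near \oo, G k <= 3 * (2 * C) * \int[mu]_y `|g y|.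
  by rewrite -(cvg_lim (@Rhausdorff R) cG); apply: limr_le => //; apply: cvgP cG.
near=> k.
have mh : k.+1%:R^-1 < h by near: k; exact: near_infty_natSinv_lt (PosNum h0).
have [m [m0 {}mh mE]] : exists m : R, [/\ 0 < m, m^-1 < h & m = k.+1%:R] by exists k.+1%:R.
rewrite /G /mm -mE.
pose tau1 (c y : R) := r1 (m * (y - (c + t))) - r1 (m * (y - c)).
pose tau2 (c y : R) := moll m (c + t) y - moll m c y.
have dtau1 c0 (y : R) : is_derive y 1 (tau1 c0) (tau2 c0 y).
  have ? := is_derive_rescale m (c0 + t) dr1 y.
  have ? := is_derive_rescale m c0 dr1 y.
  by apply: is_derive_eq; rewrite /GRing.scale/= /tau2 /moll; ring.
have ntau n c0 : ndiff n (tau1 c0).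
  apply: ndiffD; first exact: ndiff_rescale.
  rewrite (_ : (fun y => _) = fun y => (- 1) * r1 (m * (y - c0))).
    by apply: ndiffM; [exact: ndiff_cst|exact: ndiff_rescale].
  by apply/funext => y; rewrite mulN1r.
have tau_supp c0 y : tau1 c0 y != 0 -> c0 < y < c0 + t + m^-1.
  apply: contraR; rewrite negb_and -!leNgt => /orP[] Hy; rewrite /tau1.
    have [|_ -> _] := r_left (_ : m * (y - (c0 + t)) <= 0); first by rewrite pmulr_rle0//; lra.
    have [|_ -> _] := r_left (_ : m * (y - c0) <= 0); first by rewrite pmulr_rle0//; lra.
    by rewrite subrr.
  have mV : 0 < m^-1 by rewrite invr_gt0.
  have ge1 z : m^-1 <= z -> 1 <= m * z by move=> zm; rewrite -ler_pdivrMl// mulr1.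
  have [|_ -> _] := r_right (_ : 1 <= m * (y - (c0 + t))); first by apply: ge1; lra.
  have [|_ -> _] := r_right (_ : 1 <= m * (y - c0)); first by apply: ge1; lra.
  by rewrite subrr.
have tau_bound c0 y : `|tau1 c0 y| <= 2 * C.
  apply: (le_trans (ler_normB _ _)).
  have := (r_bound (m * (y - (c0 + t)))).1; have := (r_bound (m * (y - c0))).1.
  by lra.
pose phi1 y := \sum_(i < N) sg i * tau1 (c i) y.
pose phi2 y := \sum_(i < N) sg i * tau2 (c i) y.
have sg1 i : `|sg i| <= 1 by rewrite normr_sg lern1; case: (_ != _).
have dphi1 (y : R) : is_derive y 1 phi1 (phi2 y).
  exact: (@is_derive_combination R N sg (fun i => tau1 (c i)) (fun i => tau2 (c i))) (fun i => dtau1 (c i) y).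
have phi_bound y : `|phi1 y| <= 3 * (2 * C).
  apply: (@sum_overlap _ N (fun i => sg i * tau1 (c i) y) _ h x y h0).
    by move=> i; rewrite normrM -[leRHS]mul1r; exact: ler_pM.
  move=> i; rewrite mulf_eq0 negb_or => /andP[_ /tau_supp]; rewrite /c; lra.
have tphi : test_function phi1.
  apply: (@sum_bumps_test_function _ N h x 0 (t + m^-1) (fun i y => sg i * tau1 (c i) y)) => //.
  - by rewrite addr_ge0// invr_ge0 ltW.
  - by move=> n i; apply: ndiffM => //; exact: ndiff_cst.
  - by move=> i y; rewrite mulf_eq0 negb_or addrA subr0 => /andP[_ /tau_supp].
have := hg phi1 tphi; rewrite (derive1_is_derive dphi1).
have -> : \int[mu]_x0 (beta x0 * phi2 x0) = \sum_(i < N) sg i * (\int[mu]_y (beta y * moll m (c i + t) y) - \int[mu]_y (beta y * moll m (c i) y)).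
  pose w i y := beta y * moll m (c i + t) y - beta y * moll m (c i) y.
  have -> : (fun y => beta y * phi2 y) = (fun y => \sum_(i < N) sg i * w i y).
    by apply/funext => y; rewrite /phi2 mulr_sumr; apply: eq_bigr => i _; rewrite /tau2 /w; ring.
  have Iw i : L1 mu (w i) by apply: integrableBR; exact: integrable_moll.
  rewrite (@Rintegral_sumR _ _ _ mu N (fun i y => sg i * w i y)) => [|i]; last exact: integrableZR.
  by apply: eq_bigr => i _; rewrite RintegralZl// RintegralB//; exact: integrable_moll.
move=> ->; apply: (le_trans (ler_norm _)); rewrite normrN -RintegralZl//.
apply: normr_Rintegral_le.
- apply: measurable_funM; first exact: integrable_measurable ig.
  exact: continuous_measurableT (is_derive_continuous dphi1).
- by move=> y; rewrite normrM mulrC ler_wpM2r.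
- exact: integrableZR.
Unshelve. all: by end_near. Qed.

End kernel_variation.

Lemma second_difference_variation (R : realType) (beta : R -> R)
    (nu : {charge set (measurableTypeR R) -> \bar R}) :
  continuous beta -> second_distributional_derivative beta nu ->
  exists2 B : R, 0 <= B & forall (h x t : R) (N : nat), 0 < h -> 0 <= t <= h / 2 ->
    \sum_(i < N) `|beta (x + i%:R * h + t) + beta (x + i%:R * h - t)
                   - 2 * beta (x + i%:R * h)| <= B * t.
Proof.
move=> cb; have [r [r1 [r2 [C [C0 [n0 n1 n2] [d0 d1] [s0 s1] b]]]]] := smooth_ramp R.
move=> hnu.
eapply (@second_difference_variation_aux R beta cb r r1 r2 C); eassumption.
Qed.

Lemma first_difference_variation (R : realType) (beta : R -> R) :
  continuous beta -> W11 beta ->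
  exists2 B : R, 0 <= B & forall (h x t : R) (N : nat), 0 < h -> 0 <= t <= h ->
    \sum_(i < N) `|beta (x + i%:R * h + t) - beta (x + i%:R * h)| <= B.
Proof.
move=> cb [_ [g g1 wg]].
have [r [r1 [r2 [C [C0 [n0 n1 n2] [d0 d1] [s0 s1] b]]]]] := smooth_ramp R.
eapply (@first_difference_variation_aux R beta cb r r1 r2 C); eassumption.
Qed.

(** * Sums over the integers *)

(** Running from [- N] to [N - 1], the range splits evenly between the two
    constructors of [int]. *)
Definition zpart (R : realType) (F : int -> R) (N : nat) : R :=
  \sum_(i < N + N) F (i%:Z - N%:Z).

Lemma zpartE (R : realType) (F : int -> R) (N : nat) :
  zpart F N = \sum_(n < N) F (Posz n) + \sum_(n < N) F (Negz n).
Proof.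
rewrite /zpart big_split_ord/= addrC; congr (_ + _).
  by apply: eq_bigr => i _; congr F; rewrite PoszD addrAC subrr add0r.
rewrite (reindex_inj rev_ord_inj); apply: eq_bigr => i _; congr F => /=.
by rewrite NegzE; have := ltn_ord i; lia.
Qed.

Lemma nonneg_series_cvg (R : realType) (f : nat -> R) (B : R) :
  (forall n, 0 <= f n) -> (forall N, \sum_(i < N) f i <= B) ->
  exists2 l : R, (fun N => \sum_(i < N) f i) @ \oo --> l &
    (\sum_(n <oo) (f n)%:E = l%:E)%E.
Proof.
move=> f0 fB; pose s N := \sum_(i < N) f i.
have ns : nondecreasing_seq s.
  by apply/nondecreasing_seqP => n; rewrite /s big_ord_recr/= lerDl.
have sl := nondecreasing_cvgn ns (ex_intro _ B _ : has_ubound (range s)).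
exists (sup (range s)); first by apply: sl => _ [n _ <-]; exact: fB.
have /sl {}sl : ubound (range s) B by move=> _ [n _ <-]; exact: fB.
apply: cvg_lim => //.
rewrite (_ : (fun n => _) = EFin \o s); first exact: cvg_EFin (nearW _ _) sl.
by apply/funext => n; rewrite big_mkord sumEFin.
Qed.

Lemma esum_int_cvg (R : realType) (f : int -> R) (B : R) :
  (forall j, 0 <= f j) -> (forall N, zpart f N <= B) ->
  zpart f @ \oo --> fine (\esum_(j in [set: int]) (f j)%:E)%E.
Proof.
move=> f0 fB.
have fp N : \sum_(n < N) f (Posz n) <= B.
  by apply: le_trans (fB N); rewrite zpartE lerDl sumr_ge0.
have fn N : \sum_(n < N) f (Negz n) <= B.
  by apply: le_trans (fB N); rewrite zpartE lerDr sumr_ge0.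
have [lp cp ep] := nonneg_series_cvg (fun n => f0 (Posz n)) fp.
have [ln cn en] := nonneg_series_cvg (fun n => f0 (Negz n)) fn.
have -> : (\esum_(j in [set: int]) (f j)%:E = lp%:E + ln%:E)%E.
  rewrite (esumID (range Posz)); last by move=> i _; rewrite lee_fin.
  rewrite -ep -en !setTI; congr (_ + _)%E.
    rewrite esum_image; last by move=> m n _ _ [].
    by rewrite nneseries_esumT// => n; rewrite lee_fin.
  rewrite (_ : ~` _ = Negz @` [set: nat]).
    rewrite esum_image; last by move=> m n _ _ [].
    by rewrite nneseries_esumT// => n; rewrite lee_fin.
  apply/seteqP; split => [[n|n]|_ [n _ <-] [m _]] //=.
    by move=> /=; case; exists n.
  by move=> _; exists n.
rewrite (_ : zpart f = (fun N => \sum_(n < N) f (Posz n)) + (fun N => \sum_(n < N) f (Negz n))).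
  exact: cvgD.
by apply/funext => N; rewrite zpartE.
Qed.

Lemma zpart_le (R : realType) (F G : int -> R) N :
  (forall j, F j <= G j) -> zpart F N <= zpart G N.
Proof. by move=> FG; apply: ler_sum. Qed.

(** This reduces bounds and linearity of [zsum] to those of finite sums. *)
Lemma zsum_cvg (R : realType) (F : int -> R) (B : R) :
  (forall N, zpart (fun j => `|F j|) N <= B) -> zpart F @ \oo --> zsum F.
Proof.
move=> FB; pose P j := Num.max (F j) 0; pose Q j := Num.max (- F j) 0.
have FPQ : zpart F = zpart P - zpart Q.
  apply/funext => N; rewrite !fctE /zpart -sumrB; apply: eq_bigr => i _.
  by rewrite /P /Q; have [?|?] := leP (F (i%:Z - N%:Z)) 0; have [?|?] := leP (- F (i%:Z - N%:Z)) 0; lra.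
rewrite FPQ /zsum; apply: cvgB.
  rewrite (_ : esum _ _ = \esum_(j in [set: int]) (P j)%:E)%E.
    apply: (@esum_int_cvg _ P B) => [j|N]; first by rewrite /P le_max lexx orbT.
    apply: le_trans (FB N); apply: zpart_le => j.
    by rewrite /P ge_max ler_norm normr_ge0.
  by apply: eq_esum => j _; rewrite /P funeposE EFin_max.
rewrite (_ : esum _ _ = \esum_(j in [set: int]) (Q j)%:E)%E.
  apply: (@esum_int_cvg _ Q B) => [j|N]; first by rewrite /Q le_max lexx orbT.
  apply: le_trans (FB N); apply: zpart_le => j.
  by rewrite /Q ge_max -normrN ler_norm normr_ge0.
by apply: eq_esum => j _; rewrite /Q funenegE EFin_max.
Qed.

Lemma zsum_le (R : realType) (F : int -> R) (B : R) :
  (forall N, zpart (fun j => `|F j|) N <= B) -> `|zsum F| <= B.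
Proof.
move=> FB; have cF := zsum_cvg FB.
have cN : (fun N => `|zpart F N|) @ \oo --> `|zsum F| by exact: cvg_norm.
rewrite -(cvg_lim (@Rhausdorff R) cN); apply: limr_le; first exact: cvgP cN.
apply: nearW => N; apply: le_trans (FB N); exact: ler_norm_sum.
Qed.

Lemma zsumB (R : realType) (F G : int -> R) (B C : R) :
  (forall N, zpart (fun j => `|F j|) N <= B) ->
  (forall N, zpart (fun j => `|G j|) N <= C) ->
  zsum (fun j => F j - G j) = zsum F - zsum G.
Proof.
move=> FB GC; have cFG := cvgB (zsum_cvg FB) (zsum_cvg GC).
have H N : zpart (fun j => `|F j - G j|) N <= B + C.
  apply: (@le_trans _ _ (zpart (fun j => `|F j|) N + zpart (fun j => `|G j|) N)).
    by rewrite /zpart -big_split; apply: ler_sum => i _; exact: ler_normB.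
  exact: lerD.
have E : zpart (fun j => F j - G j) = zpart F - zpart G.
  by apply/funext => N; rewrite !fctE /zpart -sumrB.
by rewrite -(cvg_lim (@Rhausdorff R) (zsum_cvg H)) E; apply: cvg_lim; [exact: Rhausdorff|exact: cFG].
Qed.

Lemma zsum_shift (R : realType) (F : int -> R) (k : int) :
  zsum (fun j => F (j + k)) = zsum F.
Proof.
have sb : set_bij [set: int] [set: int] (fun j : int => j + k).
  split => //; first by move=> x y _ _ /addIr.
  by move=> y _; exists (y - k) => //; rewrite subrK.
have E (a : int -> \bar R) : (\esum_(j in [set: int]) a (j + k)%R = \esum_(j in [set: int]) a j)%E.
  by rewrite [RHS](reindex_esum _ _ _ a sb).
by rewrite /zsum -[in RHS](E (EFin \o F)^\+%E) -[in RHS](E (EFin \o F)^\-%E); congr (fine _ - fine _);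
  apply: eq_esum => j _; rewrite ?funeposE ?funenegE.
Qed.

(** * Quadrature of integrable kernels *)

Section reflection.
Context (R : realType).
Let mu := @lebesgue_measure R.

Lemma measurable_reflect (c : R) :
  measurable_fun setT ((fun y => c - y) : measurableTypeR R -> measurableTypeR R).
Proof.
apply: (@continuous_measurable_fun R (fun y => c - y)) => y.
by apply: cvgB; [exact: cvg_cst|exact: cvg_id].
Qed.

Lemma lebesgue_measure_reflect (c : R) (A : set R) : measurable A ->
  pushforward mu ((fun y => c - y) : measurableTypeR R -> measurableTypeR R) A = mu A.
Proof.
have ? := measurable_reflect c.
move=> mA; apply/esym/lebesgue_measure_unique => //= _ [[a b]] _ <-.
rewrite /pushforward (_ : _ @^-1` _ = `[c - b, c - a[%classic); last first.
  by apply/seteqP; split => x /=; rewrite !in_itv/= => /andP[? ?]; apply/andP; split; lra.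
rewrite !lebesgue_measure_itv/= !lte_fin.
have -> : (c - b < c - a) = (a < b) by apply/idP/idP; lra.
by case: ifP => // _; rewrite -!EFinB; congr (_%:E); ring.
Qed.

Lemma integrable_reflect (c : R) (F : R -> R) : L1 mu F -> L1 mu (fun y => F (c - y)).
Proof.
move=> /integrableP[mF iF]; have mr := measurable_reflect c.
apply/integrableP; split; first exact: (measurableT_comp mF mr).
apply: le_lt_trans iF.
rewrite -(@eq_measure_integral _ _ _ setT _ (pushforward mu ((fun y => c - y) : measurableTypeR R -> measurableTypeR R)) (abse \o (EFin \o F))).
  have ma : measurable_fun setT (abse \o (EFin \o F)) by apply: measurableT_comp => //; exact: abse_measurable.
  by rewrite ge0_integral_pushforward//= lexx.
by move=> A mA _; exact: lebesgue_measure_reflect.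
Qed.

Lemma Rintegral_reflect (c : R) (F : R -> R) : L1 mu F -> \int[mu]_y F (c - y) = \int[mu]_y F y.
Proof.
move=> iF; have mr := measurable_reflect c; have [mF _] := integrableP _ _ _ iF.
rewrite /Rintegral; congr fine.
rewrite -[RHS](@eq_measure_integral _ _ _ setT _ (pushforward mu ((fun y => c - y) : measurableTypeR R -> measurableTypeR R))).
  by rewrite integral_pushforward//; exact: integrable_reflect.
by move=> A mA _; exact: lebesgue_measure_reflect.
Qed.

End reflection.

Lemma cvg_Rintegral_window (R : realType) (F : R -> R) (a b : nat -> R) :
  L1 (@lebesgue_measure R) F ->
  a @ \oo --> -oo%R -> b @ \oo --> +oo%R ->
  (fun n => \int[@lebesgue_measure R]_(x in `[a n, b n]) F x) @ \oo -->
    \int[@lebesgue_measure R]_x F x.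
Proof.
move=> iF aNy bNy; set mu := @lebesgue_measure R.
have [mF _] := integrableP _ _ _ iF.
have H : (fun n => \int[mu]_x (F \_ `[a n, b n] x)%:E)%E @ \oo --> (\int[mu]_x (F x)%:E)%E.
  apply: (@dominated_cvg _ _ R mu setT measurableT _ _ (fun x => `|F x|%:E)) => //.
  - move=> n; have := measurable_restrictT (EFin \o F) (measurable_itv `[a n, b n]).
    move=> [+ _]; rewrite restrict_EFin; apply; exact: measurable_funTS.
  - move=> x _; apply: cvg_near_cst.
    have xa : \forall n \near \oo, a n < x by move/cvgrNyPlt : aNy => /(_ x).
    have xb : \forall n \near \oo, x < b n by move/cvgryPgt : bNy => /(_ x).
    near=> n; rewrite patchE mem_set//= in_itv/=.
    by apply/andP; split; apply: ltW; near: n.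
  - exact: integrable_norm iF.
  - move=> n x _; rewrite lee_fin patchE; case: ifP => // _; by rewrite normr0.
have fin : (\int[mu]_x (F x)%:E \is a fin_num)%E by exact: integrable_fin_num iF.
rewrite /Rintegral; apply: fine_cvg; rewrite fineK//.
apply: cvg_trans H; apply: near_eq_cvg; apply: nearW => n.
by rewrite [RHS]integral_mkcond restrict_EFin.
Unshelve. all: by end_near. Qed.

(** All that the scheme sees of the kernel: the discrete forms, uniform in the
    mesh, of [b] and [b'] being integrable and of [b''] being a finite measure.
    The offset [x] is arbitrary, so that translating or reflecting [b] preserves
    the bounds. *)
Definition kernel_bounds (R : realType) (b : R -> R) (B : R) : Prop :=
  forall (h x : R) (N : nat), 0 < h <= 1 ->
  [/\ \sum_(i < N) h * `|b (x + i%:R * h)| <= B,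
      forall t, 0 <= t <= h ->
        \sum_(i < N) `|b (x + i%:R * h + t) - b (x + i%:R * h)| <= B &
      forall t, 0 <= t <= h / 2 ->
        \sum_(i < N) `|b (x + i%:R * h + t) + b (x + i%:R * h - t)
                       - 2 * b (x + i%:R * h)| <= B * t].

Lemma kernel_bounds_reflect (R : realType) (b : R -> R) (B X : R) :
  kernel_bounds b B -> kernel_bounds (fun y => b (X - y)) B.
Proof.
move=> bB h x N hh.
have rN (i : 'I_N) : (N - i.+1)%:R = N%:R - 1 - i%:R :> R.
  by rewrite natrB ?ltn_ord// -natr1; ring.
pose z := X - x - (N%:R - 1) * h.
have [b0 b1 b2] := bB h z N hh; split.
- apply: le_trans b0; rewrite (reindex_inj rev_ord_inj)/=; apply: ler_sum => i _.
  by rewrite rN; apply: eq_ler; congr (_ * `|b _|); rewrite /z; ring.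
- move=> t th; have [_ /(_ t th) {}b1 _] := bB h (z - t) N hh; apply: le_trans b1.
  rewrite (reindex_inj rev_ord_inj)/=; apply: ler_sum => i _; rewrite rN distrC.
  apply: eq_ler; congr (`|b _ - b _|); rewrite /z; ring.
- move=> t th; apply: le_trans (b2 t th).
  rewrite (reindex_inj rev_ord_inj)/=; apply: ler_sum => i _; rewrite rN [X in `|X - _|]addrC.
  apply: eq_ler; congr (`|b _ + b _ - 2 * b _|); rewrite /z; ring.
Qed.

Lemma antiderivative_on (R : realType) (F : R -> R) (a : R) : continuous F ->
  exists Phi : R -> R, forall x : R, a < x -> is_derive x 1 Phi (F x).
Proof.
move=> cF; exists (fun x => \int[@lebesgue_measure R]_(t in `[a, x]) F t) => x ax.
have [||d1 d2] := @continuous_FTC1_closed R F a x (x + 1) _ _ ax (cF x).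
- by rewrite ltrDl.
- apply: continuous_compact_integrable; first exact: segment_compact.
  exact: continuous_subspaceT.
- by apply: (is_derive_eq (derivableP d1)); rewrite -derive1E.
Qed.

(** The midpoint rule: the error is the integral over [0, h / 2] of the second
    differences at the nodes. *)
Lemma midpoint_rule (R : realType) (F : R -> R) (h x K : R) (N : nat) :
  continuous F -> 0 < h ->
  (forall t, 0 <= t <= h / 2 ->
    `|\sum_(i < N) (F (x + i%:R * h + t) + F (x + i%:R * h - t) - 2 * F (x + i%:R * h))| <= K) ->
  `|\int[@lebesgue_measure R]_(y in `[x - h / 2, x + N%:R * h - h / 2]) F y
    - \sum_(i < N) h * F (x + i%:R * h)| <= K * (h / 2).
Proof.
move=> cF h0 HK; have h20 : 0 <= h / 2 by lra.
have [Phi dPhi] := antiderivative_on (x - h / 2 - 1) cF.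
pose c (i : nat) : R := x + i%:R * h.
have cx i : x <= c i by rewrite /c lerDl mulr_ge0// ltW.
pose H t := \sum_(i < N) (Phi (c i + t) - Phi (c i - t) - 2 * F (c i) * t).
pose H' t := \sum_(i < N) (F (c i + t) + F (c i - t) - 2 * F (c i)).
have dH (t : R) : 0 <= t <= h / 2 -> is_derive t 1 H (H' t).
  move=> /andP[t0 th].
  have dHi i : is_derive t 1 (fun t => Phi (c i + t) - Phi (c i - t) - 2 * F (c i) * t)
      (F (c i + t) + F (c i - t) - 2 * F (c i)).
    have ? : is_derive t 1 (fun t => Phi (c i + t)) (F (c i + t)).
      by apply: is_derive_add_arg; apply: dPhi; have := cx i; lra.
    have ? : is_derive t 1 (fun t => Phi (c i - t)) (- F (c i - t)).
      by apply: is_derive_sub_arg; apply: dPhi; have := cx i; lra.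
    by apply: is_derive_eq; rewrite /GRing.scale/=; ring.
  refine (@is_derive_sumR R N (fun i t => Phi (c i + t) - Phi (c i - t) - 2 * F (c i) * t)
    (fun i t => F (c i + t) + F (c i - t) - 2 * F (c i)) t dHi).
have hb : 0 <= h / 2 <= h / 2 by rewrite h20 lexx.
have hz : 0 <= (0 : R) <= h / 2 by rewrite lexx h20.
have := derive_lipschitz_on dH HK hb hz.
rewrite (_ : H 0 = 0); last first.
  by rewrite /H big1// => i _; rewrite addr0 subr0 mulr0 subrr subr0.
rewrite !subr0 (ger0_norm h20); apply: le_trans; apply: eq_ler; congr (`|_|).
have Nh : 0 <= N%:R * h by rewrite mulr_ge0// ltW.
have xx : x - h / 2 <= x + N%:R * h - h / 2 by lra.
have dPhi' (y : R) : x - h / 2 <= y <= x + N%:R * h - h / 2 -> is_derive y 1 Phi (F y).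
  by move=> /andP[y1 _]; apply: dPhi; lra.
rewrite (FTC2_continuous xx cF dPhi').
rewrite /H sumrB; congr (_ - _); last first.
  by apply: eq_bigr => i _; rewrite mulrAC; congr (_ * _); lra.
rewrite (eq_bigr (fun i : 'I_N => (Phi (c i.+1 - h / 2) - Phi (c i - h / 2)))).
  have := telescope_sumr (fun i => Phi (c i - h / 2)) (leq0n N).
  by rewrite big_mkord => ->; rewrite /c mul0r addr0.
by move=> i _; rewrite /c -natr1; congr (Phi _ - _); field.
Qed.

(** A Riemann sum differs from the integral by at most the variation within
    the cells, integrated over the width of a cell. *)
Lemma kernel_sum_le (R : realType) (b : R -> R) (h x B : R) (N : nat) :
  continuous b -> L1 (@lebesgue_measure R) b -> 0 < h ->
  (forall t, 0 <= t <= h -> \sum_(i < N) `|b (x + i%:R * h + t) - b (x + i%:R * h)| <= B) ->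
  \sum_(i < N) h * `|b (x + i%:R * h)| <= \int[@lebesgue_measure R]_y `|b y| + B * h.
Proof.
move=> cb ib h0 HB.
have cn : continuous (fun y => `|b y|) by move=> y; apply: cvg_norm; exact: cb.
have [Phi dPhi] := antiderivative_on (x - 1) cn.
pose c (i : nat) : R := x + i%:R * h.
have cx i : x <= c i by rewrite /c lerDl mulr_ge0// ltW.
pose H t := \sum_(i < N) (`|b (c i)| * t - (Phi (c i + t) - Phi (c i))).
pose H' t := \sum_(i < N) (`|b (c i)| - `|b (c i + t)|).
have dH (t : R) : 0 <= t <= h -> is_derive t 1 H (H' t).
  move=> /andP[t0 th].
  have dHi i : is_derive t 1 (fun t => `|b (c i)| * t - (Phi (c i + t) - Phi (c i)))
      (`|b (c i)| - `|b (c i + t)|).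
    have ? : is_derive t 1 (fun t => Phi (c i + t)) `|b (c i + t)|.
      by apply: is_derive_add_arg; apply: dPhi; have := cx i; lra.
    by apply: is_derive_eq; rewrite /GRing.scale/=; ring.
  refine (@is_derive_sumR R N (fun i t => `|b (c i)| * t - (Phi (c i + t) - Phi (c i)))
    (fun i t => `|b (c i)| - `|b (c i + t)|) t dHi).
have H'B t : 0 <= t <= h -> `|H' t| <= B.
  move=> th; apply: le_trans (HB t th); apply: le_trans (ler_norm_sum _ _ _) _.
  apply: ler_sum => i _; rewrite -/(c i) [leRHS]distrC.
  exact: ler_dist_dist.
have hb : 0 <= h <= h by rewrite lexx ltW.
have hz : 0 <= (0 : R) <= h by rewrite lexx ltW.
have := derive_lipschitz_on dH H'B hb hz.
rewrite (_ : H 0 = 0); last first.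
  by rewrite /H big1// => i _; rewrite addr0 mulr0 !subrr.
rewrite !subr0 (gtr0_norm h0) => /(le_trans (ler_norm _)); rewrite /H sumrB lerBlDl.
under [in leLHS]eq_bigr do rewrite mulrC.
have -> : \sum_(i < N) (Phi (c i + h) - Phi (c i)) = Phi (c N) - Phi (c 0%N).
  have := telescope_sumr (fun i => Phi (c i)) (leq0n N); rewrite big_mkord => <-.
  by apply: eq_bigr => i _; rewrite /c -natr1; congr (Phi _ - _); ring.
move=> /le_trans; apply; rewrite lerD2r.
have xc : c 0%N <= c N by rewrite {1}/c mul0r addr0.
have dPhi' (y : R) : c 0%N <= y <= c N -> is_derive y 1 Phi `|b y|.
  by move=> /andP[y1 _]; apply: dPhi; have := cx 0%N; lra.
rewrite -(FTC2_continuous xc cn dPhi').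
have inb := integrable_norm ib.
rewrite Rintegral_mkcond; apply: le_Rintegral => //.
  have [+ _] := @integrable_mkcond _ _ R (@lebesgue_measure R) `[c 0%N, c N]
    (EFin \o (fun y => `|b y|)) (measurable_itv _).
  rewrite restrict_EFin; apply; exact: integrableS inb.
by move=> y _; rewrite patchE; case: ifP => _; [exact: lexx|exact: normr_ge0].
Qed.

Lemma W11_kernel_bounds (R : realType) (beta : R -> R)
    (nu : {charge set (measurableTypeR R) -> \bar R}) :
  continuous beta -> W11 beta -> second_distributional_derivative beta nu ->
  exists2 B : R, 0 <= B & kernel_bounds beta B.
Proof.
move=> cb wb hnu; have [B2 B20 H2] := second_difference_variation cb hnu; clear hnu nu.
have [B1 B10 H1] := first_difference_variation cb wb.
have ib : L1 (@lebesgue_measure R) beta.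
  by have [/Lfun1_integrable] := wb.
have [I I0 IE] : exists2 I : R, 0 <= I & \int[@lebesgue_measure R]_y `|beta y| = I.
  by exists (\int[@lebesgue_measure R]_y `|beta y|) => //; exact: Rintegral_ge0.
exists (I + B1 + B2); first by rewrite !addr_ge0.
move=> h x N /andP[h0 h1]; split.
- have := kernel_sum_le cb ib h0 (fun t th => H1 h x t N h0 th); rewrite IE.
  clear IE ib cb wb; have : B1 * h <= B1 by rewrite ler_piMr.
  lra.
- by move=> t th; have := H1 h x t N h0 th; lra.
- move=> t th; have /andP[t0 _] := th; apply: le_trans (H2 h x t N h0 th) _.
  by rewrite ler_wpM2r//; lra.
Qed.

(** * Consistency of the discretisation *)

Lemma zsumZ (R : realType) (F : int -> R) (k B : R) :
  (forall N, zpart (fun j => `|F j|) N <= B) ->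
  zsum (fun j => k * F j) = k * zsum F.
Proof.
move=> FB; have cF := zsum_cvg FB.
have ck : (fun N => k * zpart F N) @ \oo --> k * zsum F.
  by apply: cvgM => //; exact: cvg_cst.
have H N : zpart (fun j => `|k * F j|) N <= `|k| * B.
  apply: le_trans (ler_wpM2l (normr_ge0 k) (FB N)).
  by rewrite /zpart mulr_sumr; apply: ler_sum => i _; rewrite normrM.
have E : zpart (fun j => k * F j) = fun N => k * zpart F N.
  by apply/funext => N; rewrite /zpart mulr_sumr.
by rewrite -(cvg_lim (@Rhausdorff R) (zsum_cvg H)) E; apply: cvg_lim; [exact: Rhausdorff|].
Qed.

Lemma grid_node (R : realType) (h : R) (N i : nat) :
  (i%:Z - N%:Z)%:~R * h = - (N%:R * h) + i%:R * h.
Proof. by rewrite rmorphB/= mulrBl addrC. Qed.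

Lemma kernel_zpart_le (R : realType) (b : R -> R) (B h : R) (N : nat) :
  kernel_bounds b B -> 0 < h <= 1 ->
  zpart (fun j => h * `|b (j%:~R * h)|) N <= B.
Proof.
move=> bB hh; have [+ _ _] := bB h (- (N%:R * h)) (N + N)%N hh.
by apply: le_trans; apply: ler_sum => i _; rewrite grid_node.
Qed.

Lemma kernel_product_zpart_le (R : realType) (b : R -> R) (B h m : R) (z : int -> R) (N : nat) :
  kernel_bounds b B -> 0 < h <= 1 -> (forall j, `|z j| <= m) ->
  zpart (fun j => `|h * b (j%:~R * h) * z j|) N <= B * m.
Proof.
move=> bB hh zm; have /andP[h0 _] := hh.
apply: le_trans (ler_wpM2r (le_trans (normr_ge0 _) (zm 0)) (kernel_zpart_le N bB hh)).
rewrite /zpart mulr_suml; apply: ler_sum => i _.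
by rewrite !normrM (gtr0_norm h0) ler_wpM2l// mulr_ge0// ltW.
Qed.

(** The discrete Leibniz rule. Its three terms are of order [t]: the one with
    the second difference of [b] by hypothesis, the one with the two first
    differences because [w] is Lipschitz, and the one with the second difference
    of [w], of order [t ^ 2], because [h] times the sum of [|b|] is bounded and
    [t <= h]. *)
Lemma product_second_difference (R : realType) (b w : R -> R) (B W h x t : R) (N : nat) :
  kernel_bounds b B -> 0 < h <= 1 -> 0 <= t <= h / 2 ->
  (forall y, `|w y| <= W) -> (forall y z, `|w y - w z| <= W * `|y - z|) ->
  (forall c t, 0 <= t -> `|w (c + t) + w (c - t) - 2 * w c| <= W * t ^+ 2) ->
  \sum_(i < N) `|b (x + i%:R * h + t) * w (x + i%:R * h + t)
    + b (x + i%:R * h - t) * w (x + i%:R * h - t)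
    - 2 * (b (x + i%:R * h) * w (x + i%:R * h))| <= 4 * (B * W) * t.
Proof.
move=> bB hh th w0 w1 w2; have /andP[h0 h1] := hh; have /andP[t0 t2] := th.
have W0 : 0 <= W := le_trans (normr_ge0 _) (w0 0).
have th' : 0 <= t <= h by apply/andP; split; lra.
pose c (i : nat) : R := x + i%:R * h.
have [v0 /(_ t th') v1 /(_ t th) v2] := bB h x N hh.
have [_ /(_ t th') v1' _] := bB h (x - t) N hh.
have step i : `|b (c i + t) * w (c i + t) + b (c i - t) * w (c i - t) - 2 * (b (c i) * w (c i))|
   <= `|b (c i + t) + b (c i - t) - 2 * b (c i)| * W
      + (`|b (c i + t) - b (c i)| * (W * t) + `|b (c i) - b (c i - t)| * (W * t))
      + `|b (c i)| * (W * t ^+ 2).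
  have -> : b (c i + t) * w (c i + t) + b (c i - t) * w (c i - t) - 2 * (b (c i) * w (c i)) =
    (b (c i + t) + b (c i - t) - 2 * b (c i)) * w (c i)
    + ((b (c i + t) - b (c i)) * (w (c i + t) - w (c i))
       + (b (c i) - b (c i - t)) * (w (c i) - w (c i - t)))
    + b (c i) * (w (c i + t) + w (c i - t) - 2 * w (c i)) by ring.
  apply: (le_trans (ler_normD _ _)); apply: lerD; last first.
    by rewrite normrM ler_wpM2l// w2.
  apply: (le_trans (ler_normD _ _)); apply: lerD; first by rewrite normrM ler_wpM2l.
  apply: (le_trans (ler_normD _ _)); apply: lerD; rewrite normrM ler_wpM2l//.
    by apply: (le_trans (w1 _ _)); rewrite addrAC subrr add0r ger0_norm.
  by apply: (le_trans (w1 _ _)); rewrite opprB addrC subrK ger0_norm.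
apply: le_trans; first (apply: ler_sum => i _; exact: (step i)).
rewrite !big_split/= -!mulr_suml.
have e1 : \sum_(i < N) `|b (c i + t) + b (c i - t) - 2 * b (c i)| * W <= B * t * W.
  by rewrite -mulr_suml ler_wpM2r.
have e2 : (\sum_(i < N) `|b (c i + t) - b (c i)|) * (W * t) <= B * (W * t).
  by rewrite ler_wpM2r// mulr_ge0.
have e3 : (\sum_(i < N) `|b (c i) - b (c i - t)|) * (W * t) <= B * (W * t).
  rewrite ler_wpM2r ?mulr_ge0//; apply: le_trans v1'; apply: ler_sum => i _.
  rewrite /c; apply: eq_ler; congr (`|b _ - b _|); ring.
have e4 : (\sum_(i < N) `|b (c i)|) * (W * t ^+ 2) <= B * (W * t).
  have -> : (\sum_(i < N) `|b (c i)|) * (W * t ^+ 2) = (\sum_(i < N) `|b (c i)|) * t * (W * t) by ring.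
  rewrite ler_wpM2r ?mulr_ge0//; apply: le_trans v0; rewrite -mulr_sumr mulrC.
  by rewrite ler_wpM2r ?sumr_ge0//; lra.
by rewrite -mulr_suml in e1; lra.
Qed.

(** Second order although [b] is not [C^2]: the midpoint rule integrates over
    [0, h / 2] second differences whose sum is of order [t]. *)
Lemma midpoint_convolution (R : realType) (b w : R -> R) (B W h : R) :
  kernel_bounds b B -> continuous b -> L1 (@lebesgue_measure R) b ->
  0 < h <= 1 -> continuous w ->
  (forall y, `|w y| <= W) -> (forall y z, `|w y - w z| <= W * `|y - z|) ->
  (forall c t, 0 <= t -> `|w (c + t) + w (c - t) - 2 * w c| <= W * t ^+ 2) ->
  `|zsum (fun j : int => h * b (j%:~R * h) * w (j%:~R * h))
    - \int[@lebesgue_measure R]_y (b y * w y)| <= B * W * h ^+ 2.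
Proof.
move=> bB cb ib hh cw w0 w1 w2; have /andP[h0 h1] := hh.
have W0 : 0 <= W := le_trans (normr_ge0 _) (w0 0).
have HB N : zpart (fun j => `|h * b (j%:~R * h) * w (j%:~R * h)|) N <= B * W.
  exact: kernel_product_zpart_le.
have cz := zsum_cvg HB.
have cbw : continuous (fun y => b y * w y).
  by move=> y; apply: cvgM; [exact: cb|exact: cw].
have ibw : L1 (@lebesgue_measure R) (fun y => b y * w y).
  have := integrable_boundedM (continuous_measurableT cw) w0 ib.
  by apply: eq_integrable => // y _ /=; rewrite mulrC.
pose a (N : nat) : R := - (N%:R * h) - h / 2.
pose e (N : nat) : R := - (N%:R * h) + (N + N)%:R * h - h / 2.
have natNh : (fun N : nat => N%:R * h) @ \oo --> +oo%R.
  apply/cvgryPge => A; near=> N; rewrite -ler_pdivrMr//; near: N.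
  exact: nbhs_infty_ger.
have ci := @cvg_Rintegral_window R (fun y => b y * w y) a e ibw.
have {}ci : (fun n => \int[@lebesgue_measure R]_(x in `[a n, e n]) (b x * w x)) @ \oo -->
    \int[@lebesgue_measure R]_x (b x * w x).
  apply: ci.
    apply/cvgrNyPle => A; near=> N; rewrite /a.
    have : - A <= N%:R * h by near: N; move/cvgryPge : natNh; exact.
    by lra.
  apply/cvgryPge => A; near=> N; rewrite /e natrD.
  have : A + h <= N%:R * h by near: N; move/cvgryPge : natNh; exact.
  by lra.
have cd : (fun N => `|zpart (fun j : int => h * b (j%:~R * h) * w (j%:~R * h)) N
    - \int[@lebesgue_measure R]_(x in `[a N, e N]) (b x * w x)|) @ \oo -->
    `|zsum (fun j : int => h * b (j%:~R * h) * w (j%:~R * h)) - \int[@lebesgue_measure R]_y (b y * w y)|.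
  by apply: cvg_norm; exact: cvgB.
rewrite -(cvg_lim (@Rhausdorff R) cd); apply: limr_le; first exact: cvgP cd.
apply: nearW => N /=; rewrite distrC.
have -> : zpart (fun j => h * b (j%:~R * h) * w (j%:~R * h)) N =
    \sum_(i < N + N) h * (b (- (N%:R * h) + i%:R * h) * w (- (N%:R * h) + i%:R * h)).
  by apply: eq_bigr => i _; rewrite grid_node mulrA.
have := @midpoint_rule R (fun y => b y * w y) h (- (N%:R * h)) (4 * (B * W) * (h / 2)) (N + N) cbw h0.
move=> /(_ _)/le_trans; apply.
  move=> t th; apply: (le_trans (ler_norm_sum _ _ _)).
  apply: (le_trans (product_second_difference _ _ bB hh th w0 w1 w2)).
  have BW0 : 0 <= B * W.
    by apply: le_trans (HB 0%N); rewrite /zpart big_ord0.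
  by have /andP[_ ?] := th; rewrite ler_wpM2l// mulr_ge0.
by apply: eq_ler; field.
Unshelve. all: by end_near. Qed.

Section consistency.
Variables (R : realType) (beta : R -> R) (B : R).
Hypothesis cbeta : continuous beta.
Hypothesis ibeta : L1 (@lebesgue_measure R) beta.
Hypothesis betaB : kernel_bounds beta B.
Let mu := @lebesgue_measure R.

Variables (g g1 g2 g3 : R -> R) (M : R).
Hypothesis dg : forall x : R, is_derive x 1 g (g1 x).
Hypothesis dg1 : forall x : R, is_derive x 1 g1 (g2 x).
Hypothesis dg2 : forall x : R, is_derive x 1 g2 (g3 x).
Hypothesis gM : forall x, `|g x| <= M.
Hypothesis g1M : forall x, `|g1 x| <= M.
Hypothesis g2M : forall x, `|g2 x| <= M.
Hypothesis g3M : forall x, `|g3 x| <= M.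

Let cg : continuous g. Proof. exact: is_derive_continuous dg. Qed.

Local Lemma integrable_conv (c : R) :
  L1 mu (fun z => beta z * g (c - z)).
Proof.
have cgc : continuous (fun z => g (c - z)).
  by apply: is_derive_continuous => z; exact: is_derive_reflect c dg z.
have := integrable_boundedM (continuous_measurableT cgc) (fun z => gM (c - z)) ibeta.
by apply: eq_integrable => // y _ /=; rewrite mulrC.
Qed.

Local Lemma convolutionE (c : R) :
  convolution beta g c = \int[mu]_z (beta z * g (c - z)).
Proof.
rewrite -(Rintegral_reflect c (integrable_conv c)) /convolution.
by apply: eq_Rintegral => y _; rewrite subKr.
Qed.

Let delta (k y : R) := (2 * k)^-1 * (g (y + k) - g (y - k)).

Local Lemma delta_conv (k x : R) :
  (2 * k)^-1 * (convolution beta g (x + k) - convolution beta g (x - k)) =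
  \int[mu]_z (beta z * delta k (x - z)).
Proof.
rewrite !convolutionE -RintegralB//; try exact: integrable_conv.
rewrite -RintegralZl//; last by apply: integrableBR; exact: integrable_conv.
apply: eq_Rintegral => z _; rewrite /delta (addrAC x k) (addrAC x (- k)); ring.
Qed.

Local Lemma delta_error (k y : R) : 0 < k -> `|delta k y - g1 y| <= M * k ^+ 2.
Proof. by move=> k0; exact: central_difference_error dg dg1 dg2 g3M y k k0. Qed.

Local Lemma integrable_delta (k x : R) :
  L1 mu (fun z => beta z * delta k (x - z)).
Proof.
have : L1 mu (fun z => (2 * k)^-1 * (beta z * g (x + k - z) - beta z * g (x - k - z))).
  by apply: integrableZR; apply: integrableBR; exact: integrable_conv.
apply: eq_integrable => // z _ /=; congr (_%:E).
rewrite /delta (addrAC x k) (addrAC x (- k)); ring.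
Qed.

Let A := \int[mu]_y `|beta y|.

(** [beta * g] is differentiable at the point [x], with no bound on its further
    derivatives. Its difference quotient with step [h] is therefore compared
    with those of steps [k] tending to [0]: both are convolutions of [beta]
    with difference quotients of [g], which are within [M h ^ 2] and [M k ^ 2]
    of [g1]. *)
Local Lemma central_difference_convolution (h x d : R) : 0 < h ->
  is_derive x 1 (convolution beta g) d ->
  `|(2 * h)^-1 * (convolution beta g (x + h) - convolution beta g (x - h)) - d|
    <= A * M * h ^+ 2.
Proof.
move=> h0 /is_derive1_caratheodory[q [qE cq qx]].
set D := _ * _.
have H k : 0 < k -> `|D - (q (x + k) + q (x - k)) / 2| <= A * (M * (h ^+ 2 + k ^+ 2)).
  move=> k0.
  have -> : (q (x + k) + q (x - k)) / 2 =
      (2 * k)^-1 * (convolution beta g (x + k) - convolution beta g (x - k)).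
    have e1 := qE (x + k); have e2 := qE (x - k).
    have -> : convolution beta g (x + k) - convolution beta g (x - k) =
      q (x + k) * (x + k - x) - q (x - k) * (x - k - x) by rewrite -e1 -e2; ring.
    by field; rewrite gt_eqF.
  rewrite /D !delta_conv -RintegralB//; try exact: integrable_delta.
  have inb := integrable_norm ibeta.
  rewrite mulrC -RintegralZl//.
  apply: normr_Rintegral_le.
  - by apply: (@integrable_measurable _ _ R mu); apply: integrableBR; exact: integrable_delta.
  - move=> z; rewrite -mulrBr normrM mulrC ler_wpM2r//.
    have := delta_error (x - z) h0; have := delta_error (x - z) k0.
    rewrite !ler_norml => /andP[? ?] /andP[? ?]; apply/andP; split; lra.
  - exact: integrableZR inb.
have c1 : (fun k : R => A * (M * (h ^+ 2 + k ^+ 2))) @ 0^'+ --> A * (M * (h ^+ 2 + 0 ^+ 2)).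
  apply: cvg_at_right_filter; apply: cvgM; first exact: cvg_cst.
  apply: cvgM; first exact: cvg_cst.
  by apply: cvgD; [exact: cvg_cst|exact: exprn_continuous].
have cq_comp (p : R -> R) : p k @[k --> (0 : R)] --> x -> q (p k) @[k --> (0 : R)] --> q x.
  by move=> px; exact: (cvg_comp _ _ px cq).
have c2 : (fun k : R => `|D - (q (x + k) + q (x - k)) / 2|) @ 0^'+ --> `|D - (q x + q x) / 2|.
  apply: cvg_norm; apply: cvgB; first exact: cvg_cst.
  apply: cvgM; last exact: cvg_cst.
  apply: cvg_at_right_filter; apply: cvgD; apply: cq_comp.
    by rewrite -[X in _ --> X]addr0; apply: cvgD; [exact: cvg_cst|exact: cvg_id].
  by rewrite -[X in _ --> X]subr0; apply: cvgB; [exact: cvg_cst|exact: cvg_id].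
have := ler_cvg_to c2 c1.
rewrite qx expr0n/= addr0 -mulrA (_ : (d + d) / 2 = d); last by field.
by apply; near=> k; apply: H; near: k; exact: nbhs_right_gt.
Unshelve. all: by end_near. Qed.

(** Moving the discrete derivative from the convolution to [g] turns the left
    side into a Riemann sum of [beta (x - y) * w y], with [w] the difference
    quotient of [g]. The two errors are that of the midpoint rule and that of
    the difference quotient of [beta * g]. *)
Lemma discrete_convolution_consistency (h : R) (i : int) (d : R) : 0 < h <= 1 ->
  is_derive (i%:~R * h) 1 (convolution beta g) d ->
  `|central_difference h (discrete_convolution h (grid h beta) (grid h g)) i - d|
    <= (B + A) * M * h ^+ 2.
Proof.
move=> hh dd; have /andP[h0 h1] := hh; set x := i%:~R * h.
pose b (y : R) := beta (x - y).
have bB : kernel_bounds b B by exact: kernel_bounds_reflect.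
have cb : continuous b.
  move=> y; apply: (@continuous_comp _ _ _ (fun y : R => x - y) beta); last exact: cbeta.
  by apply: cvgB; [exact: cvg_cst|exact: cvg_id].
have ib : L1 mu b by exact: integrable_reflect.
pose dl (f : R -> R) y := (2 * h)^-1 * (f (h + y) - f (- h + y)).
have ddl (f f' : R -> R) : (forall x : R, is_derive x 1 f (f' x)) ->
    forall x : R, is_derive x 1 (dl f) (dl f' x).
  move=> df y; have ? := @is_derive_translate R f f' h df y.
  have ? := @is_derive_translate R f f' (- h) df y.
  by apply: is_derive_eq; rewrite /GRing.scale/= /dl; ring.
have dlM (f f' : R -> R) : (forall x : R, is_derive x 1 f (f' x)) ->
    (forall x, `|f' x| <= M) -> forall y, `|dl f y| <= M.
  move=> df fM y; rewrite /dl normrM gtr0_norm ?invr_gt0 ?mulr_gt0// ler_pdivrMl ?mulr_gt0//.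
  apply: (le_trans (derive_lipschitz df fM _ _)).
  rewrite (_ : h + y - (- h + y) = 2 * h); last by ring.
  by rewrite ger0_norm ?mulr_ge0 ?(ltW h0)// mulrC.
have w0 := dlM _ _ dg g1M.
have w1 := derive_lipschitz (ddl _ _ dg) (dlM _ _ dg1 g2M).
have w2 := second_difference_le (ddl _ _ dg) (ddl _ _ dg1) (dlM _ _ dg2 g3M).
have cw := is_derive_continuous (ddl _ _ dg).
have := midpoint_convolution bB cb ib hh cw w0 w1 w2.
set Z := zsum _; set I := \int[_]_y _ => HZ.
have sumB (s : R) N : zpart (fun j : int => `|h * b (j%:~R * h) * g (j%:~R * h + s)|) N <= B * M.
  exact: kernel_product_zpart_le.
(* Shifting the summation index moves the difference onto [g]. *)
have shift (s : int) : zsum (fun j : int => h * grid h beta (i + s - j) * grid h g j) =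
    zsum (fun j : int => h * b (j%:~R * h) * g (j%:~R * h + s%:~R * h)).
  rewrite -(zsum_shift _ s); congr zsum; apply/funext => j.
  rewrite /grid /b /x; congr (_ * beta _ * g _); last by rewrite rmorphD/= mulrDl.
  by rewrite !rmorphD/= !rmorphN/= !rmorphD/=; ring.
have -> : central_difference h (discrete_convolution h (grid h beta) (grid h g)) i = Z.
  rewrite /central_difference /discrete_convolution (shift 1) (shift (-1)).
  rewrite -(zsumB (sumB _) (sumB _)) -(@zsumZ _ _ _ (B * M + B * M)).
    congr zsum; apply/funext => j; rewrite /dl rmorphN/= rmorph1 mul1r mulN1r.
    by rewrite (addrC h) (addrC (- h)); ring.
  move=> N; apply: le_trans (lerD (sumB (1%:~R * h) N) (sumB ((-1)%:~R * h) N)).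
  by rewrite /zpart -big_split; apply: ler_sum => k _; exact: ler_normB.
have IE : I = (2 * h)^-1 * (convolution beta g (x + h) - convolution beta g (x - h)).
  rewrite delta_conv /I -(Rintegral_reflect x); last first.
    have := integrable_boundedM (continuous_measurableT cw) w0 ib.
    by apply: eq_integrable => // y _ /=; rewrite mulrC.
  apply: eq_Rintegral => z _; rewrite /b subKr /dl /delta.
  by rewrite (addrC h) (addrC (- h)).
have := central_difference_convolution h0 dd; rewrite -/x -IE => HI.
have -> : Z - d = (Z - I) + (I - d) by ring.
by apply: (le_trans (ler_normD _ _)); rewrite mulrDl mulrDl; exact: lerD.
Qed.

End consistency.

(** Uniform bound on the discrete operator: the difference falls on the kernel,
    whose increments over one cell are summable independently of the mesh. *)
Lemma discrete_operator_le (R : realType) (beta : R -> R) (B h m : R) (z : int -> R) (i : int) :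
  kernel_bounds beta B -> 0 < h <= 1 -> (forall j, `|z j| <= m) ->
  `|central_difference h (discrete_convolution h (grid h beta) z) i| <= B * m.
Proof.
move=> bB hh zm; have /andP[h0 h1] := hh.
have m0 : 0 <= m := le_trans (normr_ge0 _) (zm 0).
pose b k (y : R) := beta ((i + k)%:~R * h - y).
have bkB k : kernel_bounds (b k) B by exact: kernel_bounds_reflect.
have gb k j : grid h beta (i + k - j) = b k (j%:~R * h).
  by rewrite /grid /b rmorphB/= mulrBl.
have sumB k N : zpart (fun j : int => `|h * grid h beta (i + k - j) * z j|) N <= B * m.
  rewrite (_ : (fun j => _) = fun j => `|h * b k (j%:~R * h) * z j|).
    exact: kernel_product_zpart_le (bkB k) hh zm.
  by apply/funext => j; rewrite gb.
rewrite /central_difference /discrete_convolution -(zsumB (sumB 1) (sumB (-1))).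
rewrite normrM gtr0_norm ?invr_gt0 ?mulr_gt0// ler_pdivrMl ?mulr_gt0//.
apply: zsum_le => N.
have -> : 2 * h * (B * m) = (B + B) * (h * m) by ring.
have -> : zpart (fun j : int => `|h * grid h beta (i + 1 - j) * z j - h * grid h beta (i + -1 - j) * z j|) N =
  \sum_(j < N + N) `|b 1 (- (N%:R * h) + j%:R * h) - b (-1) (- (N%:R * h) + j%:R * h)| *
     (h * `|z (j%:Z - N%:Z)|).
  apply: eq_bigr => j _; rewrite !gb grid_node -mulrBl -mulrBr !normrM (gtr0_norm h0); ring.
apply: (@le_trans _ _ (\sum_(j < N + N) (`|b 1 (- (N%:R * h) + j%:R * h) - b 0 (- (N%:R * h) + j%:R * h)| +
  `|b 0 (- (N%:R * h) + j%:R * h) - b (-1) (- (N%:R * h) + j%:R * h)|) * (h * m))).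
  apply: ler_sum => j _; apply: ler_pM => //; first by rewrite mulr_ge0// ltW.
    by rewrite (le_trans _ (ler_normD _ _))// addrA subrK.
  by rewrite ler_wpM2l// ltW.
rewrite -mulr_suml ler_wpM2r ?mulr_ge0 ?(ltW h0)// big_split/=.
have hxh : 0 <= h <= h by rewrite lexx ltW.
apply: lerD.
  have [_ /(_ h hxh) v _] := bkB 0 h (- (N%:R * h) - h) (N + N)%N hh.
  apply: le_trans v; apply: ler_sum => j _; rewrite distrC.
  apply: eq_ler; rewrite /b !rmorphD/= rmorph1 rmorph0.
  by congr (`|beta _ - beta _|); ring.
have [_ /(_ h hxh) v _] := bkB 0 h (- (N%:R * h)) (N + N)%N hh.
apply: le_trans v; apply: ler_sum => j _; rewrite distrC.
apply: eq_ler; rewrite /b !rmorphD/= rmorphN rmorph1 rmorph0.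
by congr (`|beta _ - beta _|); ring.
Qed.

Lemma discrete_operatorB (R : realType) (beta : R -> R) (B h m1 m2 : R) (z1 z2 : int -> R) (i : int) :
  kernel_bounds beta B -> 0 < h <= 1 -> (forall j, `|z1 j| <= m1) -> (forall j, `|z2 j| <= m2) ->
  central_difference h (discrete_convolution h (grid h beta) (fun j => z1 j - z2 j)) i =
  central_difference h (discrete_convolution h (grid h beta) z1) i -
  central_difference h (discrete_convolution h (grid h beta) z2) i.
Proof.
move=> bB hh z1m z2m; have /andP[h0 h1] := hh.
have sumB (z : int -> R) m k N : (forall j, `|z j| <= m) ->
    zpart (fun j : int => `|h * grid h beta (k - j) * z j|) N <= B * m.
  move=> zm; apply: le_trans (kernel_product_zpart_le N (kernel_bounds_reflect (k%:~R * h) bB) hh zm).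
  by apply: zpart_le => j; rewrite /grid rmorphB/= mulrBl.
have E k : discrete_convolution h (grid h beta) (fun j => z1 j - z2 j) k =
    discrete_convolution h (grid h beta) z1 k - discrete_convolution h (grid h beta) z2 k.
  rewrite /discrete_convolution -(zsumB (fun N => sumB z1 m1 k N z1m) (fun N => sumB z2 m2 k N z2m)).
  by congr zsum; apply/funext => j; ring.
by rewrite /central_difference !E; ring.
Qed.

(** * Integrals against sines and cosines *)

Lemma is_derive_trig (R : realType) (a b y x : R) :
  is_derive x 1 (fun t => a * cos (t * y) - b * sin (t * y))
    (- (y * b) * cos (x * y) - y * a * sin (x * y)).
Proof.
rewrite (_ : (fun t => _) = (fun t => a * cos (y * t) - b * sin (y * t))); last first.
  by apply/funext => t; rewrite (mulrC t).
have ? := is_derive_scale_arg (is_derive_cos (y * x)).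
have ? := is_derive_scale_arg (is_derive_sin (y * x)).
by apply: is_derive_eq; rewrite /GRing.scale/= (mulrC x); ring.
Qed.

Section trigonometric_integral.
Context (R : realType).
Let mu := @lebesgue_measure R.

(** The real part of the integral of [(A + 'i B) * exp ('i x y)]. *)
Definition trig_integral (A B : R -> R) (x : R) : R :=
  \int[mu]_y (A y * cos (x * y) - B y * sin (x * y)).

Lemma continuous_cos_mul (x : R) : continuous (fun y : R => cos (x * y)).
Proof.
move=> y; apply: (@continuous_comp _ _ _ (fun y : R => x * y) cos); last exact: continuous_cos.
by apply: cvgM; [exact: cvg_cst|exact: cvg_id].
Qed.

Lemma continuous_sin_mul (x : R) : continuous (fun y : R => sin (x * y)).
Proof.
move=> y; apply: (@continuous_comp _ _ _ (fun y : R => x * y) sin); last exact: continuous_sin.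
by apply: cvgM; [exact: cvg_cst|exact: cvg_id].
Qed.

Lemma cos_abs_le1 (x : R) : `|cos x| <= 1.
Proof. by rewrite ler_norml cos_geN1 cos_le1. Qed.

Lemma sin_abs_le1 (x : R) : `|sin x| <= 1.
Proof. by rewrite ler_norml sin_geN1 sin_le1. Qed.

Lemma integrable_mul_cos (A : R -> R) (x : R) : L1 mu A -> L1 mu (fun y => A y * cos (x * y)).
Proof.
move=> IA; have := integrable_boundedM (continuous_measurableT (@continuous_cos_mul x))
  (fun y => cos_abs_le1 (x * y)) IA.
by apply: eq_integrable => // y _ /=; rewrite mulrC.
Qed.

Lemma integrable_mul_sin (A : R -> R) (x : R) : L1 mu A -> L1 mu (fun y => A y * sin (x * y)).
Proof.
move=> IA; have := integrable_boundedM (continuous_measurableT (@continuous_sin_mul x))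
  (fun y => sin_abs_le1 (x * y)) IA.
by apply: eq_integrable => // y _ /=; rewrite mulrC.
Qed.

Lemma integrable_trig (A B : R -> R) (x : R) : L1 mu A -> L1 mu B ->
  L1 mu (fun y => A y * cos (x * y) - B y * sin (x * y)).
Proof.
by move=> IA IB; apply: integrableBR; [exact: integrable_mul_cos|exact: integrable_mul_sin].
Qed.

Lemma trig_le (a b x : R) : `|a * cos x - b * sin x| <= `|a| + `|b|.
Proof.
apply: (le_trans (ler_normB _ _)); rewrite !normrM.
by apply: lerD; rewrite ler_piMr// ?cos_abs_le1 ?sin_abs_le1.
Qed.

Lemma trig_integral_le (A B W : R -> R) (x : R) :
  measurable_fun setT A -> measurable_fun setT B ->
  (forall y, `|A y| + `|B y| <= W y) -> L1 mu W ->
  `|trig_integral A B x| <= \int[mu]_y W y.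
Proof.
move=> mA mB ABW IW.
have IA : L1 mu A.
  by apply: integrable_dominated IW => // y; apply: le_trans (ABW y); rewrite lerDl.
have IB : L1 mu B.
  by apply: integrable_dominated IW => // y; apply: le_trans (ABW y); rewrite lerDr.
apply: normr_Rintegral_le => //; first exact: integrable_measurable (integrable_trig x IA IB).
by move=> y; apply: le_trans (ABW y); exact: trig_le.
Qed.

(** Differentiation under the integral sign multiplies [A + 'i B] by ['i y]. *)
Lemma trig_integral_is_derive (A B : R -> R) : L1 mu A -> L1 mu B -> L1 mu (fun y => y * A y) ->
  L1 mu (fun y => y * B y) ->
  forall x : R, is_derive x 1 (trig_integral A B)
    (trig_integral (fun y => - (y * B y)) (fun y => y * A y) x).
Proof.
move=> IA IB IyA IyB x.
pose f (x y : R) := A y * cos (x * y) - B y * sin (x * y).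
pose G y := `|y * B y| + `|y * A y|.
have Ix : `]x - 1, x + 1[%classic x by rewrite /= in_itv/=; apply/andP; split; lra.
have intf (z : R) : `]x - 1, x + 1[%classic z -> L1 mu (f z).
  by move=> _; exact: integrable_trig.
have d1E z y : partial1of2 f z y = - (y * B y) * cos (z * y) - y * A y * sin (z * y).
  by rewrite partial1of2E; have ? := is_derive_trig (A y) (B y) y z; rewrite derive_val.
have derf (z : R) y : `]x - 1, x + 1[%classic z -> [set: R] y -> derivable (f ^~ y) z 1.
  by move=> _ _; have ? := is_derive_trig (A y) (B y) y z; exact: ex_derive.
have G0 y : 0 <= G y by rewrite addr_ge0.
have intG : L1 mu G.
  by apply: integrableDR; exact: integrable_norm.
have Gub z y : `]x - 1, x + 1[%classic z -> [set: R] y -> `|partial1of2 f z y| <= G y.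
  by move=> _ _; rewrite d1E; apply: (le_trans (trig_le _ _ _)); rewrite normrN.
have dF := @derivable_under_integral R _ _ mu f setT measurableT x (x - 1) (x + 1) Ix
  intf derf G G0 intG Gub.
have eF := @differentiation_under_integral R _ _ mu f setT measurableT x (x - 1) (x + 1) Ix
  intf derf G G0 intG Gub.
apply: (is_derive_eq (derivableP dF)); rewrite -derive1E eF.
by apply: eq_Rintegral => y _; rewrite d1E.
Qed.

End trigonometric_integral.

(** * Gaussian functions *)

Section gaussian.
Variables (R : realType) (kappa : R).
Hypothesis kappa0 : 0 < kappa.
Let mu := @lebesgue_measure R.

Definition gauss (y : R) : R := expR (- (kappa * y) ^+ 2).

Lemma gauss_gt0 y : 0 < gauss y. Proof. exact: expR_gt0. Qed.

Lemma gauss_le1 y : gauss y <= 1.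
Proof. by rewrite /gauss -expR0 ler_expR oppr_le0 sqr_ge0. Qed.

Lemma is_derive_gauss (y : R) : is_derive y 1 gauss (- (2 * kappa ^+ 2) * (y * gauss y)).
Proof.
have dq : is_derive y 1 (fun t : R => - (kappa * t) ^+ 2) (- (2 * kappa ^+ 2 * y)).
  by apply: is_derive_eq; rewrite /GRing.scale/=; ring.
have := @is_derive1_comp _ expR (fun t : R => - (kappa * t) ^+ 2) y _ _ (is_derive_expR _) dq.
by move=> H; apply: (is_derive_eq H); rewrite /gauss; ring.
Qed.

(** [exp (z ^ 2)] dominates [z ^ (2 n) / n!]; an arbitrary power of [y] is
    below [1] or below an even power. *)
Lemma gauss_moment (k : nat) : exists M, forall y, `|y ^+ k * gauss y| <= M.
Proof.
have even n : exists M, forall y, `|y| ^+ (2 * n) * gauss y <= M.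
  case: n => [|n].
    by exists 1 => y; rewrite muln0 expr0 mul1r gauss_le1.
  exists ((n.+1)`!%:R / kappa ^+ (2 * n.+1)) => y.
  have f0 : 0 < (n.+1)`!%:R :> R by rewrite ltr0n fact_gt0.
  have k0 : 0 < kappa ^+ (2 * n.+1) by rewrite exprn_gt0.
  rewrite ler_pdivlMr// /gauss expRN mulrAC ler_pdivrMr ?expR_gt0//.
  have := @expR_ge1Dxn R ((kappa * y) ^+ 2) n (sqr_ge0 _) => H.
  rewrite -ler_pdivrMl// mulrC.
  have H' := le_trans (ler_wpDl ler01 (lexx _)) H; apply: le_trans H'.
  rewrite exprM real_normK ?num_real// (exprM kappa) -exprMn -exprMn.
  by rewrite (mulrC y).
have [M0 H0] := even 0%N; have [Mk Hk] := even k.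
exists (M0 + Mk) => y; rewrite normrM (gtr0_norm (gauss_gt0 y)) normrX.
have [y1|y1] := leP `|y| 1.
  apply: (@le_trans _ _ M0).
    apply: le_trans (H0 y); rewrite muln0 expr0 ler_wpM2r ?(ltW (gauss_gt0 y))//.
    by rewrite exprn_ile1.
  by rewrite lerDl; apply: le_trans (Hk 0); rewrite mulr_ge0 ?exprn_ge0// ltW// gauss_gt0.
apply: (@le_trans _ _ Mk).
  apply: le_trans (Hk y); rewrite ler_wpM2r ?(ltW (gauss_gt0 y))//.
  by rewrite mul2n -addnn exprD ler_peMl ?exprn_ge0// exprn_ege1// ltW.
by rewrite lerDr; apply: le_trans (H0 0); rewrite mulr_ge0 ?exprn_ge0// ltW// gauss_gt0.
Qed.

Variable x0 : R.

(** The functions [p(y) * cos (x0 y) * gauss y] and [p(y) * sin (x0 y) * gauss y],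
    with [p] a polynomial, and their sums. The class is stable under
    differentiation and under multiplication by [y], so that it consists of
    Schwartz functions as soon as its members are bounded. *)
Inductive gauss_class : (R -> R) -> Prop :=
| gauss_cos : gauss_class (fun y => cos (x0 * y) * gauss y)
| gauss_sin : gauss_class (fun y => sin (x0 * y) * gauss y)
| gauss_classD f g : gauss_class f -> gauss_class g -> gauss_class (fun y => f y + g y)
| gauss_classZ c f : gauss_class f -> gauss_class (fun y => c * f y)
| gauss_classX f : gauss_class f -> gauss_class (fun y => y * f y).

Lemma gauss_class_derive f : gauss_class f ->
  exists2 f', gauss_class f' & forall y : R, is_derive y 1 f (f' y).
Proof.
elim=> [||{}f g _ [f' gf' df] _ [g' gg' dg]|c {}f _ [f' gf' df]|{}f gf [f' gf' df]].
- exists (fun y => (- x0) * (sin (x0 * y) * gauss y) + - (2 * kappa ^+ 2) * (y * (cos (x0 * y) * gauss y))).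
    apply: gauss_classD; apply: gauss_classZ; first exact: gauss_sin.
    by apply: gauss_classX; exact: gauss_cos.
  move=> y; have ? := is_derive_gauss y; have ? := is_derive_scale_arg (is_derive_cos (x0 * y)).
  by apply: is_derive_eq; rewrite /GRing.scale/=; ring.
- exists (fun y => x0 * (cos (x0 * y) * gauss y) + - (2 * kappa ^+ 2) * (y * (sin (x0 * y) * gauss y))).
    apply: gauss_classD; apply: gauss_classZ; first exact: gauss_cos.
    by apply: gauss_classX; exact: gauss_sin.
  move=> y; have ? := is_derive_gauss y; have ? := is_derive_scale_arg (is_derive_sin (x0 * y)).
  by apply: is_derive_eq; rewrite /GRing.scale/=; ring.
- exists (fun y => f' y + g' y); first exact: gauss_classD.
  by move=> y; have ? := df y; have ? := dg y; exact: is_deriveD.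
- exists (fun y => c * f' y); first exact: gauss_classZ.
  move=> y; have ? := df y; apply: is_derive_eq.
  by rewrite /GRing.scale/=; ring.
- exists (fun y => f y + y * f' y); first by apply: gauss_classD => //; exact: gauss_classX.
  move=> y; have ? := df y; apply: is_derive_eq.
  by rewrite /GRing.scale/=; ring.
Qed.

Lemma gauss_class_ndiff n f : gauss_class f -> ndiff n f.
Proof.
elim: n f => [//|n IHn] f gf; have [f' gf' df] := gauss_class_derive gf.
by exists f' => //; exact: IHn.
Qed.

Lemma gauss_class_continuous f : gauss_class f -> continuous f.
Proof. by move=> /(gauss_class_ndiff 1)/ndiff_continuous. Qed.

Lemma gauss_class_decay f : gauss_class f ->
  forall k : nat, exists M, forall y, `|y ^+ k * f y| <= M.
Proof.
elim=> [||{}f g _ Hf _ Hg|c {}f _ Hf|{}f _ Hf] k.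
- have [M HM] := gauss_moment k; exists M => y; apply: le_trans (HM y).
  by rewrite !normrM ler_wpM2l// ler_piMl// cos_abs_le1.
- have [M HM] := gauss_moment k; exists M => y; apply: le_trans (HM y).
  by rewrite !normrM ler_wpM2l// ler_piMl// sin_abs_le1.
- have [Mf HMf] := Hf k; have [Mg HMg] := Hg k; exists (Mf + Mg) => y.
  by rewrite mulrDr; apply: (le_trans (ler_normD _ _)); exact: lerD.
- have [M HM] := Hf k; exists (`|c| * M) => y.
  by rewrite mulrCA normrM ler_wpM2l.
- have [M HM] := Hf k.+1; exists M => y.
  by rewrite mulrA -exprSr.
Qed.

Lemma gauss_class_derive1n n f : gauss_class f -> gauss_class (f^`(n))%classic.
Proof.
elim: n f => [//|n IHn] f gf; have [f' gf' df] := gauss_class_derive gf.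
by rewrite derive1Sn (derive1_is_derive df); exact: IHn.
Qed.

Lemma gauss_class_schwartz f : gauss_class f -> schwartz f.
Proof.
move=> gf; split; first by apply: ndiff_smooth => n; exact: gauss_class_ndiff.
by move=> k n; have := gauss_class_decay (gauss_class_derive1n n gf) k.
Qed.

End gaussian.

(** * Integrability of powers *)

Section power_integrable.
Context (R : realType).
Let mu := @lebesgue_measure R.

Lemma cvg_powRN_pinfty (r : R) : 0 < r -> (1 + x) `^ (- r) @[x --> +oo%R] --> (0 : R).
Proof.
move=> r0; apply/cvgr0Pnorm_le => e e0.
near=> x; have xt : (e^-1) `^ r^-1 <= x by near: x; exact: nbhs_pinfty_ge.
have x0 : 0 <= x by apply: le_trans xt; exact: powR_ge0.
rewrite ger0_norm ?powR_ge0// powRN -[leRHS]invrK lef_pV2 ?posrE ?invr_gt0 ?powR_gt0//; last by lra.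
have -> : e^-1 = ((e^-1) `^ r^-1) `^ r.
  by rewrite -powRrM mulVf ?gt_eqF// powRr1// invr_ge0 ltW.
apply: ge0_ler_powR; rewrite ?nnegrE ?powR_ge0//; first exact: ltW; lra.
Unshelve. all: by end_near. Qed.

Lemma is_derive_powR_shift (p x : R) : -1 < x ->
  is_derive x 1 (fun t => (1 + t) `^ p) (p * (1 + x) `^ (p - 1)).
Proof.
move=> x1; have dp : is_derive (1 + x) 1 (fun t : R => t `^ p) (p * (1 + x) `^ (p - 1)).
  by apply: is_derive1_powR; lra.
exact: is_derive_add_arg dp.
Qed.

(** Comparison with [(1 + |y|) ^ (- 2 p)], which has an explicit primitive. *)
Lemma integrable_powRN (p : R) : 2^-1 < p ->
  L1 mu (fun y : R => (1 + y ^+ 2) `^ (- p)).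
Proof.
move=> p2; pose q := 2 * p; have q1 : 1 < q by rewrite /q; lra.
pose k (x : R) := (1 + `|x|) `^ (- q).
have ck : continuous k.
  move=> x; apply: (@continuous_comp _ _ _ (fun x : R => `|x|) (fun t => (1 + t) `^ (- q))).
    exact: norm_continuous.
  apply: is_derive_continuous_at.
  exact: is_derive_powR_shift (lt_le_trans (ltrN10 R) (normr_ge0 x)).
have k0 x : 0 <= k x by exact: powR_ge0.
have Ik : L1 mu k.
  apply/integrableP; split; first by apply/measurable_EFinP; exact: continuous_measurableT.
  under eq_integral do rewrite /= ger0_norm//.
  rewrite ge0_symfun_integralT//; last by move=> x; rewrite /k/= normrN.
  rewrite (_ : [set x | 0 <= x] = `[0, +oo[%classic); last first.
    by apply/seteqP; split => x /=; rewrite in_itv/= andbT.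
  pose F (x : R) := - (q - 1)^-1 * (1 + x) `^ (- (q - 1)).
  have dF (x : R) : -1 < x -> is_derive x 1 F ((1 + x) `^ (- q)).
    move=> x1; have ? := is_derive_powR_shift (- (q - 1)) x1.
    apply: is_derive_eq; rewrite /GRing.scale/= (_ : - (q - 1) - 1 = - q); last by ring.
    by field; rewrite gt_eqF// subr_gt0.
  rewrite (@ge0_continuous_FTC2y R k F 0 0)//.
  - by rewrite -EFinB -EFinM ltry.
  - exact: continuous_subspaceT.
  - rewrite -[X in _ --> X](mulr0 (- (q - 1)^-1)); apply: cvgM; first exact: cvg_cst.
    by apply: cvg_powRN_pinfty; lra.
  - by move=> x x0; have ? := dF x (lt_trans (ltrN10 R) x0); exact: ex_derive.
  - by apply: cvg_at_right_filter; exact: is_derive_continuous_at (dF 0 (ltrN10 R)).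
  - move=> x; rewrite in_itv/= andbT => x0; have ? := dF x (lt_trans (ltrN10 R) x0).
    by rewrite derive1E derive_val /k ger0_norm// ltW.
apply: (@integrable_dominated _ _ R mu _ (fun y => 2 `^ p * k y)).
- apply: (@measurableT_comp _ _ _ _ _ _ (fun t : R => t `^ (- p))); first exact: measurable_powR.
  by apply: continuous_measurableT => y; apply: cvgD; [exact: cvg_cst|exact: exprn_continuous].
- move=> y; rewrite ger0_norm ?powR_ge0// /k !powRN.
  have y1 : 0 < 1 + y ^+ 2 by rewrite ltr_pwDl// sqr_ge0.
  have y2 : 0 < 1 + `|y| by rewrite ltr_pwDl.
  rewrite ler_pdivlMr ?powR_gt0// mulrC ler_pdivrMr ?powR_gt0// -powRM ?(ltW y1)//.
  rewrite /q powRrM powR_mulrn ?(ltW y2)//.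
  apply: ge0_ler_powR; rewrite ?nnegrE ?sqr_ge0 ?mulr_ge0 ?(ltW y1)//; first by lra.
  rewrite -(real_normK (num_real y)); have := sqr_ge0 (1 - `|y|); lra.
- exact: integrableZR.
Qed.

End power_integrable.

Lemma Rintegral_dominated_cvg d (T : measurableType d) (R : realType)
    (mu : {measure set T -> \bar R}) (F : nat -> T -> R) (f g : T -> R) :
  (forall n, measurable_fun setT (F n)) -> measurable_fun setT f ->
  (forall x, (F ^~ x) @ \oo --> f x) -> (forall n x, `|F n x| <= g x) ->
  L1 mu g ->
  (fun n => \int[mu]_x F n x) @ \oo --> \int[mu]_x f x.
Proof.
move=> mF mf Ff Fg Ig.
have fg x : `|f x| <= g x.
  have cn : (fun n => `|F n x|) @ \oo --> `|f x| by apply: cvg_norm; exact: Ff.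
  rewrite -(cvg_lim (@Rhausdorff R) cn); apply: limr_le; first exact: cvgP cn.
  by apply: nearW => n; exact: Fg.
have If : L1 mu f by exact: integrable_dominated Ig.
rewrite /Rintegral; apply: fine_cvg; rewrite fineK; last exact: integrable_fin_num.
apply: (@dominated_cvg _ _ R mu setT measurableT (fun n x => (F n x)%:E) _ (EFin \o g)) => //.
- by move=> n; exact/measurable_EFinP.
- by move=> x _; apply: cvg_EFin; [exact: nearW|exact: Ff].
- by move=> n x _; rewrite lee_fin.
Qed.

(** * The Fourier transform of a Gaussian *)

Section gaussian_transform.
Variables (R : realType).
Let mu := @lebesgue_measure R.

Lemma gauss_class_integrable (kappa x0 : R) (f : R -> R) : 0 < kappa ->
  gauss_class kappa x0 f -> L1 mu f.
Proof.
move=> k0 gf; have [M0 H0] := gauss_class_decay k0 gf 0%N; have [M2 H2] := gauss_class_decay k0 gf 2%N.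
apply: (@integrable_dominated _ _ R mu _ (fun y => (M0 + M2) * (1 + y ^+ 2) `^ (- 1))).
- exact: continuous_measurableT (gauss_class_continuous gf).
- move=> y; have y1 : 0 < 1 + y ^+ 2 by rewrite ltr_pwDl// sqr_ge0.
  rewrite powR_inv1 ?(ltW y1)// ler_pdivlMr// mulrDr mulr1.
  apply: lerD; first by have := H0 y; rewrite expr0 mul1r.
  by have := H2 y; rewrite normrM (ger0_norm (sqr_ge0 y)) mulrC.
- by apply: integrableZR; apply: integrable_powRN; lra.
Qed.

Lemma gauss_integrable (kappa : R) : 0 < kappa -> L1 mu (gauss kappa).
Proof.
move=> k0; have := gauss_class_integrable k0 (gauss_cos kappa 0).
by apply: eq_integrable => // y _ /=; rewrite mul0r cos0 mul1r.
Qed.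

(** No boundary term: the integral of a derivative vanishes. *)
Lemma gauss_class_Rintegral_derive (kappa x0 : R) (f f' : R -> R) : 0 < kappa ->
  gauss_class kappa x0 f -> gauss_class kappa x0 f' ->
  (forall y : R, is_derive y 1 f (f' y)) -> \int[mu]_y f' y = 0.
Proof.
move=> k0 gf gf' df; have [M HM] := gauss_class_decay k0 gf 1%N.
have M0 : 0 <= M := le_trans (normr_ge0 _) (HM 0).
have cN : (fun n : nat => - n%:R : R) @ \oo --> -oo%R.
  by apply/cvgrNyPle => A; near=> n; rewrite lerNl; near: n; exact: nbhs_infty_ger.
have cP : (fun n : nat => n%:R : R) @ \oo --> +oo%R by exact: cvgr_idn.
have c1 := cvg_Rintegral_window (gauss_class_integrable k0 gf') cN cP.
rewrite -(cvg_lim (@Rhausdorff R) c1); apply: cvg_lim => //.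
apply/cvgr0Pnorm_le => e e0; near=> n.
have n0 : 0 < n%:R :> R by rewrite ltr0n; near: n; exact: nbhs_infty_gt.
have nn : - n%:R <= n%:R :> R by lra.
rewrite (FTC2_continuous nn (gauss_class_continuous gf') (fun y _ => df y)).
have Mn (y : R) : `|y| = n%:R -> `|f y| <= M / n%:R.
  by move=> yn; rewrite ler_pdivlMr// mulrC -yn -normrM; exact: HM.
apply: (@le_trans _ _ (M / n%:R + M / n%:R)).
  by apply: (le_trans (ler_normB _ _)); apply: lerD; apply: Mn; rewrite ?normrN ger0_norm// ltW.
rewrite -mulrDl ler_pdivrMr// -ler_pdivrMl//; near: n; exact: nbhs_infty_ger.
Unshelve. all: by end_near. Qed.

Definition gauss_mass (kappa : R) : R := \int[mu]_y gauss kappa y.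

(** The change of variables [y |-> kappa * y]. *)
Lemma gauss_massE (kappa : R) : 0 < kappa -> gauss_mass kappa = gauss_mass 1 / kappa.
Proof.
move=> k0; have kn : kappa != 0 by rewrite gt_eqF.
pose F (x : R) := kappa * x.
have dF (x : R) : is_derive x 1 F kappa by apply: is_derive_eq; rewrite /GRing.scale/=; ring.
have F' : (F^`())%classic = cst kappa by exact: derive1_is_derive.
have c1 : continuous (@gauss R 1).
  by apply: (@is_derive_continuous _ _ (fun y => - (2 * 1 ^+ 2) * (y * gauss 1 y))) => y; exact: is_derive_gauss.
have Fy : F x @[x --> +oo%R] --> +oo%R.
  apply/cvgryPge => A; have := nbhs_pinfty_ge (num_real (kappa^-1 * A)).
  by apply: filterS => x; rewrite /F ler_pdivrMl.
have FNy : F x @[x --> -oo%R] --> -oo%R.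
  apply/cvgrNyPle => A; have := nbhs_ninfty_le (num_real (kappa^-1 * A)).
  by apply: filterS => x; rewrite /F ler_pdivlMl.
have := @increasing_ge0_integration_by_substitutionT R F (gauss 1).
rewrite F' => H; have {}H : (\int[mu]_x (gauss 1 x)%:E = \int[mu]_x (kappa%:E * (gauss kappa x)%:E))%E.
  rewrite H//.
  - by apply: eq_integral => x _; rewrite -EFinM; congr (_%:E); rewrite !fctE /gauss /F mul1r mulrC.
  - by move=> x y xy; rewrite /F ltr_pM2l.
  - by move=> x; exact: cvg_cst.
  - exact: is_cvg_cst.
  - exact: is_cvg_cst.
  - by move=> x; exact/ltW/gauss_gt0.
rewrite /gauss_mass /Rintegral H integralZl//; last exact: gauss_integrable.
rewrite fineM//; last by apply: integrable_fin_num => //; exact: gauss_integrable.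
by rewrite /= mulrC mulKf.
Unshelve. all: by end_near. Qed.

Lemma gauss_mass_gt0 : 0 < gauss_mass 1.
Proof.
have : gauss_mass 1 = Num.sqrt pi.
  have -> : gauss_mass 1 = \int[mu]_x gauss_fun x.
    by apply: eq_Rintegral => x _; rewrite /gauss /gauss_fun mul1r.
  by rewrite /Rintegral integralT_gauss.
by move=> ->; rewrite sqrtr_gt0 pi_gt0.
Qed.

Definition gauss_transform (kappa x : R) : R := \int[mu]_y (gauss kappa y * cos (x * y)).

(** Differentiating under the integral and integrating by parts, the transform
    [S] satisfies [S' = - x S / (2 kappa ^ 2)], a linear differential equation
    whose solutions are multiples of a Gaussian. *)
Lemma gauss_transformE (kappa x : R) : 0 < kappa ->
  gauss_transform kappa x = gauss_mass kappa * gauss (2 * kappa)^-1 x.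
Proof.
move=> k0; have kn : kappa != 0 by rewrite gt_eqF.
have Ig := gauss_integrable k0.
have I0 : L1 mu (fun _ : R => 0 : R) by exact: integrable0.
have Iyg : L1 mu (fun y => y * gauss kappa y).
  have := gauss_class_integrable k0 (gauss_classX (gauss_cos kappa 0)).
  by apply: eq_integrable => // y _ /=; rewrite mul0r cos0 mul1r.
have Iy0 : L1 mu (fun y : R => y * 0).
  by apply: eq_integrable I0 => // y _ /=; rewrite mulr0.
have tE z : gauss_transform kappa z = trig_integral (gauss kappa) (fun=> 0) z.
  by apply: eq_Rintegral => y _; rewrite mul0r subr0.
have dT (z : R) : is_derive z 1 (gauss_transform kappa) (- ((2 * kappa ^+ 2)^-1 * z) * gauss_transform kappa z).
  rewrite (_ : gauss_transform kappa = trig_integral (gauss kappa) (fun=> 0)); last exact/funext.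
  apply: (is_derive_eq (trig_integral_is_derive Ig I0 Iyg Iy0 z)).
  have [f' gf' df] := gauss_class_derive (gauss_sin kappa z).
  have := gauss_class_Rintegral_derive k0 (gauss_sin kappa z) gf' df.
  have -> : f' = fun y => z * (gauss kappa y * cos (z * y)) + - (2 * kappa ^+ 2) * ((y * gauss kappa y) * sin (z * y)).
    apply/funext => y.
    have dc := is_derive_scale_arg (is_derive_sin (z * y)).
    have dg := is_derive_gauss kappa y.
    have dM := is_deriveM dc dg; have ? := df y.
    rewrite -(@derive_val _ _ _ _ _ _ _ (df y)) (@derive_val _ _ _ _ _ _ _ dM).
    by rewrite /GRing.scale/=; ring.
  rewrite RintegralD//; last 2 first.
    by apply: integrableZR; exact: integrable_mul_cos.
    by apply: integrableZR; exact: integrable_mul_sin.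
  rewrite !RintegralZl//; [|exact: integrable_mul_sin|exact: integrable_mul_cos].
  rewrite -/(gauss_transform kappa z); set S := \int[_]_y _ => e.
  have -> : trig_integral (fun y : R => - (y * 0)) (fun y => y * gauss kappa y) z = - S.
    rewrite -mulN1r -RintegralZl//; last exact: integrable_mul_sin.
    by apply: eq_Rintegral => y _; ring.
  rewrite -tE; have -> : S = (2 * kappa ^+ 2)^-1 * (z * gauss_transform kappa z).
    have k2 : 2 * kappa ^+ 2 != 0 by rewrite mulf_neq0// expf_neq0.
    apply: (mulfI k2); rewrite mulVKf//; lra.
  by ring.
pose H z := gauss_transform kappa z * expR ((4 * kappa ^+ 2)^-1 * z ^+ 2).
have dH (z : R) : is_derive z 1 H 0.
  have ? := dT z.
  have dq : is_derive z 1 (fun t : R => (4 * kappa ^+ 2)^-1 * t ^+ 2) ((2 * kappa ^+ 2)^-1 * z).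
    by apply: is_derive_eq; rewrite /GRing.scale/=; field.
  have dE := @is_derive1_comp _ expR (fun t : R => (4 * kappa ^+ 2)^-1 * t ^+ 2) z _ _ (is_derive_expR _) dq.
  have := is_deriveM (dT z) dE => HM; apply: (is_derive_eq HM).
  by rewrite /GRing.scale/=; ring.
have := is_derive_0_is_cst x 0 dH.
rewrite /H expr0n/= mulr0 expR0 mulr1.
have -> : gauss_transform kappa 0 = gauss_mass kappa.
  by apply: eq_Rintegral => y _; rewrite mul0r cos0 mulr1.
move=> <-; rewrite /gauss -mulrA -expRD.
rewrite (_ : _ + - _ = 0) ?expR0 ?mulr1//.
by field.
Qed.

End gaussian_transform.

(** * Fourier inversion *)

Lemma id_mul_expRN_le (R : realType) (z : R) : 0 <= z -> z * expR (- z) <= 1.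
Proof.
move=> z0; rewrite expRN ler_pdivrMr ?expR_gt0// mul1r.
by apply: le_trans (expR_ge1Dx z); rewrite lerDr.
Qed.

Lemma gauss_subC (R : realType) (kappa x y : R) : gauss kappa (x - y) = gauss kappa (y - x).
Proof. by rewrite /gauss; congr (expR (- _)); ring. Qed.

Section fourier_inversion.
Variables (R : realType) (v a b : R -> R).
Let mu := @lebesgue_measure R.
Hypothesis cv : continuous v.
Hypothesis v2 : v \in Lfun mu 2%:E.
Hypothesis fv : is_fourier v a b.
Hypothesis Ia : L1 mu a.
Hypothesis Ib : L1 mu b.

Local Lemma integrable_mul_gauss (kappa c : R) : 0 < kappa ->
  L1 mu (fun x => v x * gauss kappa (x - c)).
Proof.
move=> k0; have Ig : L1 mu (fun x => gauss kappa (x - c)).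
  have := integrable_reflect c (gauss_integrable k0).
  apply: eq_integrable => // x _ /=; congr (_%:E).
  exact: gauss_subC.
have Iv2 : L1 mu (fun x => v x ^+ 2).
  exact: Lfun2_integrable_sqr v2.
apply: (@integrable_dominated _ _ R mu _ (fun x => v x ^+ 2 + gauss kappa (x - c))).
- apply: measurable_funM; first exact: continuous_measurableT.
  exact: integrable_measurable Ig.
- move=> x; rewrite normrM (gtr0_norm (gauss_gt0 _ _)) -(real_normK (num_real (v x))).
  have g0 := gauss_gt0 kappa (x - c); have g1 := gauss_le1 kappa (x - c).
  have := sqr_ge0 (`|v x| - gauss kappa (x - c)); rewrite sqrrB.
  have : gauss kappa (x - c) ^+ 2 <= gauss kappa (x - c).
    by rewrite expr2 ler_piMl// ltW.
  have := sqr_ge0 `|v x|; have := mulr_ge0 (normr_ge0 (v x)) (ltW g0); lra.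
- exact: integrableDR.
Qed.

(** The definition of the Fourier transform, tested with [cos (x0 y)] and
    [sin (x0 y)] times a Gaussian: in the combination on the left the product
    formulas leave a Gaussian centred at [x0] and cancel the one at [- x0]. *)
Local Lemma approximate_inversion (kappa x0 : R) : 0 < kappa ->
  \int[mu]_y ((a y * cos (x0 * y) - b y * sin (x0 * y)) * gauss kappa y) =
  \int[mu]_x (v x * gauss_transform kappa (x - x0)).
Proof.
move=> k0; have kn : kappa != 0 by rewrite gt_eqF.
have k2 : 0 < (2 * kappa)^-1 by rewrite invr_gt0 mulr_gt0.
have [fa _] := fv (gauss_class_schwartz k0 (gauss_cos kappa x0)).
have [_ fb] := fv (gauss_class_schwartz k0 (gauss_sin kappa x0)).
pose T := gauss_transform kappa.
have Ig := gauss_integrable k0.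
have Ivt c : L1 mu (fun x => v x * T (x - c)).
  have := integrableZR (gauss_mass kappa) (integrable_mul_gauss c k2).
  by apply: eq_integrable => // x _ /=; congr (_%:E); rewrite /T gauss_transformE//; ring.
have cE x : \int[mu]_y (cos (x * y) * (cos (x0 * y) * gauss kappa y)) = 2^-1 * (T (x - x0) + T (x - - x0)).
  rewrite /T /gauss_transform -RintegralD//; try exact: integrable_mul_cos.
  rewrite -RintegralZl//; last by apply: integrableDR; exact: integrable_mul_cos.
  by apply: eq_Rintegral => y _; rewrite opprK mulrBl mulrDl cosB cosD; field.
have sE x : \int[mu]_y (sin (x * y) * (sin (x0 * y) * gauss kappa y)) = 2^-1 * (T (x - x0) - T (x - - x0)).
  rewrite /T /gauss_transform -RintegralB//; try exact: integrable_mul_cos.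
  rewrite -RintegralZl//; last by apply: integrableBR; exact: integrable_mul_cos.
  by apply: eq_Rintegral => y _; rewrite opprK mulrBl mulrDl cosB cosD; field.
have gM y : `|gauss kappa y| <= 1 by rewrite gtr0_norm ?gauss_gt0 ?gauss_le1.
have mg := integrable_measurable Ig.
have Iac : L1 mu (fun y => a y * (cos (x0 * y) * gauss kappa y)).
  have := integrable_boundedM mg gM (integrable_mul_cos x0 Ia).
  by apply: eq_integrable => // y _ /=; congr (_%:E); ring.
have Ibs : L1 mu (fun y => b y * (sin (x0 * y) * gauss kappa y)).
  have := integrable_boundedM mg gM (integrable_mul_sin x0 Ib).
  by apply: eq_integrable => // y _ /=; congr (_%:E); ring.
transitivity (\int[mu]_y (a y * (cos (x0 * y) * gauss kappa y)) - \int[mu]_y (b y * (sin (x0 * y) * gauss kappa y))).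
  by rewrite -RintegralB//; apply: eq_Rintegral => y _; ring.
have IP : L1 mu (fun x => 2^-1 * (v x * T (x - x0) + v x * T (x - - x0))).
  by apply: integrableZR; exact: integrableDR.
have IQ : L1 mu (fun x => 2^-1 * (v x * T (x - x0) - v x * T (x - - x0))).
  by apply: integrableZR; exact: integrableBR.
rewrite fa fb opprK.
rewrite [X in X + _](_ : _ = \int[mu]_x (2^-1 * (v x * T (x - x0) + v x * T (x - - x0)))); last first.
  by apply: eq_Rintegral => x _; rewrite cE; ring.
rewrite [X in _ + X](_ : _ = \int[mu]_x (2^-1 * (v x * T (x - x0) - v x * T (x - - x0)))); last first.
  by apply: eq_Rintegral => x _; rewrite sE; ring.
by rewrite -RintegralD//; apply: eq_Rintegral => x _; rewrite -/T; field.
Qed.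

(** This constant is [2 pi]. *)
Let K := 2 * gauss_mass (1 : R) ^+ 2.

Let kap (n : nat) : R := (2 * n.+1%:R)^-1.

Local Lemma kap_gt0 n : 0 < kap n.
Proof. by rewrite invr_gt0 mulr_gt0. Qed.

Local Lemma transform_kap n x :
  gauss_transform (kap n) x = 2 * n.+1%:R * gauss_mass (1 : R) * gauss n.+1%:R x.
Proof.
rewrite gauss_transformE ?kap_gt0// (gauss_massE (kap_gt0 n)) /kap !invfM !invrK mulrA.
by rewrite mulVf// mul1r; congr (_ * _); ring.
Qed.

(** Within [delta] of [x0] continuity of [v] suffices. Farther away [v] may be
    unbounded, and the kernel [T n] is dominated by [1 / n] times the fixed
    Gaussian of parameter [1 / 2], against which [v], being square integrable,
    has a finite integral. *)
Local Lemma gauss_approximate_identity (x0 : R) :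
  (fun n => \int[mu]_x (v x * gauss_transform (kap n) (x - x0))) @ \oo --> K * v x0.
Proof.
pose c1 := gauss_mass (1 : R); have c10 : 0 < c1 by exact: gauss_mass_gt0.
pose T n x := gauss_transform (kap n) (x - x0).
have nat0 n : 0 < n.+1%:R :> R by rewrite ltr0n.
have Igs (k : R) : 0 < k -> L1 mu (fun x => gauss k (x - x0)).
  move=> k0; have := integrable_reflect x0 (gauss_integrable k0).
  apply: eq_integrable => // x _ /=; congr (_%:E).
  exact: gauss_subC.
have TE n x : T n x = 2 * n.+1%:R * c1 * gauss n.+1%:R (x - x0) by exact: transform_kap.
have IT n : L1 mu (T n).
  have := integrableZR (2 * n.+1%:R * c1) (Igs _ (nat0 n)).
  by apply: eq_integrable => // x _ /=; rewrite TE.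
have intT n : \int[mu]_x T n x = K.
  have -> : \int[mu]_x T n x = \int[mu]_x (2 * n.+1%:R * c1 * gauss n.+1%:R (x0 - x)).
    by apply: eq_Rintegral => x _; rewrite TE; congr (_ * _); exact: gauss_subC.
  rewrite RintegralZl//; last exact: integrable_reflect (gauss_integrable (nat0 n)).
  rewrite Rintegral_reflect; last exact: gauss_integrable (nat0 n).
  rewrite -/(gauss_mass (n.+1%:R : R)) gauss_massE// /K -/c1; field.
  by rewrite addrC natr1 pnatr_eq0.
pose J := \int[mu]_x (`|v x| * gauss 2^-1 (x - x0) + `|v x0| * gauss 2^-1 (x - x0)).
have h20 : 0 < 2^-1 :> R by rewrite invr_gt0.
have IJ : L1 mu (fun x => `|v x| * gauss 2^-1 (x - x0) + `|v x0| * gauss 2^-1 (x - x0)).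
  apply: integrableDR; last by apply: integrableZR; exact: Igs.
  have := integrable_norm (integrable_mul_gauss x0 h20).
  by apply: eq_integrable => // x _ /=; rewrite normrM (gtr0_norm (gauss_gt0 _ _)).
have J0 : 0 <= J by apply: Rintegral_ge0 => x _; rewrite addr_ge0// mulr_ge0// ltW ?gauss_gt0.
apply/cvgrPdist_le => e e0.
have K0 : 0 < K by rewrite mulr_gt0// exprn_gt0.
have /cvgrPdist_le/(_ (e / (2 * K))) := @cv x0.
rewrite divr_gt0 ?mulr_gt0// => /(_ isT) [/= delta d0 Hd].
pose C := 8 * c1 / (3 * delta ^+ 2).
have C0 : 0 < C by rewrite divr_gt0 ?mulr_gt0 ?exprn_gt0.
have pw n x : `|v x0 - v x| * T n x <= e / (2 * K) * T n x +
    C / n.+1%:R * (`|v x| * gauss 2^-1 (x - x0) + `|v x0| * gauss 2^-1 (x - x0)).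
  have T0 : 0 <= T n x by rewrite TE !mulr_ge0 ?(ltW c10)// ltW// gauss_gt0.
  have g0 := gauss_gt0 2^-1 (x - x0).
  have Cn0 : 0 <= C / n.+1%:R by rewrite divr_ge0// ltW.
  have [xd|xd] := ltP `|x0 - x| delta.
    apply: (@le_trans _ _ (e / (2 * K) * T n x)); first by rewrite ler_wpM2r//; exact: Hd.
    by rewrite lerDl mulr_ge0// addr_ge0// mulr_ge0// ltW.
  apply: (@le_trans _ _ (C / n.+1%:R * (`|v x| * gauss 2^-1 (x - x0) + `|v x0| * gauss 2^-1 (x - x0)))); last first.
    by rewrite lerDr mulr_ge0// ltW// divr_gt0 ?mulr_gt0.
  rewrite -mulrDl mulrCA [leLHS]mulrC mulrC.
  have vv : `|v x0 - v x| <= `|v x| + `|v x0| by rewrite distrC; exact: ler_normB.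
  have TC : T n x <= C / n.+1%:R * gauss 2^-1 (x - x0).
    set y := x - x0; set m : R := n.+1%:R; have m0 : 0 < m := nat0 n.
    have m1 : 1 <= m by rewrite ler1n.
    have yd : delta ^+ 2 <= y ^+ 2.
      rewrite -[y ^+ 2](real_normK (num_real y)) /y distrC ler_sqr ?nnegrE//; exact: ltW.
    have gs : gauss m y <= expR (- (3 / 4 * (m * y) ^+ 2)) * gauss 2^-1 y.
      rewrite /gauss -expRD ler_expR.
      have : y ^+ 2 <= (m * y) ^+ 2.
        by rewrite exprMn ler_peMl ?sqr_ge0// exprn_ege1.
      rewrite [(2^-1 * y) ^+ 2]exprMn; lra.
    have ze : (3 / 4 * (m * y) ^+ 2) * expR (- (3 / 4 * (m * y) ^+ 2)) <= 1.
      by apply: id_mul_expRN_le; rewrite mulr_ge0// sqr_ge0.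
    have E0 := expR_gt0 (- (3 / 4 * (m * y) ^+ 2)); move: gs ze E0.
    set E := expR _ => gs ze E0.
    have mE : m ^+ 2 * E <= 4 / (3 * delta ^+ 2).
      rewrite ler_pdivlMr ?mulr_gt0 ?exprn_gt0//.
      apply: (@le_trans _ _ (4 * (3 / 4 * (m * y) ^+ 2 * E))); last by lra.
      rewrite (_ : 4 * _ = m ^+ 2 * E * (3 * y ^+ 2)); last by rewrite exprMn; field.
      by rewrite ler_wpM2l ?mulr_ge0 ?sqr_ge0 ?(ltW E0)// ler_wpM2l.
    rewrite TE -/y -/m.
    apply: (@le_trans _ _ (2 * m * c1 * (E * gauss 2^-1 y))).
      by rewrite ler_wpM2l// !mulr_ge0// ltW.
    rewrite mulrA ler_wpM2r ?(ltW g0)// ler_pdivlMr//.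
    rewrite (_ : 2 * m * c1 * E * m = 2 * c1 * (m ^+ 2 * E)); last by ring.
    apply: (@le_trans _ _ (2 * c1 * (4 / (3 * delta ^+ 2)))).
      by rewrite ler_wpM2l// mulr_ge0// ltW.
    by rewrite /C; apply: eq_ler; ring.
  exact: ler_pM.
have IvT n : L1 mu (fun x => v x * T n x).
  have := integrableZR (2 * n.+1%:R * c1) (integrable_mul_gauss x0 (nat0 n)).
  by apply: eq_integrable => // x _ /=; congr (_%:E); rewrite TE; ring.
near=> n.
have -> : K * v x0 - \int[mu]_x (v x * gauss_transform (kap n) (x - x0)) =
    \int[mu]_x ((v x0 - v x) * T n x).
  have -> : K * v x0 = \int[mu]_x (v x0 * T n x) by rewrite RintegralZl ?intT 1?mulrC//; exact: IT.
  rewrite -RintegralB//; [|exact: integrableZR|exact: IvT].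
  by apply: eq_Rintegral => x _; rewrite mulrBl.
have Ibd : L1 mu (fun x => e / (2 * K) * T n x +
    C / n.+1%:R * (`|v x| * gauss 2^-1 (x - x0) + `|v x0| * gauss 2^-1 (x - x0))).
  by apply: integrableDR; exact: integrableZR.
apply: (@le_trans _ _ (\int[mu]_x (e / (2 * K) * T n x +
    C / n.+1%:R * (`|v x| * gauss 2^-1 (x - x0) + `|v x0| * gauss 2^-1 (x - x0))))).
  apply: normr_Rintegral_le => //.
    apply: measurable_funM; last exact: integrable_measurable (IT n).
    by apply: continuous_measurableT => x; apply: cvgB; [exact: cvg_cst|exact: cv].
  move=> x; rewrite normrM (@ger0_norm _ (T n x)) ?pw// TE.
  by rewrite !mulr_ge0 ?(ltW c10)// ltW// gauss_gt0.
rewrite RintegralD//; [|exact: integrableZR|exact: integrableZR].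
rewrite !RintegralZl// intT -/J.
have -> : e / (2 * K) * K = e / 2 by field; rewrite gt_eqF.
have : C / n.+1%:R * J <= e / 2.
  rewrite mulrAC ler_pdivrMr// -ler_pdivrMl ?divr_gt0//.
  apply: (@le_trans _ _ n%:R); last by rewrite ler_nat.
  by near: n; exact: nbhs_infty_ger.
by move=> h1; apply: (le_trans (lerD (lexx (e / 2)) h1)); rewrite -splitr.
Unshelve. all: by end_near. Qed.

(** The Gaussian cutoff is removed by dominated convergence on the Fourier side
    and by the approximate identity on the other. *)
Lemma fourier_inversion (x0 : R) : trig_integral a b x0 = K * v x0.
Proof.
have c1 : (fun n => \int[mu]_y ((a y * cos (x0 * y) - b y * sin (x0 * y)) * gauss (kap n) y))
    @ \oo --> trig_integral a b x0.
  have It := integrable_trig x0 Ia Ib.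
  apply: (@Rintegral_dominated_cvg _ _ R mu _ _ (fun y => `|a y * cos (x0 * y) - b y * sin (x0 * y)|)).
  - move=> n; apply: measurable_funM; first exact: integrable_measurable It.
    exact: integrable_measurable (gauss_integrable (kap_gt0 n)).
  - exact: integrable_measurable It.
  - move=> y; rewrite -[X in _ --> X]mulr1; apply: cvgM; first exact: cvg_cst.
    have cg : continuous (fun k : R => gauss k y).
      move=> k; apply: (@continuous_comp _ _ _ (fun k : R => - (k * y) ^+ 2) expR); last exact: continuous_expR.
      apply: cvgN; apply: (@continuous_comp _ _ _ (fun k : R => k * y) (fun z => z ^+ 2)); last exact: exprn_continuous.
      by apply: cvgM; [exact: cvg_id|exact: cvg_cst].
    have <- : gauss 0 y = 1 by rewrite /gauss mul0r expr0n/= oppr0 expR0.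
    apply: (@cvg_comp _ _ _ kap (fun k => gauss k y) _ (nbhs (0 : R))); last exact: cg.
    rewrite (_ : kap = fun n => 2^-1 * n.+1%:R^-1); last by apply/funext => n; rewrite /kap invfM.
    have : (fun n : nat => 2^-1 * n.+1%:R^-1 : R) @ \oo --> (2^-1 * 0 : R).
      by apply: cvgM; [exact: cvg_cst|exact: cvg_harmonic].
    by rewrite mulr0.
  - by move=> n y; rewrite normrM ler_piMr// gtr0_norm ?gauss_gt0 ?gauss_le1.
  - exact: integrable_norm It.
have c2 := @gauss_approximate_identity x0.
rewrite -(cvg_lim (@Rhausdorff R) c1) -(cvg_lim (@Rhausdorff R) c2).
by congr (lim (_ @ \oo)); apply/funext => n; exact: approximate_inversion (kap_gt0 n).
Qed.

End fourier_inversion.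

(** * The Sobolev embedding *)

Definition bounded_C3 (R : realType) (v : R -> R) (M : R) : Prop :=
  exists v1 v2 v3 : R -> R,
    (forall x : R, [/\ is_derive x 1 v (v1 x), is_derive x 1 v1 (v2 x) & is_derive x 1 v2 (v3 x)]) /\
    (forall x : R, [/\ `|v x| <= M, `|v1 x| <= M, `|v2 x| <= M & `|v3 x| <= M]).

Lemma bounded_C3D (R : realType) (v w : R -> R) (M N : R) :
  bounded_C3 v M -> bounded_C3 w N -> bounded_C3 (fun x => v x + w x) (M + N).
Proof.
move=> [v1 [v2 [v3 [dv bv]]]] [w1 [w2 [w3 [dw bw]]]].
exists (fun x => v1 x + w1 x), (fun x => v2 x + w2 x), (fun x => v3 x + w3 x).
split=> x.
  by have [? ? ?] := dv x; have [? ? ?] := dw x; split; exact: is_deriveD.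
have [? ? ? ?] := bv x; have [? ? ? ?] := bw x.
by split; apply: (le_trans (ler_normD _ _)); exact: lerD.
Qed.

Lemma bounded_C3Z (R : realType) (c : R) (v : R -> R) (M : R) :
  bounded_C3 v M -> bounded_C3 (fun x => c * v x) (`|c| * M).
Proof.
move=> [v1 [v2 [v3 [dv bv]]]].
exists (fun x => c * v1 x), (fun x => c * v2 x), (fun x => c * v3 x).
split=> x.
  by have [? ? ?] := dv x; split; exact: is_deriveZ.
by have [? ? ? ?] := bv x; split; rewrite normrM ler_wpM2l.
Qed.

Lemma bounded_C3_le (R : realType) (v : R -> R) (M N : R) :
  M <= N -> bounded_C3 v M -> bounded_C3 v N.
Proof.
move=> MN [v1 [v2 [v3 [dv bv]]]]; exists v1, v2, v3; split=> // x.
by have [? ? ? ?] := bv x; split; exact: le_trans MN.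
Qed.

Section sobolev_embedding.
Context (R : realType).
Let mu := @lebesgue_measure R.

Lemma young_weighted (p u w : R) : 0 < p -> 0 <= u -> 0 <= w ->
  u * w <= 2^-1 * (p * u ^+ 2 + p^-1 * w ^+ 2).
Proof.
move=> p0 u0 w0; rewrite -(ler_pM2l p0).
have -> : p * (2^-1 * (p * u ^+ 2 + p^-1 * w ^+ 2)) = 2^-1 * ((p * u) ^+ 2 + w ^+ 2).
  by field; rewrite gt_eqF.
by have := sqr_ge0 (p * u - w); rewrite sqrrB; lra.
Qed.

(** Young's inequality with weight [(1 + y ^ 2) ^ s]. Three powers of [y] cost
    the power [3] of [1 + y ^ 2] in the last term, which is integrable exactly
    if [s - 3 > 1 / 2]: this is where [s > 7 / 2] comes from. *)
Lemma weighted_fourier_le (s y a : R) (k : nat) : (k <= 3)%N ->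
  `|y| ^+ k * `|a| <= 2^-1 * ((1 + y ^+ 2) `^ s * a ^+ 2 + (1 + y ^+ 2) `^ (- (s - 3))).
Proof.
move=> k3; set P := 1 + y ^+ 2.
have P1 : 1 <= P by rewrite lerDl sqr_ge0.
have P0 : 0 < P := lt_le_trans ltr01 P1.
rewrite mulrC; apply: (le_trans (@young_weighted (P `^ s) _ _ _ _ _)) => //.
  by rewrite powR_gt0.
rewrite real_normK ?num_real// ler_wpM2l// lerD2l -exprM mulnC exprM real_normK ?num_real//.
rewrite opprB addrC powRD; last by rewrite (gt_eqF P0) implybT.
rewrite powRN ler_wpM2l ?invr_ge0 ?powR_ge0//.
rewrite (powR_mulrn 3) ?(ltW P0)//.
apply: (@le_trans _ _ (P ^+ k)); last exact: ler_weXn2l.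
by apply: lerXn2r; rewrite ?nnegrE ?sqr_ge0 ?(ltW P0)// /P lerDr.
Qed.

(** The derivative on the Fourier side: [a + 'i b] becomes ['i y (a + 'i b)]. *)
Definition trig_shift (A : (R -> R) * (R -> R)) : (R -> R) * (R -> R) :=
  (fun y => - (y * A.2 y), fun y => y * A.1 y).

Lemma trig_shift_norm (k : nat) (a b : R -> R) (y : R) :
  `|(iter k trig_shift (a, b)).1 y| + `|(iter k trig_shift (a, b)).2 y| =
  `|y| ^+ k * (`|a y| + `|b y|).
Proof.
elim: k => [|k IHk]/=; first by rewrite expr0 mul1r.
by rewrite normrN !normrM -mulrDr addrC IHk exprS mulrA.
Qed.

Lemma trig_shift_measurable (k : nat) (a b : R -> R) :
  measurable_fun setT a -> measurable_fun setT b ->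
  measurable_fun setT (iter k trig_shift (a, b)).1 /\
  measurable_fun setT (iter k trig_shift (a, b)).2.
Proof.
move=> ma mb; elim: k => [|k [IH1 IH2]]//=; split.
  by apply: measurable_funN; apply: measurable_funM => //; exact: measurable_id.
by apply: measurable_funM => //; exact: measurable_id.
Qed.

Lemma sobolev_weight_integrable (s r : R) (v : R -> R) :
  (sobolev_norm s v < r%:E)%E -> exists a b : R -> R,
  [/\ measurable_fun setT a, measurable_fun setT b, is_fourier v a b,
      L1 mu (fun y => (1 + y ^+ 2) `^ s * (a y ^+ 2 + b y ^+ 2)) &
      \int[mu]_y ((1 + y ^+ 2) `^ s * (a y ^+ 2 + b y ^+ 2)) <= r ^+ 2].
Proof.
move=> /ereal_inf_lt[_ [a [b [ma mb fv ->]]] Nr].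
exists a, b; set Q := fun y => _.
have Q0 y : 0 <= Q y by rewrite mulr_ge0 ?powR_ge0// addr_ge0 ?sqr_ge0.
have mQ : measurable_fun setT Q.
  apply: measurable_funM; last by apply: measurable_funD; exact: measurable_funX.
  apply: (@measurableT_comp _ _ _ _ _ _ (fun t : R => t `^ s)); first exact: measurable_powR.
  by apply: measurable_funD => //; exact: measurable_funX.
have r0 : 0 <= r by rewrite -lee_fin; exact: le_trans (Lnorm_ge0 _ _ _) (ltW Nr).
have intQ : (\int[mu]_y (Q y)%:E <= (r ^+ 2)%:E)%E.
  have -> : (\int[mu]_y (Q y)%:E)%E = poweR (Lnorm mu 2%:E (fun xi : measurableTypeR R =>
              ((1 + xi ^+ 2) `^ (s / 2) * Num.sqrt (a xi ^+ 2 + b xi ^+ 2))%:E)) 2.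
    rewrite poweR_Lnorm//; apply: eq_integral => y _.
    rewrite gee0_abs ?lee_fin ?mulr_ge0 ?powR_ge0 ?sqrtr_ge0// poweR_EFin; congr EFin.
    rewrite powRM ?powR_ge0 ?sqrtr_ge0// -powRrM divfK// powR_mulrn ?sqrtr_ge0//.
    by rewrite sqr_sqrtr// addr_ge0 ?sqr_ge0.
  have -> : (r ^+ 2)%:E = poweR r%:E 2 by rewrite poweR_EFin powR_mulrn.
  apply: gt0_ler_poweR => //; rewrite ?in_itv/= ?leey ?andbT ?lee_fin//; last exact: ltW.
  exact: Lnorm_ge0.
have IQ : L1 mu Q.
  apply/integrableP; split; first exact/measurable_EFinP.
  under eq_integral do rewrite /= ger0_norm//.
  exact: le_lt_trans intQ (ltry _).
split => //; rewrite -lee_fin /Rintegral fineK//.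
exact: integrable_fin_num.
Qed.

(** By Fourier inversion [v] and its first three derivatives are integrals of
    functions dominated by [|y| ^ k * (|a y| + |b y|)] with [k <= 3], which
    Young's inequality bounds by the norm. That [M] is the same for all [v] is
    what turns convergence in the Sobolev norm into bounds along a curve. *)
Lemma sobolev_embedding (s r : R) : 7 / 2 < s -> exists M : R, forall v : R -> R,
  sobolev s v -> (sobolev_norm s v < r%:E)%E -> bounded_C3 v M.
Proof.
move=> s7; pose K : R := 2 * gauss_mass 1 ^+ 2.
have K0 : 0 < K by rewrite mulr_gt0// exprn_gt0// gauss_mass_gt0.
have s3 : 2^-1 < s - 3 by lra.
have IP := integrable_powRN s3.
exists (K^-1 * (2^-1 * r ^+ 2 + \int[mu]_y (1 + y ^+ 2) `^ (- (s - 3)))).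
move=> v [cv v2 _] /sobolev_weight_integrable[a [b [ma mb fv IQ Qr]]].
pose W (y : R) := 2^-1 * ((1 + y ^+ 2) `^ s * (a y ^+ 2 + b y ^+ 2)) + (1 + y ^+ 2) `^ (- (s - 3)).
have IW : L1 mu W.
  by apply: integrableDR => //; exact: integrableZR.
have intW : \int[mu]_y W y <= 2^-1 * r ^+ 2 + \int[mu]_y (1 + y ^+ 2) `^ (- (s - 3)).
  rewrite /W RintegralD//; last exact: integrableZR.
  by rewrite RintegralZl// lerD2r ler_wpM2l.
pose A k := (iter k trig_shift (a, b)).1; pose B k := (iter k trig_shift (a, b)).2.
have AB (k : nat) (y : R) : (k <= 3)%N -> `|A k y| + `|B k y| <= W y.
  move=> k3; rewrite trig_shift_norm mulrDr.
  have := @weighted_fourier_le s y (a y) k k3; have := @weighted_fourier_le s y (b y) k k3.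
  rewrite /W; lra.
have mA k : measurable_fun setT (A k) by have [] := trig_shift_measurable k ma mb.
have mB k : measurable_fun setT (B k) by have [] := trig_shift_measurable k ma mb.
have IA k : (k <= 3)%N -> L1 mu (A k).
  move=> k3; apply: integrable_dominated IW => [|y]; first exact: mA.
  by apply: le_trans (AB k y k3); rewrite lerDl.
have IB k : (k <= 3)%N -> L1 mu (B k).
  move=> k3; apply: integrable_dominated IW => [|y]; first exact: mB.
  by apply: le_trans (AB k y k3); rewrite lerDr.
pose w k (x : R) := K^-1 * trig_integral (A k) (B k) x.
have vE : v = w 0%N.
  apply/funext => x; rewrite /w (fourier_inversion cv v2 fv (IA 0 _) (IB 0 _))//.
  by rewrite mulKf// gt_eqF.
have dw (k : nat) (x : R) : (k < 3)%N -> is_derive x 1 (w k) (w k.+1 x).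
  move=> k3; have k3' := ltnW k3.
  have IyA : L1 mu (fun y => y * A k y) by exact: (IB k.+1 k3).
  have IyB : L1 mu (fun y => y * B k y).
    have := integrableZR (-1) (IA k.+1 k3).
    by apply: eq_integrable => // y _ /=; rewrite mulrN mulN1r opprK.
  have ? := trig_integral_is_derive (IA k k3') (IB k k3') IyA IyB x.
  exact: is_deriveZ.
have bw (k : nat) (x : R) : (k <= 3)%N ->
    `|w k x| <= K^-1 * (2^-1 * r ^+ 2 + \int[mu]_y (1 + y ^+ 2) `^ (- (s - 3))).
  move=> k3; rewrite /w normrM gtr0_norm ?invr_gt0// ler_wpM2l ?invr_ge0 ?(ltW K0)//.
  apply: le_trans intW; apply: (trig_integral_le _ (mA k) (mB k) _ IW) => y.
  exact: AB.
rewrite vE; exists (w 1%N), (w 2%N), (w 3%N).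
by split=> x; split; (exact: dw || exact: bw).
Qed.

End sobolev_embedding.

(** * Uniform bounds along a Sobolev curve *)

Lemma segment_locally_bounded (R : realType) (T : R) (P : R -> R -> Prop) :
  (forall t : R, 0 <= t <= T -> exists M : R, \forall tau \near t,
     forall N : R, M <= N -> 0 <= tau <= T -> P N tau) ->
  exists M : R, forall t : R, 0 <= t <= T -> P M t.
Proof.
move=> H.
have /compact_near_coveringP/(_ R (+oo%R : set_system R) (fun M t => 0 <= t <= T -> P M t) _) :=
  @segment_compact R 0 T.
case=> [t|]; last first.
  move=> M0 [_ HM]; exists (M0 + 1) => t tT; have := HM (M0 + 1).
  by rewrite ltrDl => /(_ ltr01 t); apply=> //; rewrite /= in_itv/=.
rewrite /= in_itv/= => /H[M HM].
exists ([set tau | forall N : R, M <= N -> 0 <= tau <= T -> P N tau], [set N | M <= N]) => /=.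
  by split; [exact: HM|apply: nbhs_pinfty_ge; exact: num_real].
by move=> [tau N]/= [Htau MN]; exact: Htau.
Qed.

Lemma segment_continuous_lipschitz (R : realType) (T : R) (f : R -> R) :
  (forall t : R, 0 <= t <= T -> exists2 L : R, 0 <= L & \forall tau \near t,
     0 <= tau <= T -> `|f tau - f t| <= `|tau - t| * L) ->
  {within `[0, T], continuous f}.
Proof.
move=> H; apply/subspace_continuousP => t; rewrite /= in_itv/= => /H[L L0 HL].
apply/cvgrPdist_le => e e0.
have Le : 0 < e / (L + 1) by rewrite divr_gt0// ltr_wpDl.
have near1 : \forall tau \near t, `|t - tau| <= e / (L + 1).
  by have /cvgrPdist_le/(_ _ Le) := @cvg_id _ (nbhs t).
rewrite near_withinE; near=> tau.
have HB : 0 <= tau <= T -> `|f tau - f t| <= `|tau - t| * L by near: tau.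
have d1 : `|t - tau| <= e / (L + 1) by near: tau.
rewrite /= in_itv/= => /HB b; rewrite distrC; apply: (le_trans b).
rewrite distrC; apply: (le_trans (ler_wpM2r L0 d1)).
rewrite mulrAC ler_pdivrMr ?ltr_wpDl// ler_wpM2l ?(ltW e0)//.
by rewrite lerDl.
Unshelve. all: by end_near. Qed.

Section sobolev_curve.
Context (R : realType).
Let mu := @lebesgue_measure R.

Lemma Lfun2_lincomb (c : R) (f g : R -> R) : f \in Lfun mu 2%:E -> g \in Lfun mu 2%:E ->
  (fun x => c * f x + g x) \in Lfun mu 2%:E.
Proof.
move=> f2 g2; have p1 : (1 <= 2%:E :> \bar R)%E by rewrite lee_fin ler1n.
have [_ H] := @Lfun_submod_closed _ _ _ mu 2%:E p1; exact: (H c f g).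
Qed.

Lemma sobolev_quotient (s c : R) (v w z : R -> R) :
  sobolev s v -> sobolev s w -> sobolev s z ->
  (sobolev_norm s (fun x => ((v x - w x) / c - z x)%R) < +oo)%E ->
  sobolev s (fun x => (v x - w x) / c - z x).
Proof.
move=> [cv v2 _] [cw w2 _] [cz z2 _] qN; split => //.
  by move=> x; apply: cvgB; [apply: cvgM; [apply: cvgB; [exact: cv|exact: cw]|exact: cvg_cst]|exact: cz].
rewrite (_ : (fun x => _) = (fun x => -1 * z x + (c^-1 * (-1 * w x + v x) + (0 * z x + 0 * z x)))); last first.
  by apply/funext => x; ring.
have Z0 : (fun x => 0 * z x + 0 * z x) \in Lfun mu 2%:E.
  rewrite (_ : (fun x => _) = (fun x => -1 * z x + z x)); first exact: Lfun2_lincomb.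
  by apply/funext => x; ring.
by apply: Lfun2_lincomb => //; apply: Lfun2_lincomb => //; exact: Lfun2_lincomb.
Qed.

Lemma sobolev_bounded_C3 (s : R) (v : R -> R) : 7 / 2 < s -> sobolev s v ->
  exists M, bounded_C3 v M.
Proof.
move=> s7 sv; have [_ _ N] := sv.
have [M HM] := sobolev_embedding (fine (sobolev_norm s v) + 1) s7.
exists M; apply: HM => //.
have N0 : (0 <= sobolev_norm s v)%E.
  by apply: le_ereal_inf_tmp => _ [a [b [_ _ _ ->]]]; exact: Lnorm_ge0.
rewrite -[X in (X < _)%E]fineK; first by rewrite lte_fin ltrDl.
by rewrite ge0_fin_numE.
Qed.

Variables (s T : R) (u u' : R -> R -> R).
Hypothesis s7 : 7 / 2 < s.
Hypothesis hu : C1_curve (sobolev s) (sobolev_norm s) [set t | 0 <= t <= T] u u'.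

(** Near [t] the difference quotient is within Sobolev distance [1] of the
    derivative at [t], hence their difference is bounded in [C^3] uniformly in
    [tau]. *)
Lemma sobolev_curve_lipschitz (t : R) : 0 <= t <= T -> exists2 L : R, 0 <= L &
  \forall tau \near t, 0 <= tau <= T ->
    bounded_C3 (fun x => u tau x - u t x) (`|tau - t| * L).
Proof.
move=> tT; have [hE hD _] := hu; have [ut u't] := hE t tT.
have [C HC] := sobolev_embedding 1 s7.
have [M' HM'] := sobolev_bounded_C3 s7 u't.
have M'0 : 0 <= M' by have [? [? [? [_ /(_ 0)[b _ _ _]]]]] := HM'; apply: le_trans b.
exists (`|C| + M'); first by rewrite addr_ge0.
have N1 : nbhs (0%E : \bar R) [set y : \bar R | (y < 1%:E)%E].
  by apply: open_nbhs_nbhs; split; [exact: open_ereal_lt_ereal|rewrite /= lte01].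
have H : \forall tau \near t, tau != t -> 0 <= tau <= T ->
   (sobolev_norm s (fun x => ((u tau x - u t x) / (tau - t) - u' t x)%R) < 1%:E)%E := hD t tT _ N1.
apply: filterS H => tau Htau tauT.
have [->|nt] := eqVneq tau t.
  rewrite (_ : (fun x => _) = (fun x => 0 * u' t x)); last by apply/funext => x; rewrite subrr mul0r.
  by have := bounded_C3Z 0 HM'; rewrite subrr normr0 !mul0r.
have {}Htau := Htau nt tauT.
have nt0 : tau - t != 0 by rewrite subr_eq0.
have sq : sobolev s (fun x => (u tau x - u t x) / (tau - t) - u' t x).
  apply: (sobolev_quotient (hE tau tauT).1 ut u't).
  by apply: (lt_trans Htau); exact: ltry.
have := bounded_C3Z (tau - t) (bounded_C3D (bounded_C3_le (ler_norm C) (HC _ sq Htau)) HM').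
congr bounded_C3; apply/funext => x; field.
exact: nt0.
Qed.

(** Local bounds become global by compactness of [0, T]. *)
Lemma sobolev_curve_bounded : exists M : R, forall t : R, 0 <= t <= T -> bounded_C3 (u t) M.
Proof.
apply: (@segment_locally_bounded R T (fun M t => bounded_C3 (u t) M)) => t tT.
have [L L0 HL] := sobolev_curve_lipschitz tT.
have [Mt HMt] : exists Mt, bounded_C3 (u t) Mt.
  by have [hE _ _] := hu; exact: sobolev_bounded_C3 s7 (hE t tT).1.
have near1 : \forall tau \near t, `|t - tau| <= 1.
  by have /cvgrPdist_le/(_ _ ltr01) := @cvg_id _ (nbhs t).
exists (Mt + L); apply: filterS2 HL near1 => tau Htau tau1 M ML tauT.
have := bounded_C3D HMt (Htau tauT).
rewrite (_ : (fun x => _) = u tau); last by apply/funext => x; rewrite addrC subrK.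
apply: bounded_C3_le; apply: le_trans ML; rewrite lerD2l ler_piMl//.
by rewrite distrC.
Qed.

Lemma sobolev_curve_continuous (x : R) : {within `[0, T], continuous (fun t => u t x)}.
Proof.
apply: segment_continuous_lipschitz => t tT.
have [L L0 HL] := sobolev_curve_lipschitz tT; exists L => //.
by apply: filterS HL => tau /[apply] -[? [? [? [_ /(_ x)[]]]]].
Qed.

End sobolev_curve.

(** * Composition with the nonlinearity *)

Lemma class_C_local_bounds (R : realType) (k : nat) (f : R -> R) (K : R) :
  class_C k f -> (4 <= k)%N -> 0 <= K ->
  exists (f1 f2 f3 : R -> R) (L : R),
    (forall x : R, [/\ is_derive x 1 f (f1 x), is_derive x 1 f1 (f2 x) & is_derive x 1 f2 (f3 x)]) /\
    (forall x : R, `|x| <= K -> [/\ `|f x| <= L, `|f1 x| <= L, `|f2 x| <= L & `|f3 x| <= L]).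
Proof.
move=> [df _] k4 K0.
have dn (n : nat) (x : R) : (n < 4)%N -> is_derive x 1 (f^`(n))%classic ((f^`(n.+1))%classic x).
  move=> n4; have d := df n x (leq_trans n4 k4).
  by apply: (is_derive_eq (derivableP d)); rewrite -derive1E.
have bn (n : nat) : (n < 4)%N -> exists2 L : R, 0 <= L & forall x : R, `|x| <= K -> `|(f^`(n))%classic x| <= L.
  move=> n4; have cf : continuous (f^`(n))%classic by exact: is_derive_continuous (fun x => dn n x n4).
  have KK : - K <= K by lra.
  have cnf : {within `[- K, K], continuous (fun x => `|(f^`(n))%classic x|)}.
    by apply: continuous_subspaceT => x; apply: cvg_norm; exact: cf.
  have [c _ Hc] := EVT_max KK cnf.
  exists (`|(f^`(n))%classic c|) => // x; rewrite ler_norml => xK.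
  by apply: Hc; rewrite in_itv.
have [L0 L00 H0] := bn 0%N isT; have [L1 L10 H1] := bn 1%N isT.
have [L2 L20 H2] := bn 2%N isT; have [L3 L30 H3] := bn 3%N isT.
exists (f^`(1))%classic, (f^`(2))%classic, (f^`(3))%classic, (L0 + L1 + L2 + L3).
split=> x; first by split; [exact: (dn 0%N)|exact: (dn 1%N)|exact: (dn 2%N)].
move=> xK; split.
- by apply: le_trans (H0 x xK) _; lra.
- by apply: le_trans (H1 x xK) _; lra.
- by apply: le_trans (H2 x xK) _; lra.
- by apply: le_trans (H3 x xK) _; lra.
Qed.

Lemma bounded_C3_comp (R : realType) (f f1 f2 f3 v : R -> R) (K L : R) :
  (forall x : R, [/\ is_derive x 1 f (f1 x), is_derive x 1 f1 (f2 x) & is_derive x 1 f2 (f3 x)]) ->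
  (forall x : R, `|x| <= K -> [/\ `|f x| <= L, `|f1 x| <= L, `|f2 x| <= L & `|f3 x| <= L]) ->
  bounded_C3 v K -> bounded_C3 (f \o v) (L * (1 + K) ^+ 3).
Proof.
move=> df bf [v1 [v2 [v3 [dv bv]]]].
exists (fun x => f1 (v x) * v1 x), (fun x => f2 (v x) * v1 x ^+ 2 + f1 (v x) * v2 x),
  (fun x => f3 (v x) * v1 x ^+ 3 + 3 * (f2 (v x) * (v1 x * v2 x)) + f1 (v x) * v3 x).
split=> x.
  have [d1 d2 d3] := dv x; have [e1 e2 e3] := df (v x).
  have c1 := is_derive1_comp e1 d1.
  have c2 : is_derive x 1 (fun x => f1 (v x)) (f2 (v x) * v1 x) := is_derive1_comp e2 d1.
  have c3 : is_derive x 1 (fun x => f2 (v x)) (f3 (v x) * v1 x) := is_derive1_comp e3 d1.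
  split; first exact: c1.
    by apply: is_derive_eq; rewrite /GRing.scale/=; ring.
  by apply: is_derive_eq; rewrite /GRing.scale/=; ring.
have [b0 b1 b2 b3] := bv x; have [a0 a1 a2 a3] := bf _ b0.
have K0 : 0 <= K := le_trans (normr_ge0 _) b0.
have L0 : 0 <= L := le_trans (normr_ge0 _) a0.
have LK n : 0 <= L * K ^+ n by rewrite mulr_ge0// exprn_ge0.
have E : L * (1 + K) ^+ 3 = L + 3 * (L * K) + 3 * (L * K ^+ 2) + L * K ^+ 3 by ring.
have p1 := LK 1%N; have p2 := LK 2%N; have p3 := LK 3%N; rewrite expr1 in p1.
have b1X n : `|v1 x ^+ n| <= K ^+ n by rewrite normrX lerXn2r ?nnegrE.
have q12 : `|v1 x * v2 x| <= K ^+ 2 by rewrite normrM expr2 ler_pM.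
have m (p q P Q : R) : `|p| <= P -> `|q| <= Q -> `|p * q| <= P * Q by move=> pP qQ; rewrite normrM ler_pM.
rewrite E; split.
- by apply: le_trans a0 _; lra.
- by apply: le_trans (m _ _ _ _ a1 b1) _; lra.
- apply: le_trans (ler_normD _ _) _.
  apply: le_trans (lerD (m _ _ _ _ a2 (b1X 2%N)) (m _ _ _ _ a1 b2)) _; lra.
- apply: le_trans (ler_normD _ _) _; apply: le_trans (lerD (ler_normD _ _) (lexx _)) _.
  have n3 : `|3 : R| <= 3 by rewrite ger0_norm.
  apply: le_trans (lerD (lerD (m _ _ _ _ a3 (b1X 3%N)) (m _ _ _ _ n3 (m _ _ _ _ a2 q12))) (m _ _ _ _ a1 b3)) _; lra.
Qed.

Section clamp.
Variable R : realType.

(** Composition with [clamp K] makes a locally Lipschitz nonlinearity bounded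
    and globally Lipschitz without changing it on [-K, K]. *)
Definition clamp (K x : R) : R := Num.max (- K) (Num.min K x).

Lemma clamp_le (K x : R) : 0 <= K -> `|clamp K x| <= K.
Proof.
move=> K0; rewrite ler_norml /clamp le_max lexx/= ge_max ge_min lexx/= andbT; lra.
Qed.

Lemma clamp_id (K x : R) : `|x| <= K -> clamp K x = x.
Proof. by rewrite ler_norml /clamp => /andP[Kx xK]; rewrite min_r// max_r. Qed.

Lemma clamp_contract (K x y : R) : `|clamp K x - clamp K y| <= `|x - y|.
Proof.
rewrite /clamp; set a := Num.min K x; set b := Num.min K y.
have ab : `|a - b| <= `|x - y|.
  rewrite /a /b; have [xK|Kx] := leP K x; have [yK|Ky] := leP K y => //.
  - by rewrite subrr normr0.
  - rewrite !ger0_norm; lra.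
  - rewrite !ler0_norm; lra.
apply: le_trans ab.
have [aK|Ka] := leP (- K) a; have [bK|Kb] := leP (- K) b => //.
- rewrite !ger0_norm; lra.
- rewrite !ler0_norm; lra.
- by rewrite subrr normr0.
Qed.

Lemma lipschitz_on_ball (f f' : R -> R) (K L x y : R) :
  (forall z : R, is_derive z 1 f (f' z)) -> (forall z : R, `|z| <= K -> `|f' z| <= L) ->
  `|x| <= K -> `|y| <= K -> `|f x - f y| <= L * `|x - y|.
Proof.
move=> df f'L; rewrite (ler_norml x) (ler_norml y) => xK yK.
apply: (@derive_lipschitz_on R f f' (- K) K) => // z; rewrite -ler_norml; exact: f'L.
Qed.

End clamp.

(** * Global solutions of systems with a bounded Lipschitz right-hand side *)

Lemma max0_contract (R : realType) (x y : R) : `|Num.max x 0 - Num.max y 0| <= `|x - y|.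
Proof.
have [x0|x0] := leP x 0; have [y0|y0] := leP y 0 => //.
- by rewrite subrr normr0.
- rewrite !ler0_norm; lra.
- rewrite !ger0_norm; lra.
Qed.

Section picard.
Variables (R : realType) (I : Type) (F : (I -> R) -> I -> R) (phi : I -> R) (A L : R).
Hypothesis L0 : 0 < L.
Hypothesis FA : forall w i, `|F w i| <= A.
Hypothesis FL : forall (w z : I -> R) (m : R),
  (forall j, `|w j - z j| <= m) -> forall i, `|F w i - F z i| <= L * m.

Let lipschitz_path (w : R -> I -> R) : Prop :=
  forall i (s t : R), 0 <= s -> 0 <= t -> `|w t i - w s i| <= A * `|t - s|.

Lemma solution_lipschitz (w : R -> I -> R) (c : R -> I -> R) :
  (forall i (t : R), 0 <= t -> is_derive t 1 (w^~ i) (c t i)) ->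
  (forall t i, `|c t i| <= A) -> lipschitz_path w.
Proof.
move=> dw cA i s t s0 t0.
have [sm tm] : s <= Num.max s t /\ t <= Num.max s t by rewrite !le_max !lexx orbT.
apply: (@derive_lipschitz_on _ (w^~ i) (c^~ i) 0 (Num.max s t)); rewrite ?s0 ?t0//.
by move=> x /andP[x0 _]; exact: dw.
Qed.

(** The right-hand side is continued to the left of [0] by its value at [0],
    which makes the new iterate differentiable, on both sides, at [0] too. *)
Local Lemma picard_step (z : R -> I -> R) : exists y : R -> I -> R, lipschitz_path z ->
  y 0 = phi /\ forall i (t : R), 0 <= t -> is_derive t 1 (y^~ i) (F (z t) i).
Proof.
have [zA|nz] := pselect (lipschitz_path z); last by exists z.
have A0 i : 0 <= A := le_trans (normr_ge0 _) (FA phi i).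
pose c i (t : R) := F (z (Num.max t 0)) i.
have cc i : continuous (c i).
  move=> t; apply/cvgrPdist_le => e e0.
  have LA : 0 < L * A + 1 by rewrite ltr_wpDl// mulr_ge0 ?(ltW L0)// A0.
  have near1 : \forall tau \near t, `|t - tau| <= e / (L * A + 1).
    by have /cvgrPdist_le/(_ _ (divr_gt0 e0 LA)) := @cvg_id _ (nbhs t).
  near=> tau; have d1 : `|t - tau| <= e / (L * A + 1) by near: tau.
  have mm := max0_contract t tau.
  have zz j : `|z (Num.max t 0) j - z (Num.max tau 0) j| <= A * `|t - tau|.
    by apply: le_trans (zA j _ _ _ _) _; rewrite ?le_max ?lexx ?orbT// ler_wpM2l ?A0.
  apply: (le_trans (FL zz i)); rewrite mulrA.
  apply: (le_trans (ler_wpM2l _ d1)); first by rewrite mulr_ge0 ?(ltW L0) ?A0.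
  by rewrite mulrCA ler_piMr ?(ltW e0)// ler_pdivrMr// mul1r lerDl.
have /choice[Phi dPhi] i := antiderivative_on (-1) (cc i).
exists (fun t i => Phi i t - Phi i 0 + phi i) => _; split.
  by apply/funext => i; rewrite subrr add0r.
move=> i t t0; have d1 := dPhi i t (lt_le_trans (ltrN10 R) t0).
have -> : F (z t) i = c i t by rewrite /c max_l.
by apply: is_derive_eq; rewrite subr0 addr0.
Unshelve. all: by end_near. Qed.

Local Lemma le_geometric (a b c : R) : (forall n, a <= b + c * 2^-1 ^+ n) -> a <= b.
Proof.
move=> H; have c1 : (fun n => b + c * 2^-1 ^+ n) @ \oo --> (b + c * 0 : R).
  apply: cvgD; first exact: cvg_cst.
  apply: cvgM; first exact: cvg_cst.
  by apply: cvg_expr; rewrite ger0_norm ?invr_ge0// invf_lt1// ltr1n.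
rewrite -(addr0 b) -(mulr0 c) -(cvg_lim (@Rhausdorff R) c1).
apply: limr_ge; first by apply: cvgP c1.
exact: nearW.
Qed.

(** Successive approximations [W n]. For the weight [exp (2 L t)] each step
    halves the distance of two iterates, uniformly in the component: this is
    the bound [D]. Since [D n.+1 = D n / 2], the sequences [W n + 2 D n] are
    nonincreasing, whence the limit; equicontinuity in time passes to it, so
    that one more step can be applied to the limit, which it leaves fixed. *)
Lemma picard_lindelof : exists w : R -> I -> R, w 0 = phi /\
  forall i (t : R), 0 <= t -> is_derive t 1 (w^~ i) (F (w t) i).
Proof.
have [[i0 _]|noI] := pselect (exists i : I, True); last first.
  by exists (fun _ => phi); split=> // i; case: noI; exists i.
have A0 : 0 <= A :=  le_trans (normr_ge0 _) (FA phi i0).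
have [step Hstep] := choice picard_step.
pose W n := iter n step (fun _ => phi).
have lW n : lipschitz_path (W n).
  elim: n => [|n IHn]; first by move=> i s t _ _; rewrite subrr normr0 mulr_ge0.
  by apply: (@solution_lipschitz _ (fun t => F (W n t))) => // i t t0; exact: (Hstep _ IHn).2.
have W0 n : W n 0 = phi by case: n => // n; exact: (Hstep _ (lW n)).1.
have dW n i (t : R) : 0 <= t -> is_derive t 1 (W n.+1 ^~ i) (F (W n t) i).
  exact: (Hstep _ (lW n)).2.
pose D n (t : R) := A / (2 * L) * 2^-1 ^+ n * expR (2 * L * t).
have D0 n t : 0 <= D n t.
  rewrite !mulr_ge0 ?exprn_ge0 ?(ltW (expR_gt0 _))// ?invr_ge0//.
  by rewrite mulr_ge0// ltW.
have DS n t : D n.+1 t = D n t / 2 by rewrite /D exprSr; ring.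
have dD n k (t : R) : is_derive t 1 (fun t => k * D n.+1 t) (L * (k * D n t)).
  have -> : (fun t => k * D n.+1 t) = fun t => (k * (A / (2 * L) * 2^-1 ^+ n.+1)) * expR (2 * L * t).
    by apply/funext => x; rewrite /D mulrA.
  apply: (is_derive_eq (is_derive_scaled_exp _ _ _)).
  by rewrite /D exprSr; field; rewrite gt_eqF.
have incr (f f' : R -> R) n k (t : R) : 0 <= t -> f 0 = 0 ->
    (forall x : R, 0 <= x -> is_derive x 1 f (f' x)) ->
    (forall x : R, 0 <= x -> `|f' x| <= L * (k * D n x)) -> `|f t| <= k * D n.+1 t.
  move=> t0 f0 df f'D.
  have k0 : 0 <= k * D n.+1 0.
    have := le_trans (normr_ge0 _) (f'D 0 (lexx _)); rewrite pmulr_rge0// DS mulrA.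
    by move=> ?; rewrite mulr_ge0// invr_ge0.
  rewrite -[f t]subr0 -f0; apply: (@le_trans _ _ (k * D n.+1 t - k * D n.+1 0)); last first.
    by rewrite lerBlDr lerDl.
  have oo (x : R) : x \in `]0, t[ -> 0 <= x by rewrite in_itv/= => /andP[/ltW].
  refine (@derive_bounded_increment R f f' (fun t => k * D n.+1 t) (fun t => L * (k * D n t)) 0 t t0
    (fun x xt => df x (oo x xt)) (fun x _ => dD n k x) _ _ (fun x xt => f'D x (oo x xt))).
  - apply: continuous_in_subspaceT => x; rewrite inE/= in_itv/= => /andP[/df + _].
    exact: is_derive_continuous_at.
  - by apply: continuous_subspaceT; exact: is_derive_continuous (dD n k).
have WD n i (t : R) : 0 <= t -> `|W n.+1 t i - W n t i| <= D n t.
  elim: n i t => [|n IHn] i t t0.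
    have -> : W 0%N t i = W 1%N 0 i by rewrite W0.
    apply: (le_trans (lW 1%N i 0 t (lexx _) t0)); rewrite subr0 ger0_norm//.
    rewrite /D expr0 mulr1 -mulrA ler_wpM2l// -ler_pdivrMl ?invr_gt0 ?mulr_gt0// invrK.
    by apply: le_trans (expR_ge1Dx _); rewrite lerDr.
  rewrite -[leRHS]mul1r.
  apply: (incr (fun t => W n.+2 t i - W n.+1 t i) (fun t => F (W n.+1 t) i - F (W n t) i)) => //.
  - by rewrite !W0 subrr.
  - by move=> x x0; have ? := dW n.+1 i x x0; have ? := dW n i x x0; exact: is_deriveB.
  - by move=> x x0; rewrite mul1r; apply: FL => j; exact: IHn.
have Wk n k i (t : R) : 0 <= t -> `|W (n + k)%N t i - W n t i| <= 2 * D n t - 2 * D (n + k)%N t.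
  move=> t0; elim: k => [|k IHk]; first by rewrite addn0 !subrr normr0.
  rewrite addnS DS; have -> : W (n + k).+1 t i - W n t i =
    (W (n + k).+1 t i - W (n + k)%N t i) + (W (n + k)%N t i - W n t i) by ring.
  apply: (le_trans (ler_normD _ _)); have := WD (n + k)%N i t t0; lra.
have [w Hw] : exists w : R -> I -> R, forall i (t : R) n, 0 <= t -> `|w t i - W n t i| <= 2 * D n t.
  exists (fun t i => lim ((fun n => W n t i + 2 * D n t) @ \oo)) => i t n t0.
  have ni : nonincreasing_seq (fun n => W n t i + 2 * D n t).
    apply/nonincreasing_seqP => m; rewrite DS.
    have := WD m i t t0; rewrite ler_norml; lra.
  have lb m : W 0%N t i - 2 * D 0%N t <= W m t i + 2 * D m t.
    by have := Wk 0%N m i t t0; rewrite add0n ler_norml; have := D0 m t; lra.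
  have cv : cvgn (fun n => W n t i + 2 * D n t).
    apply: nonincreasing_is_cvgn => //.
    by exists (W 0%N t i - 2 * D 0%N t) => _ [m _ <-].
  have lo : W n t i - 2 * D n t <= lim ((fun n => W n t i + 2 * D n t) @ \oo).
    apply: limr_ge => //; exists n => // m /= /subnKC <-.
    by have := Wk n (m - n)%N i t t0; rewrite ler_norml; have := D0 (n + (m - n))%N t; lra.
  have hi : lim ((fun n => W n t i + 2 * D n t) @ \oo) <= W n t i + 2 * D n t.
    by apply: limr_le => //; exists n => // m /= nm; exact: ni.
  by rewrite ler_norml; lra.
have DE n t : D n t = D 0%N t * 2^-1 ^+ n by rewrite /D expr0; ring.
have lw : lipschitz_path w.
  move=> i s t s0 t0; apply: (@le_geometric _ _ (2 * D 0%N t + 2 * D 0%N s)) => n.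
  have -> : w t i - w s i = (w t i - W n t i) + (W n t i - W n s i) - (w s i - W n s i) by ring.
  apply: (le_trans (ler_normB _ _)); apply: (le_trans (lerD (ler_normD _ _) (lexx _))).
  have := Hw i t n t0; have := Hw i s n s0; have := lW n i s t s0 t0.
  rewrite (DE n t) (DE n s); lra.
have [y0 dy] := Hstep w lw.
have yw (t : R) i : 0 <= t -> step w t i = w t i.
  move=> t0; apply/eqP; rewrite -subr_eq0 -normr_le0.
  apply: (@le_geometric _ _ (2 * D 0%N t)) => n.
  have y1 : `|step w t i - W n.+1 t i| <= 2 * D n.+1 t.
    apply: (incr (fun t => step w t i - W n.+1 t i) (fun t => F (w t) i - F (W n t) i)) => //.
    - by rewrite W0 y0 subrr.
    - by move=> x x0; have ? := dy i x x0; have ? := dW n i x x0; exact: is_deriveB.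
    - by move=> x x0; apply: FL => j; exact: Hw.
  have y2 := Hw i t n.+1 t0.
  have -> : step w t i - w t i = (step w t i - W n.+1 t i) - (w t i - W n.+1 t i) by ring.
  apply: (le_trans (ler_normB _ _)); move: y1 y2; rewrite !DS DE; lra.
exists (step w); split=> // i t t0.
rewrite (_ : step w t = w t); first exact: dy.
by apply/funext => j; exact: yw.
Qed.

End picard.

(** * Curves of bounded sequences *)

Section bounded_sequences.
Variable R : realType.

Lemma linf_norm_le (w : int -> R) (m : R) :
  (forall i, `|w i| <= m) -> (linf_norm w <= m%:E)%E.
Proof. by move=> wm; apply: ge_ereal_sup => _ [i _ <-]; rewrite lee_fin. Qed.

Lemma linf_norm_lt (w : int -> R) (m : R) :
  (linf_norm w < m%:E)%E -> forall i, `|w i| <= m.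
Proof.
move=> wm i; rewrite -lee_fin; apply: le_trans (ltW wm).
by apply: ereal_sup_ubound; exists i.
Qed.

Lemma linf_norm_ge0 (w : int -> R) : (0 <= linf_norm w)%E.
Proof.
apply: (@le_trans _ _ (`|w 0|%:E)%E); first by rewrite lee_fin.
by apply: ereal_sup_ubound; exists 0.
Qed.

Lemma linfP (w : int -> R) : linf w <-> exists m : R, forall i, `|w i| <= m.
Proof.
split=> [wl|[m wm]]; last exact: le_lt_trans (linf_norm_le wm) (ltry _).
exists (fine (linf_norm w) + 1); apply: linf_norm_lt.
rewrite -[X in (X < _)%E]fineK; first by rewrite lte_fin ltrDl.
by rewrite ge0_fin_numE// linf_norm_ge0.
Qed.

Lemma linf_norm_cvg0 (F : set_system R) (t C : R) (q : R -> int -> R) :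
  Filter F -> F --> t -> (\forall tau \near F, forall i, `|q tau i| <= C * `|tau - t|) ->
  linf_norm (q tau) @[tau --> F] --> 0%E.
Proof.
move=> FF Ft Hq; apply: (@squeeze_cvge _ _ _ _ (fun _ => 0%E) _ (fun tau => (C * `|tau - t|)%:E)).
- apply: filterS Hq => tau Hq; rewrite linf_norm_ge0/=; exact: linf_norm_le.
- exact: cvg_cst.
- apply: cvg_EFin; first exact: nearW.
  have c1 : (C * `|tau - t|) @[tau --> F] --> (C * `|t - t|).
    apply: cvgM; first exact: cvg_cst.
    by apply: cvg_norm; apply: cvgB; [exact: Ft|exact: cvg_cst].
  by move: c1; rewrite subrr normr0 mulr0.
Qed.

(** The Taylor estimates are uniform in the component, as they must be for
    differentiability in the sup norm. *)
Lemma C1_curve_linf (J : set R) (v v' : R -> int -> R) (C : R) :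
  (forall t, J t -> linf (v t) /\ linf (v' t)) ->
  (forall t tau i, J t -> J tau -> `|v tau i - v t i - (tau - t) * v' t i| <= C * `|tau - t| ^+ 2) ->
  (forall t tau i, J t -> J tau -> `|v' tau i - v' t i| <= C * `|tau - t|) ->
  C1_curve (@linf R) (@linf_norm R) J v v'.
Proof.
move=> vl dv dv'; split=> // t Jt.
- apply: (@linf_norm_cvg0 _ t C).
    by apply: (@cvg_trans _ (t^')); exact: cvg_within.
  rewrite near_withinE; near=> tau => Jtau i.
  have nt : tau != t by near: tau; exact: nbhs_dnbhs_neq.
  have nt0 : 0 < `|tau - t| by rewrite normr_gt0 subr_eq0.
  rewrite -(ler_pM2l nt0) -normrM.
  rewrite (_ : (tau - t) * _ = v tau i - v t i - (tau - t) * v' t i); last first.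
    by field; rewrite subr_eq0.
  by apply: (le_trans (dv t tau i Jt Jtau)); rewrite expr2 mulrCA.
- apply: (@linf_norm_cvg0 _ t C); first exact: cvg_within.
  by rewrite near_withinE; apply: nearW => tau Jtau i; exact: dv'.
Unshelve. all: by end_near. Qed.

Section elimination.
Variables (J : set R) (v v' : R -> int -> R).
Hypothesis vC1 : C1_curve (@linf R) (@linf_norm R) J v v'.

Lemma linf_curve_quotient (t e : R) : J t -> 0 < e ->
  \forall tau \near t, tau != t -> J tau ->
    forall i, `|(v tau i - v t i) / (tau - t) - v' t i| <= e.
Proof.
move=> Jt e0; have [_ hD _] := vC1.
have Ne : nbhs (0%E : \bar R) [set y : \bar R | (y < e%:E)%E].
  by apply: open_nbhs_nbhs; split; [exact: open_ereal_lt_ereal|rewrite /= lte_fin].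
have H : \forall tau \near t, tau != t -> J tau ->
   (linf_norm (fun i => ((v tau i - v t i) / (tau - t) - v' t i)%R) < e%:E)%E := hD t Jt _ Ne.
by apply: filterS H => tau H nt Jtau; exact: linf_norm_lt (H nt Jtau).
Qed.

Lemma linf_curve_lipschitz (t : R) : J t -> exists2 L : R, 0 <= L &
  \forall tau \near t, J tau -> forall i, `|v tau i - v t i| <= `|tau - t| * L.
Proof.
move=> Jt; have [hE _ _] := vC1; have [_ /linfP[M' HM']] := hE t Jt.
have M'0 : 0 <= M' := le_trans (normr_ge0 _) (HM' 0).
exists (1 + M'); first by rewrite addr_ge0.
have := linf_curve_quotient Jt ltr01; apply: filterS => tau H Jtau i.
have [->|nt] := eqVneq tau t; first by rewrite !subrr normr0 mul0r.
rewrite (_ : v tau i - v t i = (tau - t) * (((v tau i - v t i) / (tau - t) - v' t i) + v' t i)); last first.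
  by field; rewrite subr_eq0.
rewrite normrM ler_wpM2l//; apply: (le_trans (ler_normD _ _)).
by rewrite lerD// H.
Qed.

Lemma linf_curve_bounded (T : R) : `[0, T] `<=` J ->
  exists M : R, forall t : R, 0 <= t <= T -> forall i, `|v t i| <= M.
Proof.
move=> TJ; have inJ (t : R) : 0 <= t <= T -> J t by move=> tT; apply: TJ; rewrite /= in_itv.
apply: (@segment_locally_bounded R T (fun M t => forall i, `|v t i| <= M)) => t tT.
have [L L0 HL] := linf_curve_lipschitz (inJ t tT).
have [Mt HMt] : exists Mt, forall i, `|v t i| <= Mt.
  by have [hE _ _] := vC1; apply/linfP; exact: (hE t (inJ t tT)).1.
have near1 : \forall tau \near t, `|t - tau| <= 1.
  by have /cvgrPdist_le/(_ _ ltr01) := @cvg_id _ (nbhs t).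
exists (Mt + L); apply: filterS2 HL near1 => tau Htau tau1 M ML tauT i; apply: le_trans ML.
rewrite -[v tau i](subrK (v t i)) addrC; apply: (le_trans (ler_normD _ _)).
rewrite lerD//; apply: (le_trans (Htau (inJ tau tauT) i)).
by rewrite ler_piMl// distrC.
Qed.

Lemma linf_curve_continuous (T : R) (i : int) : `[0, T] `<=` J ->
  {within `[0, T], continuous (v^~ i)}.
Proof.
move=> TJ; have inJ (t : R) : 0 <= t <= T -> J t by move=> tT; apply: TJ; rewrite /= in_itv.
apply: segment_continuous_lipschitz => t tT.
have [L L0 HL] := linf_curve_lipschitz (inJ t tT); exists L => //.
by apply: filterS HL => tau Htau /inJ/Htau.
Qed.

Lemma linf_curve_is_derive (t : R) (i : int) : nbhs t J -> is_derive t 1 (v^~ i) (v' t i).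
Proof.
move=> nJ; have Jt : J t := nbhs_singleton nJ.
have D : h^-1 *: ((v (h *: 1 + t) i) - v t i) @[h --> (0 : R)^'] --> v' t i.
  apply/cvgrPdist_le => e e0.
  have [d /= d0 Hd] := (nbhs_ballP _ _).1 (@filterI _ (nbhs t) _ _ _ nJ (linf_curve_quotient Jt e0)).
  near=> h; have hn : h != 0 by near: h; exact: nbhs_dnbhs_neq.
  have hd : `|h| < d by near: h; exact: dnbhs0_lt.
  have [] := Hd (h + t).
    by rewrite /ball/= opprD addrCA subrr addr0 normrN.
  move=> Jh /(_ _ Jh i); rewrite -subr_eq0 addrK => /(_ hn).
  by rewrite distrC /GRing.scale/= mulr1 [h^-1 * _]mulrC.
by apply: DeriveDef; [exact: cvgP D|exact: cvg_lim D].
Unshelve. all: by end_near. Qed.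

End elimination.

End bounded_sequences.

(** * The truncated scheme *)

Definition scheme_field (R : realType) (beta : R -> R) (h : R) (z : int -> R) (i : int) : R :=
  - central_difference h (discrete_convolution h (grid h beta) z) i.

Section scheme.
Variables (R : realType) (beta f : R -> R) (B K L h : R).
Hypothesis betaB : kernel_bounds beta B.
Hypothesis hh : 0 < h <= 1.
Hypothesis K0 : 0 <= K.
Hypothesis fL : forall x : R, `|x| <= K -> `|f x| <= L.
Hypothesis fLip : forall x y : R, `|x| <= K -> `|y| <= K -> `|f x - f y| <= L * `|x - y|.

Lemma scheme_field_le (m : R) (z : int -> R) (i : int) :
  (forall j, `|z j| <= m) -> `|scheme_field beta h z i| <= B * m.
Proof. by move=> zm; rewrite normrN; exact: discrete_operator_le. Qed.

Lemma scheme_fieldB (m1 m2 m : R) (z1 z2 : int -> R) (i : int) :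
  (forall j, `|z1 j| <= m1) -> (forall j, `|z2 j| <= m2) -> (forall j, `|z1 j - z2 j| <= m) ->
  `|scheme_field beta h z1 i - scheme_field beta h z2 i| <= B * m.
Proof.
move=> z1m z2m zm; rewrite -opprD normrN -(discrete_operatorB i betaB hh z1m z2m).
exact: discrete_operator_le.
Qed.

Definition truncated_field (w : int -> R) : int -> R :=
  scheme_field beta h (fun j => f (clamp K (w j))).

Lemma truncated_field_le (w : int -> R) i : `|truncated_field w i| <= B * L.
Proof. by apply: scheme_field_le => j; apply: fL; exact: clamp_le. Qed.

Lemma kernel_bound_ge0 : 0 <= B.
Proof. by have [] := betaB 0 0 hh; rewrite big_ord0. Qed.

Lemma truncation_bound_ge0 : 0 <= L.
Proof. by apply: le_trans (fL (x := 0) _); rewrite ?normr0. Qed.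

Lemma truncated_field_lipschitz (w z : int -> R) (m : R) :
  (forall j, `|w j - z j| <= m) -> forall i,
  `|truncated_field w i - truncated_field z i| <= B * L * m.
Proof.
move=> wz i; rewrite -mulrA.
apply: (@scheme_fieldB L L).
- by move=> j; apply: fL; exact: clamp_le.
- by move=> j; apply: fL; exact: clamp_le.
move=> j; apply: (le_trans (fLip _ _)); try exact: clamp_le.
rewrite ler_wpM2l ?truncation_bound_ge0//.
by apply: le_trans (wz j); exact: clamp_contract.
Qed.

Lemma truncated_solution (v0 : int -> R) : exists w : R -> int -> R, w 0 = v0 /\
  forall i (t : R), 0 <= t -> is_derive t 1 (w^~ i) (truncated_field (w t) i).
Proof.
have BL0 : 0 <= B * L by rewrite mulr_ge0 ?kernel_bound_ge0 ?truncation_bound_ge0.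
apply: (@picard_lindelof _ _ _ _ (B * L) (B * L + 1)) => [||w z m wz i].
- by rewrite ltr_wpDl.
- exact: truncated_field_le.
- apply: (le_trans (truncated_field_lipschitz wz i)); rewrite ler_wpM2r ?lerDl//.
  exact: le_trans (normr_ge0 _) (wz 0).
Qed.

(** As long as the components stay in [-K, K] the truncation is invisible. The
    field being bounded and Lipschitz, its composition with a solution is
    Lipschitz in time uniformly in the component; hence the Taylor estimates. *)
Lemma truncated_semidiscrete_solution (phi : R -> R) (T : R) (w : R -> int -> R) :
  w 0 = grid h phi ->
  (forall i (t : R), 0 <= t -> is_derive t 1 (w^~ i) (truncated_field (w t) i)) ->
  (forall i (t : R), 0 <= t < T -> `|w t i| <= K) ->
  semidiscrete_solution beta f phi h T%:E w.
Proof.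
move=> w0 dw wK; split=> //.
have BL0 : 0 <= B * L by rewrite mulr_ge0 ?kernel_bound_ge0 ?truncation_bound_ge0.
have lw := solution_lipschitz dw (fun t i => truncated_field_le (w t) i).
have E t i : 0 <= t < T ->
    - central_difference h (discrete_convolution h (grid h beta) (fun j => f (w t j))) i =
    truncated_field (w t) i.
  move=> tT; rewrite /truncated_field /scheme_field.
  rewrite (_ : (fun j => f (w t j)) = (fun j => f (clamp K (w t j))))//.
  by apply/funext => j; rewrite clamp_id// wK.
have lF (s t : R) i : 0 <= s -> 0 <= t ->
    `|truncated_field (w t) i - truncated_field (w s) i| <= B * L * (B * L) * `|t - s|.
  by move=> s0 t0; rewrite -mulrA; apply: truncated_field_lipschitz => j; exact: lw.
apply: (@C1_curve_linf R _ _ _ (B * L * (B * L))) => [t|t tau i|t tau i].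
- rewrite /= lte_fin => /andP tT; split; apply/linfP.
    by exists K => i; exact: wK.
  by exists (B * L) => i; rewrite E//; exact: truncated_field_le.
- rewrite /= !lte_fin => /andP tT /andP tauT; rewrite E//.
  have /andP[t0 _] := tT; have /andP[tau0 _] := tauT.
  set c := truncated_field (w t) i.
  have -> : w tau i - w t i - (tau - t) * c = (w tau i - c * tau) - (w t i - c * t) by ring.
  have seg (x : R) : Num.min t tau <= x <= Num.max t tau -> 0 <= x /\ `|x - t| <= `|tau - t|.
    have [ttau|taut] := leP t tau => /andP[x1 x2].
      split; first exact: le_trans x1.
      by rewrite !ger0_norm; lra.
    split; first exact: le_trans x1.
    by rewrite !ler0_norm; lra.
  rewrite expr2 [leRHS]mulrA.
  apply: (@derive_lipschitz_on R (fun x => w x i - c * x) (fun x => truncated_field (w x) i - c)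
    (Num.min t tau) (Num.max t tau) (B * L * (B * L) * `|tau - t|)).
  + move=> x /seg[x0 _]; have ? := dw i x x0.
    by apply: is_derive_eq; rewrite /GRing.scale/=; ring.
  + move=> x /seg[x0 xt]; apply: (le_trans (lF t x i t0 x0)).
    by rewrite ler_wpM2l// mulr_ge0.
  + by rewrite ge_min le_max !lexx !orbT.
  + by rewrite ge_min le_max !lexx.
- rewrite /= !lte_fin => /andP tT /andP tauT; rewrite !E//.
  by have /andP[t0 _] := tT; have /andP[tau0 _] := tauT; exact: lF.
Qed.

End scheme.

(** * Error of the scheme *)

(** The derivative of the error is the consistency error of order [h ^ 2] plus
    the difference of two values of the truncated field, which the Lipschitz
    bound controls by the error itself; Gronwall's inequality concludes. The
    values of [u] lie in [-K, K], so that the truncated field at [u] is the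
    scheme at [u]; along [w] it is the truncation that provides the bounds. *)
Lemma truncated_scheme_error (R : realType) (beta f phi : R -> R) (u : R -> R -> R)
    (B K L M h T : R) (w : R -> int -> R) :
  continuous beta -> L1 (@lebesgue_measure R) beta -> kernel_bounds beta B ->
  0 < h <= 1 -> 0 < T -> 0 <= K ->
  (forall x : R, `|x| <= K -> `|f x| <= L) ->
  (forall x y : R, `|x| <= K -> `|y| <= K -> `|f x - f y| <= L * `|x - y|) ->
  (forall t : R, 0 <= t <= T -> (forall x, `|u t x| <= K) /\ bounded_C3 (f \o u t) M) ->
  (forall x : R, {within `[0, T], continuous (fun t => u t x)}) ->
  (forall t x : R, 0 < t < T ->
     [/\ derivable (fun tau => u tau x) t 1,
         derivable (convolution beta (f \o u t)) x 1 &
         ((fun tau => u tau x)^`())%classic t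
           + ((convolution beta (f \o u t))^`())%classic x = 0]) ->
  u 0 = phi -> w 0 = grid h phi ->
  (forall i (t : R), 0 <= t -> is_derive t 1 (w^~ i) (truncated_field beta f K h (w t) i)) ->
  forall i (t : R), 0 <= t <= T -> `|grid h (u t) i - w t i| <=
    2 * ((B + \int[@lebesgue_measure R]_y `|beta y|) * M * h ^+ 2) * T * expR (2 * (B * L + 1) * T).
Proof.
move=> cbeta ibeta betaB hh T0 K0 fL fLip uK cu hpde u0 w0 dw i t tT.
have BL0 : 0 <= B * L.
  by rewrite mulr_ge0 ?(kernel_bound_ge0 betaB hh) ?(truncation_bound_ge0 K0 fL).
have A0 : 0 <= \int[@lebesgue_measure R]_y `|beta y| by apply: Rintegral_ge0.
have BA0 := addr_ge0 (kernel_bound_ge0 betaB hh) A0.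
have M0 : 0 <= M.
  have T00 : 0 <= (0 : R) <= T by rewrite lexx ltW.
  by have [_ [? [? [? [_ /(_ 0)[b _ _ _]]]]]] := uK 0 T00; apply: le_trans b.
have lw := solution_lipschitz dw (fun t i => truncated_field_le betaB hh K0 fL (w t) i).
have oo (s : R) : s \in `]0, T[ -> 0 < s < T by rewrite in_itv.
have cc (s : R) : s \in `[0, T] -> 0 <= s <= T by rewrite in_itv.
have oc (s : R) : s \in `]0, T[ -> 0 <= s <= T by move/oo => /andP[/ltW-> /ltW->].
have tT' : t \in `[0, T] by rewrite in_itv.
refine (@sup_norm_gronwall R int (B * L + 1) _ T (K + (K + B * L * T))
  (fun t i => grid h (u t) i - w t i)
  (fun t i => ((fun tau => u tau (i%:~R * h))^`())%classic t - truncated_field beta f K h (w t) i)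
  _ _ _ _ _ _ _ _ i t tT').
- by rewrite ltr_wpDl.
- by rewrite mulr_ge0 ?sqr_ge0// mulr_ge0.
- exact: T0.
- by move=> j; rewrite u0 w0 subrr.
- move=> j; have cw : {within `[0, T], continuous (w^~ j)}.
    apply: continuous_in_subspaceT => s; rewrite inE/= in_itv/= => /andP[s0 _].
    exact: is_derive_continuous_at (dw j s s0).
  by move=> s; apply: cvgB; [exact: cu|exact: cw].
- move=> j s sT; have [du _ _] := hpde s (j%:~R * h) (oo s sT).
  have d1 : is_derive s 1 (fun tau => u tau (j%:~R * h)) (((fun tau => u tau (j%:~R * h))^`())%classic s).
    by apply: (is_derive_eq (derivableP du)); rewrite -derive1E.
  have ? := dw j s (ltW (andP (oo s sT)).1).
  exact: is_deriveB.
- move=> j s sT; have /andP[s0 sT2] := cc s sT.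
  have uK0 (r : R) : 0 <= r <= T -> `|grid h (u r) j| <= K by move=> rT; exact: (uK r rT).1.
  apply: (le_trans (ler_normB _ _)); rewrite lerD ?uK0 ?cc//.
  rewrite -[w s j](subrK (w 0 j)) addrC; apply: (le_trans (ler_normD _ _)); rewrite lerD//.
    by rewrite w0 -u0 uK0// lexx ltW.
  apply: (le_trans (lw j 0 s (lexx _) s0)).
  by rewrite subr0 ger0_norm// ler_wpM2l.
- move=> s m sT em j; have [_ dc E] := hpde s (j%:~R * h) (oo s sT).
  have [us [g1 [g2 [g3 [dg bg]]]]] := uK s (oc s sT).
  set d := ((convolution beta (f \o u s))^`())%classic (j%:~R * h) in E *.
  have dd : is_derive (j%:~R * h) 1 (convolution beta (f \o u s)) d.
    by apply: (is_derive_eq (derivableP dc)); rewrite -derive1E.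
  have dg1 (x : R) : is_derive x 1 (f \o u s) (g1 x) by have [] := dg x.
  have dg2 (x : R) : is_derive x 1 g1 (g2 x) by have [] := dg x.
  have dg3 (x : R) : is_derive x 1 g2 (g3 x) by have [] := dg x.
  have bg0 (x : R) : `|(f \o u s) x| <= M by have [] := bg x.
  have bg1 (x : R) : `|g1 x| <= M by have [] := bg x.
  have bg2 (x : R) : `|g2 x| <= M by have [] := bg x.
  have bg3 (x : R) : `|g3 x| <= M by have [] := bg x.
  have cons := discrete_convolution_consistency cbeta ibeta betaB dg1 dg2 dg3 bg0 bg1 bg2 bg3 hh dd.
  have tf : truncated_field beta f K h (grid h (u s)) j =
      - central_difference h (discrete_convolution h (grid h beta) (grid h (f \o u s))) j.
    rewrite /truncated_field /scheme_field.
    rewrite (_ : (fun j => f (clamp K (grid h (u s) j))) = grid h (f \o u s))//.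
    by apply/funext => k; rewrite clamp_id// us.
  have lip := truncated_field_lipschitz betaB hh K0 fL fLip em j.
  have m0 : 0 <= m := le_trans (normr_ge0 _) (em 0).
  move/eqP: E; rewrite addr_eq0 => /eqP->.
  set X := central_difference h _ j in cons tf.
  have -> : - d - truncated_field beta f K h (w s) j =
      (X - d) + (truncated_field beta f K h (grid h (u s)) j - truncated_field beta f K h (w s) j).
    by rewrite tf; ring.
  apply: (le_trans (ler_normD _ _)); rewrite addrC; apply: lerD cons.
  by apply: (le_trans lip); rewrite mulrDl mul1r lerDl.
Qed.

Lemma scheme_uniqueness (R : realType) (beta f : R -> R) (B K L h T : R) (v w : R -> int -> R) :
  kernel_bounds beta B -> 0 < h <= 1 -> 0 < T -> 0 <= K ->
  (forall x : R, `|x| <= K -> `|f x| <= L) ->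
  (forall x y : R, `|x| <= K -> `|y| <= K -> `|f x - f y| <= L * `|x - y|) ->
  (forall i, v 0 i = w 0 i) ->
  (forall i, {within `[0, T], continuous (v^~ i)}) ->
  (forall i, {within `[0, T], continuous (w^~ i)}) ->
  (forall i (t : R), 0 <= t <= T -> `|v t i| <= K) ->
  (forall i (t : R), 0 <= t <= T -> `|w t i| <= K) ->
  (forall i (t : R), 0 < t < T ->
    is_derive t 1 (v^~ i) (scheme_field beta h (fun j => f (v t j)) i)) ->
  (forall i (t : R), 0 < t < T ->
    is_derive t 1 (w^~ i) (scheme_field beta h (fun j => f (w t j)) i)) ->
  forall i (t : R), 0 <= t <= T -> v t i = w t i.
Proof.
move=> betaB hh T0 K0 fL fLip vw0 cv cw vK wK dv dw i t tT.
have L0 := truncation_bound_ge0 K0 fL.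
have BL0 : 0 <= B * L by rewrite mulr_ge0 ?(kernel_bound_ge0 betaB hh).
have oo (s : R) : s \in `]0, T[ -> 0 < s < T by rewrite in_itv.
have cc (s : R) : s \in `[0, T] -> 0 <= s <= T by rewrite in_itv.
have oc (s : R) : s \in `]0, T[ -> 0 <= s <= T by move/oo => /andP[/ltW-> /ltW->].
have tT' : t \in `[0, T] by rewrite in_itv.
apply/eqP; rewrite -subr_eq0 -normr_le0.
have <- : 2 * 0 * T * expR (2 * (B * L + 1) * T) = 0 by rewrite mulr0 !mul0r.
refine (@sup_norm_gronwall R int (B * L + 1) 0 T (K + K) (fun t i => v t i - w t i)
  (fun t i => scheme_field beta h (fun j => f (v t j)) i - scheme_field beta h (fun j => f (w t j)) i)
  _ _ _ _ _ _ _ _ i t tT').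
- by rewrite ltr_wpDl.
- by [].
- exact: T0.
- by move=> j; rewrite vw0 subrr.
- by move=> j s; apply: cvgB; [exact: cv|exact: cw].
- by move=> j s /oo sT; have ? := dv j s sT; have ? := dw j s sT; exact: is_deriveB.
- by move=> j s /cc sT; apply: (le_trans (ler_normB _ _)); rewrite lerD ?vK ?wK.
- move=> s m /oc sT em j; have m0 : 0 <= m := le_trans (normr_ge0 _) (em 0).
  apply: (@le_trans _ _ (B * (L * m))); last by rewrite addr0 mulrDl mul1r mulrA lerDl.
  apply: (@scheme_fieldB _ _ _ _ betaB hh L L) => k; try (apply: fL; by [exact: vK|exact: wK]).
  by apply: (le_trans (fLip _ _ (vK k s sT) (wK k s sT))); rewrite ler_wpM2l.
Qed.

(** * Convergence of the scheme *)

Lemma class_C_ball_lipschitz (R : realType) (k : nat) (f : R -> R) (K : R) :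
  class_C k f -> (4 <= k)%N -> 0 <= K -> exists L : R,
    (forall x : R, `|x| <= K -> `|f x| <= L) /\
    (forall x y : R, `|x| <= K -> `|y| <= K -> `|f x - f y| <= L * `|x - y|).
Proof.
move=> hf k4 K0; have [f1 [f2 [f3 [L [df bf]]]]] := class_C_local_bounds hf k4 K0.
exists L; split=> [x /bf[]//|x y]; apply: (@lipschitz_on_ball R f f1) => z.
  by have [] := df z.
by move=> /bf[].
Qed.

Unset Implicit Arguments.

Theorem theorem4p2 (R : realType) (s T : R) (f beta phi : R -> R)
  (nu : {charge set (measurableTypeR R) -> \bar R}) (u : R -> R -> R)
  (hs : 7 / 2 < s) (hT : 0 < T)
  (hf : class_C (Num.truncn s).+1 f) (hf0 : f 0 = 0)
  (hbeta : W11 beta) (hbetac : continuous beta)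
  (hnu : second_distributional_derivative beta nu)
  (hphi : sobolev s phi)
  (hu : exists u' : R -> R -> R,
     C1_curve (sobolev s) (sobolev_norm s) [set t | 0 <= t <= T] u u')
  (hpde : forall t x : R, 0 < t < T ->
     [/\ derivable (fun tau => u tau x) t 1,
         derivable (convolution beta (f \o u t)) x 1 &
         ((fun tau => u tau x)^`())%classic t
           + ((convolution beta (f \o u t))^`())%classic x = 0])
  (hu0 : u 0 = phi) :
  exists h0 C : R, 0 < h0 /\
    forall (h : R) (Th : \bar R) (uh : R -> int -> R),
      0 < h <= h0 ->
      maximal_semidiscrete_solution beta f phi h Th uh ->
      (T%:E <= Th)%E /\
      forall t : R, 0 <= t <= T ->
        (linf_norm (fun i => (grid h (u t) i - uh t i)%R) <= (C * h ^+ 2)%:E)%E.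
Proof.
have [u' hu'] := hu.
have k4 : (4 <= (Num.truncn s).+1)%N.
  by rewrite ltnS truncn_ge_nat; lra.
have [M HM] := sobolev_curve_bounded hs hu'.
have cu := sobolev_curve_continuous hs hu'.
have M0 : 0 <= M.
  have T00 : 0 <= (0 : R) <= T by rewrite lexx ltW.
  by have [? [? [? [_ /(_ 0)[b _ _ _]]]]] := HM 0 T00; apply: le_trans b.
have uM (t x : R) : 0 <= t <= T -> `|u t x| <= M.
  by move=> tT; have [? [? [? [_ /(_ x)[]]]]] := HM t tT.
pose K := M + 1; have K0 : 0 <= K by rewrite addr_ge0.
have [f1 [f2 [f3 [L0 [df bf]]]]] := class_C_local_bounds hf k4 K0.
have [L [fL fLip]] := class_C_ball_lipschitz hf k4 K0.
have [B B0 betaB] := W11_kernel_bounds hbetac hbeta hnu.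
have ibeta : L1 (@lebesgue_measure R) beta.
  by have [/Lfun1_integrable] := hbeta.
clear hbeta hnu nu.
pose M' := L0 * (1 + K) ^+ 3.
have uK (t : R) : 0 <= t <= T -> (forall x, `|u t x| <= K) /\ bounded_C3 (f \o u t) M'.
  move=> tT; split=> [x|]; first by apply: (le_trans (uM t x tT)); rewrite lerDl.
  by apply: (bounded_C3_comp df bf); apply: bounded_C3_le (HM t tT); rewrite lerDl.
have M'0 : 0 <= M'.
  have T00 : 0 <= (0 : R) <= T by rewrite lexx ltW.
  by have [_ [? [? [? [_ /(_ 0)[b _ _ _]]]]]] := uK 0 T00; apply: le_trans b.
have A0 : 0 <= \int[@lebesgue_measure R]_y `|beta y| by apply: Rintegral_ge0.
pose C := 2 * ((B + \int[@lebesgue_measure R]_y `|beta y|) * M') * T * expR (2 * (B * L + 1) * T).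
have C0 : 0 <= C.
  apply: mulr_ge0 (expR_ge0 _); apply: mulr_ge0 (ltW hT); apply: mulr_ge0 => //.
  exact: mulr_ge0 (addr_ge0 B0 A0) M'0.
have C1 : 0 < 2 * (1 + C) by rewrite mulr_gt0// ltr_pwDl.
(* Below this mesh [C * h ^ 2 <= 1 / 2], half of the margin of [K] over [M]; the
   other half is for the times after [T]. *)
exists (2 * (1 + C))^-1, C; split; first by rewrite invr_gt0.
move=> h Th uh /andP[h0 hC] [Th0 [uh0 uhC] Tmax].
have h1 : h <= 1.
  by apply: (le_trans hC); rewrite invf_le1//; lra.
have hh : 0 < h <= 1 by rewrite h0.
have Ch : C * h ^+ 2 <= 2^-1.
  have hC2 : h * (2 * (1 + C)) <= 1 by rewrite -ler_pdivlMr// mul1r.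
  have : C * h ^+ 2 <= C * h by rewrite expr2 mulrA ler_piMr// mulr_ge0// ltW.
  have : h * (2 * (1 + C)) = 2 * h + 2 * (C * h) by ring.
  lra.
have [w [w0 dw]] := truncated_solution betaB hh K0 fL fLip (grid h phi).
have err i (t : R) : 0 <= t <= T -> `|grid h (u t) i - w t i| <= C * h ^+ 2.
  move=> tT; apply: (le_trans (truncated_scheme_error hbetac ibeta betaB hh hT K0 fL fLip uK cu hpde hu0 w0 dw i tT)).
  by rewrite /C; apply: eq_ler; ring.
have BL0 : 0 <= B * L by rewrite mulr_ge0// (truncation_bound_ge0 K0 fL).
have lw := solution_lipschitz dw (fun t i => truncated_field_le betaB hh K0 fL (w t) i).
have wM i (t : R) : 0 <= t <= T -> `|w t i| <= M + 2^-1.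
  move=> tT; rewrite -[w t i](subKr (grid h (u t) i)).
  apply: (le_trans (ler_normB _ _)); apply: lerD; first exact: uM.
  exact: le_trans (err i t tT) Ch.
(* [B * L] bounds the speed of [w], which moves by less than [1 / 2] during
   [delta]. *)
pose delta := (2 * (B * L + 1))^-1.
have BL1 : 0 < 2 * (B * L + 1) by rewrite mulr_gt0// ltr_wpDl.
have d0 : 0 < delta by rewrite invr_gt0.
have wK i (t : R) : 0 <= t < T + delta -> `|w t i| <= K.
  move=> /andP[t0 tTd]; have [tT|Tt] := leP t T.
    apply: (le_trans (wM i t _)); first by rewrite t0.
    by rewrite /K; lra.
  rewrite -[w t i](subrK (w T i)); apply: (le_trans (ler_normD _ _)).
  have T0T : 0 <= T <= T by rewrite lexx ltW.
  have := wM i T T0T; have := lw i T t (ltW hT) t0.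
  have : B * L * `|t - T| <= 2^-1.
    apply: (@le_trans _ _ (B * L * delta)).
      by rewrite ler_wpM2l// ger0_norm ?subr_ge0 ?(ltW Tt)// lerBlDl ltW.
    by rewrite /delta ler_pdivrMr//; lra.
  rewrite /K; lra.
have sol := truncated_semidiscrete_solution betaB hh K0 fL fLip w0 dw wK.
have TTh : (T%:E < Th)%E by apply: lt_le_trans (Tmax _ _ sol); rewrite lte_fin ltrDl.
split; first exact: ltW.
have TJ : `[0, T] `<=` [set t : R | 0 <= t /\ (t%:E < Th)%E].
  move=> t; rewrite /= in_itv/= => /andP[t0 tT]; split=> //.
  by apply: le_lt_trans TTh; rewrite lee_fin.
have [Mh HMh] := linf_curve_bounded uhC TJ.
(* A ball containing the values of both solutions, on which [f] is Lipschitz. *)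
pose K2 := K + `|Mh|; have K20 : 0 <= K2 by rewrite addr_ge0.
have [L2 [fL2 fLip2]] := class_C_ball_lipschitz hf k4 K20.
have KT (t : R) : 0 <= t <= T -> 0 <= t < T + delta.
  by move=> /andP[-> tT] /=; apply: (le_lt_trans tT); rewrite ltrDl.
have cw i : {within `[0, T], continuous (w^~ i)}.
  apply: continuous_in_subspaceT => s0; rewrite inE/= in_itv/= => /andP[s00 _].
  exact: is_derive_continuous_at (dw i s0 s00).
have uhw i (t : R) : 0 <= t <= T -> uh t i = w t i.
  apply: (scheme_uniqueness betaB hh hT K20 fL2 fLip2).
  - by move=> j; rewrite uh0 w0.
  - by move=> j; have := @linf_curve_continuous R _ _ _ uhC T j TJ.
  - exact: cw.
  - move=> j r rT; apply: (le_trans (HMh r rT j)); apply: (le_trans (ler_norm _)).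
    by rewrite lerDr.
  - by move=> j r rT; apply: (le_trans (wK j r (KT r rT))); rewrite lerDl.
  - move=> j r /andP[r0 rT]; apply: (linf_curve_is_derive uhC).
    have : r \in `]0, T[ by rewrite in_itv/= r0.
    move/near_in_itvoo; apply: filterS => x; rewrite in_itv/= => /andP[x0 xT].
    by apply: TJ; rewrite /= in_itv/= !ltW.
  - move=> j r /andP[r0 rT]; have := dw j r (ltW r0).
    rewrite /truncated_field (_ : (fun j => f (clamp K (w r j))) = (fun j => f (w r j)))//.
    by apply/funext => k; rewrite clamp_id// wK// KT// !ltW.
move=> t tT; apply: linf_norm_le => i; rewrite uhw//; exact: err.
Qed.
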